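(* There exists a universal constant $K>0$ such that the following holds. Let $n,d\ge 1$ be integers and $0\le\iota\le 1$. Let $X_1,\dots,X_n$ be independent random vectors in $\mathbb{R}^d$ with $\mathbb{E}(X_{ij})=0$ and $\mathbb{E}(|X_{ij}|^{2+\iota})<\infty$ for all $1\le i\le n$, $1\le j\le d$, and with common covariance matrix $\Sigma=\mathbb{E}(X_iX_i^{\mathsf T})$. Let $Y_1,\dots,Y_n$ be independent random vectors in $\mathbb{R}^d$, independent of $(X_1,\dots,X_n)$, with $Y_i\sim\mathcal N(0,\Sigma)$. Let $Z=\max_{1\le j\le d}\sum_{i=1}^n X_{ij}$. Then for any positive scalars $\delta,\gamma$ such that $\gamma\delta>1$ and $$\varepsilon=\gamma\delta\exp\{-(\gamma^2\delta^2-1)/2\}<1,$$ there exists a random variable $Z^\dagger$ having the same distribution as $\max_{1\le j\le d}\sum_{i=1}^n Y_{ij}$ such that $$\mathbb{P}\big(|Z-Z^\dagger|\ge c_\gamma+3\delta\big)\le K\,\frac{\varepsilon+L_n(\gamma,\delta,\iota)}{1-\varepsilon}.$$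
   Context: $X_{ij}$ and $Y_{ij}$ denote the $j$-th coordinates of $X_i$ and $Y_i$. For $\gamma>0$, $c_\gamma=\gamma^{-1}\log d$. For $0\le\iota\le1$ and $\gamma,\delta>0$ with $\gamma\delta>1$, $$L_n(\gamma,\delta,\iota)=\min\Big\{\gamma^2\delta^{-1}\,\mathbb{E}\Big(\max_{1\le j\le d}\sum_{i=1}^n|X_{ij}|^3+\max_{1\le j\le d}\sum_{i=1}^n|Y_{ij}|^3\Big),\ \gamma^{\frac{4+2\iota}{3}}\delta^{-\frac{2+\iota}{3}}\sum_{i=1}^n C_i(2+\iota)\Big\},$$ where $C_i(q)=\mathbb{E}\big(\max_{1\le j\le d}|X_{ij}|^q+\max_{1\le j\le d}|Y_{ij}|^q\big)$ (expectations of nonnegative variables, possibly $+\infty$). The constant $K$ is universal: it does not depend on $n,d,\iota,\gamma,\delta$ or the distributions of the $X_i$. $Z^\dagger$ is defined on the same probability space as $Z$. *)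

(* Defs.v *)
From HB Require Import structures.
From mathcomp Require Import all_boot all_order all_algebra.
From mathcomp Require Import all_classical all_reals all_analysis.

Set Implicit Arguments.
Unset Strict Implicit.
Unset Printing Implicit Defensive.

Import Order.TTheory GRing.Theory Num.Theory.
Import numFieldNormedType.Exports.

Local Open Scope classical_set_scope.
Local Open Scope ring_scope.

Section finite_max.
Context {R : realType} {d : nat}.

(* Only meaningful for 0 < d (see vmax_attained and vmax_ub). *)
Definition vmax (x : 'I_d -> R) : R := sup (range x).

Lemma vmax_attained (x : 'I_d -> R) : (0 < d)%N -> exists j, vmax x = x j.
Proof.
move=> d0; pose j0 := Ordinal d0.
have [j _ jmax] := @arg_maxP _ _ _ j0 xpredT x isT.
exists j; apply/eqP; rewrite eq_le; apply/andP; split.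
  apply: ge_sup; first by exists (x j0), j0.
  by move=> _ [k _ <-]; exact: jmax.
apply: ub_le_sup; last by exists j.
by exists (x j) => _ [k _ <-]; exact: jmax.
Qed.

Lemma vmax_ub (x : 'I_d -> R) (j : 'I_d) : x j <= vmax x.
Proof.
apply: ub_le_sup; last by exists j.
have [k _ kmax] := @arg_maxP _ _ _ j xpredT x isT.
by exists (x k) => _ [l _ <-]; exact: kmax.
Qed.

End finite_max.

Section independence.
Context d (T : measurableType d) {R : realType} (P : probability T R).

(* Sub-families need not be mentioned: take A i := setT outside of them. *)
Definition mutually_independent d' (U : measurableType d') (n : nat)
    (X : 'I_n -> {RV P >-> U}) : Prop :=
  forall A : 'I_n -> set U, (forall i, measurable (A i)) ->
    P (\bigcap_i (X i @^-1` A i)) = (\prod_(i < n) P (X i @^-1` A i))%E.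

(* (X_1, ..., X_n) as a map into the product measurable space U^n. *)
Definition joint d' (U : measurableType d') (n : nat)
    (X : 'I_n -> {RV P >-> U}) (w : T) : n.-tuple U := [tuple X i w | i < n].

Definition independent_families d1 (U : measurableType d1) d2
    (V : measurableType d2) (m n : nat)
    (X : 'I_m -> {RV P >-> U}) (Y : 'I_n -> {RV P >-> V}) : Prop :=
  forall (A : set (m.-tuple U)) (B : set (n.-tuple V)),
    measurable A -> measurable B ->
    P ((joint X @^-1` A) `&` (joint Y @^-1` B)) =
    (P (joint X @^-1` A) * P (joint Y @^-1` B))%E.

Definition same_law d' (U : measurableType d') (f g : T -> U) : Prop :=
  forall A : set U, measurable A -> P (f @^-1` A) = P (g @^-1` A).

End independence.

Section gaussian.
Context {R : realType}.

(* The law N(0, v) on the line, for v >= 0. The case v = 0 is separate because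
   normal_prob m 0 is, by convention, the uniform law on [0, 1] and not the
   Dirac mass at m. *)
Definition centered_normal (v : R) (A : set R) : \bar R :=
  if v == 0 then \d_(0 : R) A else normal_prob 0 (Num.sqrt v) A.

(* Y ~ N(0, Sigma), Sigma possibly singular: every linear form t of Y has the
   law N(0, t Sigma t^T). *)
Definition is_gaussian_vector d (T : measurableType d) (P : probability T R)
    (k : nat) (Sigma : 'M[R]_k) (Y : {RV P >-> k.-tuple R}) : Prop :=
  forall (t : 'rV[R]_k) (A : set R), measurable A ->
    P [set w | A (\sum_(j < k) t 0 j * tnth (Y w) j)] =
    centered_normal ((t *m Sigma *m t^T) 0 0) A.

End gaussian.

Section error_term.
Context d (T : measurableType d) {R : realType} (P : probability T R).
Context (n k : nat).
Implicit Types X Y : 'I_n -> {RV P >-> k.-tuple R}.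

Definition max_sum X (w : T) : R :=
  vmax (fun j : 'I_k => \sum_(i < n) tnth (X i w) j).

Definition max_sum3 X (w : T) : R :=
  vmax (fun j : 'I_k => \sum_(i < n) `|tnth (X i w) j| ^+ 3).

Definition max_pow X (i : 'I_n) (q : R) (w : T) : R :=
  vmax (fun j : 'I_k => `|tnth (X i w) j| `^ q).

Definition Cmoment X Y (i : 'I_n) (q : R) : \bar R :=
  'E_P[fun w => (max_pow X i q w + max_pow Y i q w)%R]%E.

Definition Ln X Y (gamma delta iota : R) : \bar R :=
  mine
    ((gamma ^+ 2 * delta^-1)%:E *
     'E_P[fun w => (max_sum3 X w + max_sum3 Y w)%R])%E
    ((gamma `^ ((4 + 2 * iota) / 3) * delta `^ (- ((2 + iota) / 3)))%:E *
     \sum_(i < n) Cmoment X Y i (2 + iota))%E.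

End error_term.

Definition cgamma {R : realType} (d : nat) (gamma : R) : R :=
  gamma^-1 * ln d%:R.

Definition epsilon {R : realType} (gamma delta : R) : R :=
  gamma * delta * expR (- ((gamma ^+ 2 * delta ^+ 2 - 1) / 2)).

(* Main.v *)
Require Import Defs.
From HB Require Import structures.
From mathcomp Require Import all_boot all_order all_algebra.
From mathcomp Require Import all_classical all_reals all_analysis.
From mathcomp Require Import measurable_realfun ring lra.

(* Strassen's criterion: Z is coupled to a copy of W with |Z - Z'| <= rho off an
   event of probability about theta as soon as P(Z in A) <= P(W in A^rho) + theta
   for all A. After cutting the line into finitely many cells this is a
   fractional Hall theorem, and the resulting finite coupling is realized on the
   given probability space by the quantile transform of one Gaussian coordinate
   Y_ij, which is independent of Z and has no atoms. (If every Sigma_jj vanishes,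
   then X = Y = 0 almost surely.) The number epsilon serves only as positive
   slack, to discard the tails of Z and W.

   The inequality between sets follows from a bound on E f(F(sum_i X_i)) -
   E f(F(sum_i Y_i)), where F is the log-sum-exp function with parameter gamma,
   within c_gamma of the maximum, and f is a smooth indicator at scale delta.
   The X_i are replaced by the Y_i one at a time, averaging over all orders of
   replacement (hence Shapley weights). After truncation at 1/gamma, the softmax
   weights at a leave-one-out sum are comparable to those at both neighbouring
   mixed sums, so the third moments can be summed over i before maximizing over
   j: this is the first term of L_n. The second one comes from interpolating the
   Taylor remainder, without truncation. *)

Set Implicit Arguments.
Unset Strict Implicit.
Unset Printing Implicit Defensive.

Import Order.TTheory GRing.Theory Num.Theory.
Import numFieldNormedType.Exports.
Local Open Scope classical_set_scope.
Local Open Scope ring_scope.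

(** * Finite couplings under a Hall condition *)

(** The obstacle is the order of sum and maximum in the first term of $L_n$. Replacing one vector at
    a time naturally gives a sum over i of maxima over j, because the softmax weights met at step i
    depend on i. In one fixed order each intermediate sum serves a single i. Averaged over all
    orders, every mixed sum serves all i at once, with a weight free of i, so the sum over i can be
    taken first. For this the whole weighted double sum has to be bounded pathwise, before any
    expectation.

    Truncated vectors are neither centred nor matched in covariance. Truncation therefore acts only
    inside F: the linear and quadratic Taylor terms keep the original X_i and Y_i and cancel exactly
    in expectation, at the price of a discrepancy of third order.

    Distances: delta/4 for truncation on each side and delta/2 for the support of f give c_gamma +
    delta in the inequality between sets; cells of length delta/2 add another delta. The coupling
    thus reaches c_gamma + 2 delta, strictly below the threshold of the theorem. *)

Section fractional_hall.
Context {R : realFieldType} {I J : finType}.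
Local Open Scope set_scope.
Local Open Scope ring_scope.
Implicit Types (a : I -> R) (b : J -> R) (S : {set I}).

Definition neighbours (e : I -> pred J) (S : {set I}) : {set J} :=
  [set k | [exists i in S, e i k]].

Lemma in_neighbours (e : I -> pred J) S k :
  reflect (exists2 i, i \in S & e i k) (k \in neighbours e S).
Proof. by rewrite inE; exact: exists_inP. Qed.

Lemma neighboursU (e : I -> pred J) S1 S2 :
  neighbours e (S1 :|: S2) = neighbours e S1 :|: neighbours e S2.
Proof.
apply/finset.setP => k; rewrite finset.in_setU; apply/in_neighbours/orP.
  by case=> i /finset.setUP[iS|iS] ik; [left|right]; apply/in_neighbours; exists i.
by case=> /in_neighbours[i iS ik]; exists i; rewrite // inE iS ?orbT.
Qed.

Lemma neighboursS (e : I -> pred J) S1 S2 :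
  S1 \subset S2 -> neighbours e S1 \subset neighbours e S2.
Proof. by move=> /finset.setUidPr <-; rewrite neighboursU finset.subsetUl. Qed.

Let delta (T : eqType) (t : R) (x y : T) : R := if y == x then t else 0.

Let sum_delta (T : finType) (t : R) (x : T) (A : {set T}) :
  \sum_(y in A) delta t x y = if x \in A then t else 0.
Proof.
case: ifPn => xA.
  rewrite (bigD1 x) //= /delta eqxx big1 ?addr0// => y /andP[_ /negbTE ->]//.
by apply: big1 => y yA; rewrite /delta; case: eqP => // yx; rewrite -yx yA in xA.
Qed.

Let big_setT (T : finType) (f : T -> R) : \sum_(x in [set: T]) f x = \sum_x f x.
Proof. by apply: eq_bigl => x; rewrite inE. Qed.

Let sum_indic (T : finType) (f : T -> R) (A B : {set T}) :
  \sum_(x in A) (if x \in B then f x else 0) = \sum_(x in A :&: B) f x.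
Proof. by rewrite -big_mkcondr /=; apply: eq_bigl => x; rewrite !inE. Qed.

Let ler_sum_subset (T : finType) (f : T -> R) (A B : {set T}) :
  A \subset B -> (forall x, 0 <= f x) -> \sum_(x in A) f x <= \sum_(x in B) f x.
Proof.
move=> AB f0; rewrite [leRHS](big_setID A)/= (finset.setIidPr AB) lerDl.
exact: sumr_ge0.
Qed.

(* Push along one edge as much mass as the Hall condition allows: either an
   endpoint is exhausted, or some set becomes tight and the problem splits
   into two problems with smaller supports. *)
Lemma fractional_hall (e : I -> pred J) a b :
  (forall i, 0 <= a i) -> (forall k, 0 <= b k) ->
  (forall S, \sum_(i in S) a i <= \sum_(k in neighbours e S) b k) ->
  exists p : I -> J -> R,
    [/\ forall i k, 0 <= p i k, forall i k, ~~ e i k -> p i k = 0,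
        forall i, \sum_k p i k = a i & forall k, \sum_i p i k <= b k].
Proof.
have [n] := ubnP (#|[set i | a i != 0%R]| + #|[set k | b k != 0%R]|)%N.
elim: n a b => // n IH a b; rewrite ltnS => szn a0 b0 hall.
have [/forallP az|/forallPn[i0 ai0]] := boolP [forall i, a i == 0].
  exists (fun _ _ => 0); split=> // [i|k]; rewrite big1_eq//.
  by rewrite (eqP (az i)).
have ai0_gt0 : 0 < a i0 by rewrite lt0r ai0 a0.
have [k0 ek0 bk0] : exists2 k0, e i0 k0 & b k0 != 0.
  apply: contrapT => nk; have := hall [set i0]; rewrite big_set1 big1.
    by rewrite leNgt ai0_gt0.
  move=> k /in_neighbours[i /finset.set1P -> ik]; apply/eqP/negP => /negP bk.
  by apply: nk; exists k.
have bk0_gt0 : 0 < b k0 by rewrite lt0r bk0 b0.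
pose slack S := \sum_(k in neighbours e S) b k - \sum_(i in S) a i.
(* Exactly for these S does removing mass from [i0] and [k0] shrink the slack: capacity is lost and
   demand is not. The first of them to become tight limits [t]. *)
pose Q S := (i0 \notin S) && (k0 \in neighbours e S).
pose m0 := Num.min (a i0) (b k0).
have [t [t0 tm tQ tcase]] : exists t, [/\ 0 <= t, t <= m0,
    forall S, Q S -> t <= slack S & t = m0 \/ exists2 S, Q S & t = slack S].
  have [/existsP[S0 /andP[QS0 lS0]]|/existsPn h] :=
      boolP [exists S, Q S && (slack S < m0)].
    case: (@arg_minP _ _ _ S0 Q slack QS0) => S QS Smin.
    exists (slack S); split=> //; [by rewrite subr_ge0|exact: (le_trans (Smin _ QS0) (ltW lS0))|].
    by right; exists S.
  exists m0; split=> //; last by left.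
    by rewrite le_min !ltW.
  by move=> S QS; move: (h S); rewrite QS /= -leNgt.
pose a' i := a i - delta t i0 i.
pose b' k := b k - delta t k0 k.
have ta : t <= a i0 by apply: le_trans tm _; rewrite ge_min lexx.
have tb : t <= b k0 by apply: le_trans tm _; rewrite ge_min lexx orbT.
have a'0 i : 0 <= a' i.
  by rewrite /a' /delta; case: eqP => [->|_]; rewrite subr_ge0.
have b'0 k : 0 <= b' k.
  by rewrite /b' /delta; case: eqP => [->|_]; rewrite subr_ge0.
have hall' S : \sum_(i in S) a' i <= \sum_(k in neighbours e S) b' k.
  rewrite !sumrB !sum_delta.
  case: ifPn => iS; case: ifPn => kS.
  - by rewrite lerD2r.
  - by exfalso; move/negP: kS; apply; apply/in_neighbours; exists i0.
  - by rewrite subr0 lerBrDr addrC -lerBrDr; apply: tQ; rewrite /Q iS.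
  - by rewrite !subr0.
have sa' : [set i | a' i != 0] \subset [set i | a i != 0].
  apply/fintype.subsetP => i; rewrite !inE /a' /delta; have [->//|_] := eqVneq i i0.
  by rewrite subr0.
have sb' : [set k | b' k != 0] \subset [set k | b k != 0].
  apply/fintype.subsetP => k; rewrite !inE /b' /delta; have [->//|_] := eqVneq k k0.
  by rewrite subr0.
have fin (p : I -> J -> R) :
    [/\ forall i k, 0 <= p i k, forall i k, ~~ e i k -> p i k = 0,
        forall i, \sum_k p i k = a' i & forall k, \sum_i p i k <= b' k] ->
    exists p : I -> J -> R,
    [/\ forall i k, 0 <= p i k, forall i k, ~~ e i k -> p i k = 0,
        forall i, \sum_k p i k = a i & forall k, \sum_i p i k <= b k].
  move=> [p0 pe pa pb].
  exists (fun i k => p i k + (if i == i0 then delta t k0 k else 0)); split.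
  - by move=> i k; rewrite addr_ge0// /delta; do 2?case: ifP.
  - move=> i k eik; rewrite pe// add0r /delta; case: eqP => // ii0.
    by case: eqP => // kk0; rewrite ii0 kk0 ek0 in eik.
  - move=> i; rewrite big_split /= pa /a' {1}/delta.
    case: eqP => // _; last by rewrite big1_eq subr0 addr0.
    have := sum_delta t k0 [set: J]; rewrite inE big_setT => ->.
    by rewrite subrK.
  - move=> k; rewrite big_split /= -lerBrDr (le_trans (pb k))// /b' lerB//.
    rewrite (bigD1 i0)//= eqxx big1 ?addr0// => i /negbTE -> //.
case: tcase => [tm0|[S QS tS]].
  have /IH -/(_ a'0 b'0 hall')[p hp] :
      (#|[set i | a' i != 0%R]| + #|[set k | b' k != 0%R]| < n)%N.
    apply: leq_trans szn.
    have [tai|tbk] : t = a i0 \/ t = b k0.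
      by rewrite tm0 /m0; case: leP; [left|right].
    - rewrite -addSn leq_add ?subset_leq_card// proper_card//.
      rewrite finset.properEneq sa' andbT; apply/eqP => /finset.setP/(_ i0).
      by rewrite !inE /a' /delta eqxx tai subrr eqxx ai0.
    - rewrite -addnS leq_add ?subset_leq_card// proper_card//.
      rewrite finset.properEneq sb' andbT; apply/eqP => /finset.setP/(_ k0).
      by rewrite !inE /b' /delta eqxx tbk subrr eqxx bk0.
  exact: fin hp.
have /andP[iS kS] := QS.
have tight : \sum_(i in S) a' i = \sum_(k in neighbours e S) b' k.
  by rewrite !sumrB !sum_delta (negbTE iS) kS subr0 tS /slack opprB addrCA subrr addr0.
pose N := neighbours e S.
pose a1 i := if i \in S then a' i else 0.
pose b1 k := if k \in N then b' k else 0.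
pose a2 i := if i \in ~: S then a' i else 0.
pose b2 k := if k \in ~: N then b' k else 0.
have [||||p1 [p10 p1e p1a p1b]] := IH a1 b1.
- apply: leq_trans szn; rewrite -addSn leq_add//.
    apply: proper_card; apply/properP; split.
      apply: fintype.subset_trans sa'; apply/fintype.subsetP => i; rewrite !inE /a1.
      by case: ifP; rewrite ?eqxx.
    by exists i0; rewrite !inE // /a1 (negbTE iS) eqxx.
  apply: subset_leq_card; apply: fintype.subset_trans sb'.
  by apply/fintype.subsetP => k; rewrite !inE /b1; case: ifP; rewrite ?eqxx.
- by move=> i; rewrite /a1; case: ifP.
- by move=> k; rewrite /b1; case: ifP.
- move=> S'; rewrite !sum_indic (le_trans (hall' _))//.
  by apply: ler_sum_subset => //;
    rewrite finset.subsetI !neighboursS// ?finset.subsetIl ?finset.subsetIr.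
have [||||p2 [p20 p2e p2a p2b]] := IH a2 b2.
- apply: leq_trans szn; rewrite -addnS leq_add//.
    apply: subset_leq_card; apply: fintype.subset_trans sa'.
    by apply/fintype.subsetP => i; rewrite !inE /a2; case: ifP; rewrite ?eqxx.
  apply: proper_card; apply/properP; split.
    apply: fintype.subset_trans sb'; apply/fintype.subsetP => k; rewrite !inE /b2.
    by case: ifP; rewrite ?eqxx.
  by exists k0; rewrite !inE // /b2 finset.in_setC kS eqxx.
- by move=> i; rewrite /a2; case: ifP.
- by move=> k; rewrite /b2; case: ifP.
(* Hall's condition off the tight set: apply it to [S' :|: S] and cancel the equality on [S]. *)
- move=> S'; rewrite !sum_indic -!finset.setDE.
  have := hall' (S' :|: S).
  rewrite neighboursU (big_setID S)/= [X in _ <= X](big_setID N)/=.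
  rewrite !(finset.setIidPr _) ?finset.subsetUr// tight lerD2l.
  by rewrite !finset.setDUl !finset.setDv !finset.setU0.
apply: (fin (fun i k => p1 i k + p2 i k)); split.
- by move=> i k; rewrite addr_ge0.
- by move=> i k eik; rewrite p1e// p2e// addr0.
- move=> i; rewrite big_split/= p1a p2a /a1 /a2 finset.in_setC.
  by case: ifP; rewrite ?addr0 ?add0r.
- move=> k; rewrite big_split/= (le_trans (lerD (p1b _) (p2b _)))//.
  by rewrite /b1 /b2 finset.in_setC; case: ifP; rewrite ?addr0 ?add0r.
Qed.

End fractional_hall.

Section deficient_coupling.
Context {R : realFieldType} {I : finType}.
Local Open Scope set_scope.
Local Open Scope ring_scope.

(** One additional target of capacity [eta], adjacent to every source, turns the deficient condition
    into Hall's condition. The mass it receives is at most [eta]; redistributing it over the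
    unfilled true targets is the only way mass gets off the edges. *)
Lemma deficient_coupling (e : I -> pred I) (a b : I -> R) (eta : R) :
  0 <= eta -> (forall i, 0 <= a i) -> (forall k, 0 <= b k) ->
  \sum_i a i = \sum_k b k ->
  (forall S : {set I},
     \sum_(i in S) a i <= \sum_(k in neighbours e S) b k + eta) ->
  exists p : I -> I -> R,
    [/\ forall i k, 0 <= p i k, forall i, \sum_k p i k = a i,
        forall k, \sum_i p i k = b k & \sum_i \sum_(k | ~~ e i k) p i k <= eta].
Proof.
move=> eta0 a0 b0 ab hall.
pose e' i (k : I + 'I_1) := if k is inl k then e i k else true.
pose b' (k : I + 'I_1) := if k is inl k then b k else eta.
have [||p [p0 pe pa pb]] := @fractional_hall R I (I + 'I_1)%type e' a b' a0.
- by case.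
- move=> S; have [->|[i0 i0S]] := set_0Vmem S.
    by rewrite big_set0; apply: sumr_ge0 => -[k|k] _ /=.
  apply: le_trans (hall S) _; rewrite big_sumType/= lerD//.
    rewrite le_eqVlt; apply/orP; left; apply/eqP; apply: eq_bigl => k.
    by apply/in_neighbours/in_neighbours => -[i iS ik]; exists i.
  rewrite (bigD1 ord0)/= ?lerDl ?sumr_ge0//.
  by apply/in_neighbours; exists i0.
have pa' i : \sum_k p i (inl k) + p i (inr ord0) = a i.
  by rewrite -pa big_sumType/= big_ord1.
pose a1 i := p i (inr ord0).
pose b1 k := b k - \sum_i p i (inl k).
have b10 k : 0 <= b1 k by rewrite subr_ge0; exact: (pb (inl k)).
pose m := \sum_i a1 i.
have m0 : 0 <= m by apply: sumr_ge0 => i _; exact: p0.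
have a10 i : 0 <= a1 i by exact: p0.
have meta : m <= eta by exact: (pb (inr ord0)).
have mb : m = \sum_k b1 k.
  rewrite sumrB -ab exchange_big/= -sumrB; apply: eq_bigr => i _.
  by rewrite -pa' addrAC subrr add0r.
(* Valid also for [m = 0]: the quotient is then 0 by convention, and so is every [x i]. *)
have divK (x : I -> R) i : (forall j, 0 <= x j) -> m = \sum_j x j ->
    x i * m / m = x i.
  move=> x0 mx; have [m00|mN0] := eqVneq m 0; last by rewrite mulfK.
  rewrite m00 mulr0 mul0r; apply/esym; move: mx; rewrite m00 => /esym mx.
  exact: (psumr_eq0P (fun j _ => x0 j) mx).
(* The leftover sources [a1] and the leftover capacities [b1] have the same total [m], so they can
   be coupled as a product. *)
exists (fun i k => p i (inl k) + a1 i * b1 k / m); split.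
- by move=> i k; rewrite addr_ge0 ?divr_ge0 ?mulr_ge0 ?p0 ?b10.
- move=> i; rewrite big_split/= -mulr_suml -mulr_sumr -mb.
  by rewrite divK.
- move=> k; rewrite big_split/= -mulr_suml -mulr_suml -/m [m * _]mulrC.
  by rewrite divK// /b1 addrC subrK.
- apply: le_trans meta; apply: ler_sum => i _.
  rewrite big_split/= big1 ?add0r => [|k /(pe i (inl k))//].
  rewrite -mulr_suml -mulr_sumr -[leRHS](divK a1)// ler_wpM2r ?invr_ge0//.
  rewrite ler_wpM2l ?p0// mb [leRHS](bigID (e i))/= lerDr.
  by apply: sumr_ge0.
Qed.

End deficient_coupling.

(** * Smooth indicators and the log-sum-exp approximation of the maximum *)

Section smooth_indicator.
Context {R : realType}.
Implicit Types (f : R -> R) (A : set R).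

Lemma continuous_of_is_derive f f' : (forall x : R, is_derive x (1 : R) f (f' x)) ->
  continuous f.
Proof.
by move=> df x; apply/differentiable_continuous/derivable1_diffP; have [] := df x.
Qed.

Lemma mean_value f f' a b : a <= b -> (forall x : R, is_derive x (1 : R) f (f' x)) ->
  exists2 c, a <= c <= b & f b - f a = f' c * (b - a).
Proof.
move=> ab df.
have [] := @MVT_segment R f f' a b ab (fun x _ => df x).
  exact/continuous_subspaceT/(continuous_of_is_derive df).
by move=> c; rewrite in_itv/= => h e; exists c.
Qed.

Lemma antiderivative_left_supported f c : continuous f ->
  (forall x, x <= c -> f x = 0) ->
  exists2 F, (forall x : R, is_derive x (1 : R) F (f x)) & (forall x, x <= c -> F x = 0).
Proof.
move=> cf f0.
(* The base point lies strictly to the left of [c], so that the fundamental theorem of calculus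
   applies at every [x >= c], including [c]. *)
pose F x := (\int[lebesgue_measure]_(t in [set` `[c - 1, x]]) (f t))%R.
have F0 x : x <= c -> F x = 0.
  move=> xc; rewrite /F /Rintegral (eq_integral (fun=> 0%E)) ?integral0//.
  move=> t; rewrite inE/= in_itv/= => /andP[_ tx].
  by rewrite f0// (le_trans tx).
exists F => // x; have [xc|cx] := ltP x c.
  rewrite f0 ?ltW//.
  have dz : is_derive x (1 : R) (cst 0 : R -> R) 0 by exact: is_derive_cst.
  have xc' : nbhs x [set y | y < c] by apply: open_nbhs_nbhs; split => //; exact: open_lt.
  apply: near_eq_is_derive dz.
  by near do rewrite F0// ltW//.
have [] := @continuous_FTC1 R f (BLeft (c - 1)) x (x + 1) _ _ _ (cf x).
- by rewrite ltrDl.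
- apply: continuous_compact_integrable; first exact: segment_compact.
  exact: continuous_subspaceT.
- by rewrite /= lte_fin ltrBlDr (le_lt_trans cx)// ltrDl.
by move=> dF F'; apply: DeriveDef => //; rewrite -derive1E.
Unshelve. all: by end_near. Qed.

Definition set_dist A (x : R) : R := inf [set `|x - a| | a in A].

Lemma set_dist_le A x a : A a -> set_dist A x <= `|x - a|.
Proof.
by move=> Aa; apply: ge_inf; [exists 0 => _ [b _ <-] | exists a].
Qed.

Lemma set_dist_ge A x r : A !=set0 -> (forall a, A a -> r <= `|x - a|) ->
  r <= set_dist A x.
Proof.
move=> [a Aa] h; apply: lb_le_inf; first by exists `|x - a|, a.
by move=> _ [b Ab <-]; exact: h.
Qed.

Lemma set_dist_lip A x y : A !=set0 -> set_dist A x - set_dist A y <= `|x - y|.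
Proof.
move=> A0; rewrite lerBlDl -lerBlDr; apply: set_dist_ge => // a Aa.
rewrite lerBlDr (le_trans (set_dist_le _ Aa))//.
by rewrite [leRHS]addrC ler_distD.
Qed.

(* The indicator of the [2 r]-neighbourhood of [A] is first made Lipschitz and
   then averaged twice over intervals of length [r]. *)
Lemma smooth_indicator A (c r : R) : 0 < r -> A !=set0 -> (forall a, A a -> c <= a) ->
  exists f f1 f2 : R -> R,
  [/\ forall x : R, is_derive x (1 : R) f (f1 x) /\ is_derive x (1 : R) f1 (f2 x),
      forall x, 0 <= f x <= 1,
      forall x, A x -> f x = 1,
      forall x, f x != 0 -> exists2 a, A a & `|x - a| <= 5 * r &
      forall x y, [/\ `|f1 x| <= r^-1, `|f2 x| <= 2 * r^-1 ^+ 2 &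
        `|f2 x - f2 y| <= 4 * r^-1 ^+ 3 * `|x - y| ]].
Proof.
move=> r0 A0 Ac.
have r1 : 0 < r^-1 by rewrite invr_gt0.
pose rho := set_dist A.
(* Equal to 1 up to distance [2 * r], to 0 from distance [3 * r] on, and Lipschitz with constant
   [r^-1]. *)
pose u x := Num.max 0 (Num.min 1 (3 - r^-1 * rho x)).
have u01 x : 0 <= u x <= 1.
  by rewrite /u le_max lexx/= ge_max ler01/= ge_min lexx.
have u1 x : rho x <= 2 * r -> u x = 1.
  move=> h; have h2 : r^-1 * rho x <= 2 by rewrite mulrC ler_pdivrMr.
  rewrite /u; case: (leP 1 (3 - r^-1 * rho x)) => h3; last by lra.
  by rewrite max_r.
have u0 x : 3 * r <= rho x -> u x = 0.
  move=> h; have h2 : 3 <= r^-1 * rho x by rewrite mulrC ler_pdivlMr.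
  rewrite /u max_l// ge_min; apply/orP; right; lra.
have ulip x y : `|u x - u y| <= r^-1 * `|x - y|.
  have h1 := set_dist_lip x y A0; have h2 := set_dist_lip y x A0.
  rewrite distrC in h2.
  have {h1}h1 : r^-1 * rho x - r^-1 * rho y <= r^-1 * `|x - y|.
    by rewrite -mulrBr ler_wpM2l// ltW.
  have {h2}h2 : r^-1 * rho y - r^-1 * rho x <= r^-1 * `|x - y|.
    by rewrite -mulrBr ler_wpM2l// ltW.
  have h0 : 0 <= r^-1 * `|x - y| by rewrite mulr_ge0// ltW.
  rewrite ler_norml /u; apply/andP; move: h0 h1 h2.
  move: (r^-1 * `|x - y|) (r^-1 * rho x) (r^-1 * rho y) => p q s h0 h1 h2.
  do 2 (case: (leP 1 (3 - _)) => ?); rewrite ?(max_r ler01);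
    do 2? (case: (leP 0 (3 - _)) => ?); split; lra.
have cu : continuous u.
  move=> x; apply/cvgrPdist_lt => e e0.
  near=> y; rewrite (le_lt_trans (ulip _ _))// mulrC ltr_pdivrMr//.
  by near: y; apply: cvgr_dist_lt; rewrite ?mulr_gt0.
(* Here the lower bound of [A] matters: [u] vanishes to the left of [c - 3 * r], which anchors both
   antiderivatives. *)
have [|U dU U0] := antiderivative_left_supported (c := c - 3 * r) cu.
  move=> x xc; apply: u0; apply: set_dist_ge => // a /Ac ca.
  by rewrite distrC ger0_norm; lra.
have cU : continuous U := continuous_of_is_derive dU.
have [V dV _] := antiderivative_left_supported cU U0.
have shift f f' s : (forall x : R, is_derive x (1 : R) f (f' x)) ->
    forall x : R, is_derive x (1 : R) (fun x => f (x + s)) (f' (x + s)).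
  move=> df x.
  have ds : is_derive x (1 : R) (fun x => x + s) 1.
    by rewrite -[X in is_derive _ _ _ X]addr0; exact: is_deriveD.
  have := @is_derive1_comp R f (fun x => x + s) x _ _ (df (x + s)) ds.
  by rewrite mulr1.
(* A normalized second difference. Applied to the second antiderivative [V] it is the double average
   of [u]; it commutes with derivation, so the derivatives of [D2 V] are [D2 U] and [D2 u]. *)
pose D2 (g : R -> R) x := r^-1 ^+ 2 * (g (x + 2 * r) - 2 * g (x + r) + g x).
have dD2 g g' : (forall x : R, is_derive x (1 : R) g (g' x)) ->
    forall x : R, is_derive x (1 : R) (D2 g) (D2 g' x).
  move=> dg x; have d2 := shift _ _ (2 * r) dg x; have d1 := shift _ _ r dg x.
  have d0 := dg x.
  exact: is_deriveZ.
exists (D2 V), (D2 U), (D2 u).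
(* Two mean value steps: each value of the average is a value of [u] at most [2 * r] further right.
   The range is inherited, and the margins [2 * r] and [3 * r] of [u] become 0 and [5 * r]. *)
have VE x : exists2 z, x <= z <= x + 2 * r & D2 V x = u z.
  have dW z : is_derive z (1 : R) (fun z => V (z + r) - V z) (U (z + r) - U z).
    by apply: is_deriveB; exact: shift.
  have [|y /andP[xy yx] e1] := mean_value (a := x) (b := x + r) _ dW.
    by rewrite lerDl ltW.
  have [|z /andP[yz zy] e2] := mean_value (a := y) (b := y + r) _ dU.
    by rewrite lerDl ltW.
  exists z; first by apply/andP; split; lra.
  rewrite /D2 (_ : x + 2 * r = x + r + r); last by ring.
  have -> : V (x + r + r) - 2 * V (x + r) + V x = u z * r * r.
    rewrite e2 in e1.
    rewrite (_ : u z * r * r = u z * (y + r - y) * (x + r - x)); last by ring.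
    by rewrite -e1; ring.
  by rewrite expr2; field; rewrite gt_eqF.
split.
- by move=> x; split; exact: dD2.
- by move=> x; have [z _ ->] := VE x.
- move=> x Ax; have [z /andP[xz zx] ->] := VE x.
  apply: u1; apply: le_trans (set_dist_le _ Ax) _.
  by rewrite ger0_norm; lra.
- move=> x; have [z /andP[xz zx] ->] := VE x => uz.
  apply: contrapT => na; move/eqP: uz; apply; apply: u0.
  apply: set_dist_ge => // a Aa; rewrite leNgt; apply/negP => za.
  apply: na; exists a => //; rewrite (le_trans (ler_distD z _ _))//.
  by rewrite distrC ger0_norm; lra.
- move=> x y; split.
  + have [|z1 _ e1] := mean_value (a := x) (b := x + r) _ dU; first by rewrite lerDl ltW.
    have [|z2 _ e2] := mean_value (a := x + r) (b := x + r + r) _ dU.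
      by rewrite lerDl ltW.
    rewrite /D2 (_ : x + 2 * r = x + r + r); last by ring.
    have -> : U (x + r + r) - 2 * U (x + r) + U x = (u z2 - u z1) * r.
      rewrite (_ : _ * r = u z2 * (x + r + r - (x + r)) - u z1 * (x + r - x)); last by ring.
      by rewrite -e1 -e2; ring.
    rewrite (_ : _ * _ = r^-1 * (u z2 - u z1)); last first.
      by rewrite expr2; field; rewrite gt_eqF.
    rewrite normrM gtr0_norm// ler_piMr ?(ltW r1)//.
    by have := u01 z1; have := u01 z2; rewrite ler_norml; lra.
  + rewrite /D2 normrM ger0_norm ?exprn_ge0 ?(ltW r1)// mulrC ler_wpM2r//.
      by rewrite exprn_ge0// ltW.
    have := u01 x; have := u01 (x + r); have := u01 (x + 2 * r).
    by rewrite ler_norml; lra.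
  + rewrite /D2 -mulrBr normrM ger0_norm ?exprn_ge0 ?(ltW r1)//.
    rewrite (_ : 4 * _ * _ = r^-1 ^+ 2 * (4 * (r^-1 * `|x - y|))); last by ring.
    rewrite ler_wpM2l ?exprn_ge0 ?(ltW r1)//.
    have := ulip x y; have := ulip (x + r) (y + r).
    have := ulip (x + 2 * r) (y + 2 * r).
    rewrite !(_ : forall s, x + s - (y + s) = x - y); [|by move=> s; ring..].
    move: (r^-1 * _) => p; rewrite !ler_norml; lra.
Unshelve. all: by end_near. Qed.

End smooth_indicator.

Section taylor.
Context {R : realType}.

Lemma is_derive1M (f g : R -> R) (x a b : R) :
  is_derive x (1 : R) f a -> is_derive x (1 : R) g b ->
  is_derive x (1 : R) (fun y => f y * g y) (f x * b + g x * a).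
Proof. by move=> df dg; exact: is_deriveM. Qed.

Lemma is_derive1_sum n (f : 'I_n -> R -> R) (x : R) (a : 'I_n -> R) :
  (forall i, is_derive x (1 : R) (f i) (a i)) ->
  is_derive x (1 : R) (fun y => \sum_(i < n) f i y) (\sum_(i < n) a i).
Proof.
move=> df; rewrite (_ : (fun y => _) = \sum_(i < n) f i); first exact: is_derive_sum.
by apply/funext => y; rewrite fct_sumE.
Qed.

Lemma lipschitz_of_derive_bound (h h1 : R -> R) (a b C : R) : a <= b ->
  (forall x : R, is_derive x (1 : R) h (h1 x)) ->
  (forall t, a <= t <= b -> `|h1 t| <= C) -> `|h b - h a| <= C * (b - a).
Proof.
move=> ab dh bh; have [c ac ->] := mean_value ab dh.
by rewrite normrM (ger0_norm (_ : 0 <= b - a)) ?subr_ge0// ler_wpM2r ?subr_ge0 ?bh.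
Qed.

(** The mean value inequality, applied twice to the remainder. Only the oscillation of [h2] enters,
    because the second derivative of a test function is merely Lipschitz. *)
Lemma taylor2 (h h1 h2 : R -> R) (C : R) :
  (forall x : R, is_derive x (1 : R) h (h1 x)) ->
  (forall x : R, is_derive x (1 : R) h1 (h2 x)) ->
  (forall t, 0 <= t <= 1 -> `|h2 t - h2 0| <= C) ->
  `|h 1 - h 0 - h1 0 - h2 0 / 2| <= C.
Proof.
move=> dh dh1 bh2.
have C0 : 0 <= C by apply: le_trans (bh2 0 _); rewrite ?lexx ?ler01.
pose q t := h t - h 0 - h1 0 * t - (h2 0 / 2) * t ^+ 2.
pose q1 t := h1 t - h1 0 - h2 0 * t.
have dq x : is_derive x (1 : R) q (q1 x).
  rewrite (_ : q1 x = h1 x - 0 - h1 0 * 1 - (h2 0 / 2) * (x * 1 + x * 1)); last by rewrite /q1;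
    field.
  have d2 := is_derive1M (is_derive_id x 1) (is_derive_id x 1).
  exact: is_deriveB.
have dq1 x : is_derive x (1 : R) q1 (h2 x - h2 0).
  rewrite (_ : h2 x - h2 0 = h2 x - 0 - h2 0 * 1); last by ring.
  exact: is_deriveB.
have bq1 t : 0 <= t <= 1 -> `|q1 t| <= C.
  move=> /andP[t0 t1].
  have -> : q1 t = q1 t - q1 0 by rewrite /q1 subrr mulr0 !subr0.
  have hs s : 0 <= s <= t -> `|h2 s - h2 0| <= C.
    by move=> /andP[s0 st]; rewrite bh2// s0 (le_trans st).
  apply: le_trans (lipschitz_of_derive_bound t0 dq1 hs) _.
  by rewrite subr0 ler_piMr.
have := lipschitz_of_derive_bound ler01 dq bq1.
rewrite /q subr0 !mulr1 expr1n mulr1 subrr expr2 !mulr0 !subr0 /=.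
exact.
Qed.

End taylor.

(** * Softmax moments and the derivatives of log-sum-exp *)

Section softmax.
Context {R : realType} {d : nat} (gamma : R).
Hypotheses (d0 : (0 < d)%N) (gamma0 : 0 < gamma).
Implicit Types (w v : 'I_d -> R).

Definition partition_function w : R := \sum_(j < d) expR (gamma * w j).
Definition lse w : R := gamma^-1 * ln (partition_function w).
Definition softmax w (j : 'I_d) : R := expR (gamma * w j) / partition_function w.
Definition softmax_moment w v (k : nat) : R := \sum_(j < d) softmax w j * v j ^+ k.

Local Notation ray w v t := (fun j => w j + v j * t).

Lemma partition_function_gt0 w : 0 < partition_function w.
Proof.
rewrite /partition_function (bigD1 (Ordinal d0))//= ltr_pwDl ?expR_gt0//.
by apply: sumr_ge0 => j _; exact: expR_ge0.
Qed.

Lemma softmax_ge0 w j : 0 <= softmax w j.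
Proof. by rewrite divr_ge0 ?expR_ge0// ltW// partition_function_gt0. Qed.

Lemma sum_softmax w : \sum_(j < d) softmax w j = 1.
Proof. by rewrite -mulr_suml divff// gt_eqF// partition_function_gt0. Qed.

Lemma vmax_le_lse w : vmax w <= lse w.
Proof.
have [j ->] := vmax_attained w d0.
rewrite /lse mulrC ler_pdivlMr// -[leLHS]expRK ler_ln ?posrE ?expR_gt0 ?partition_function_gt0//.
rewrite mulrC /partition_function (bigD1 j)//= lerDl.
by apply: sumr_ge0 => i _; exact: expR_ge0.
Qed.

Lemma lse_le_vmax w : lse w <= vmax w + cgamma d gamma.
Proof.
rewrite /lse /cgamma -[vmax w](mulKf (lt0r_neq0 gamma0)) -mulrDr.
rewrite ler_wpM2l ?invr_ge0 ?(ltW gamma0)//.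
rewrite -[X in X + _]expRK -lnM ?posrE ?expR_gt0 ?ltr0n//.
rewrite ler_ln ?posrE ?mulr_gt0 ?expR_gt0 ?ltr0n ?partition_function_gt0//.
have -> : expR (gamma * vmax w) * d%:R = \sum_(j < d) expR (gamma * vmax w).
  by rewrite sumr_const card_ord mulr_natr.
apply: ler_sum => j _; rewrite ler_expR ler_wpM2l ?(ltW gamma0)//.
exact: vmax_ub.
Qed.

(** Numerator of the [k]-th softmax moment along a ray; deriving in [t] multiplies by [gamma] and
    raises [k] by one. *)
Let num w v k t := \sum_(j < d) v j ^+ k * expR (gamma * (w j + v j * t)).

Let num0 w v t : partition_function (ray w v t) = num w v 0 t.
Proof. by apply: eq_bigr => j _; rewrite expr0 mul1r. Qed.

Let softmax_momentE w v k t :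
  softmax_moment (ray w v t) v k = num w v k t * (num w v 0 t)^-1.
Proof.
rewrite /softmax_moment /num mulr_suml; apply: eq_bigr => j _.
by rewrite /softmax num0 mulrC mulrA.
Qed.

Let num_gt0 w v t : 0 < num w v 0 t.
Proof. by rewrite -num0 partition_function_gt0. Qed.

Let is_derive_num w v k t :
  is_derive t (1 : R) (num w v k) (gamma * num w v k.+1 t).
Proof.
have -> : gamma * num w v k.+1 t =
    \sum_(j < d) v j ^+ k * (expR (gamma * (w j + v j * t)) * (gamma * v j)).
  by rewrite /num mulr_sumr; apply: eq_bigr => j _; rewrite exprSr; ring.
apply: is_derive1_sum => j; apply: is_deriveZ.
apply: (@is_derive1_comp _ expR (fun t => gamma * (w j + v j * t))).
have dl : is_derive t (1 : R) (fun t => w j + v j * t) (0 + v j * 1).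
  exact: is_deriveD.
by rewrite mulr1 add0r in dl; exact: is_deriveZ.
Qed.

Lemma is_derive_lse w v t :
  is_derive t (1 : R) (fun t => lse (ray w v t)) (softmax_moment (ray w v t) v 1).
Proof.
rewrite (_ : (fun t => _) = fun t => gamma^-1 * ln (num w v 0 t)); last first.
  by apply/funext => s; rewrite /lse num0.
rewrite softmax_momentE.
have -> : num w v 1 t * (num w v 0 t)^-1 =
    gamma^-1 * ((num w v 0 t)^-1 * (gamma * num w v 1 t)).
  by field; rewrite !gt_eqF.
have dln := is_derive1_ln (num_gt0 w v t).
have dn := is_derive_num w v 0 t.
by apply: is_deriveZ; exact: is_derive1_comp.
Qed.

(** The softmax weights form an exponential family, so the derivative is [gamma] times the
    covariance of [v ^+ k] and [v] under them. *)
Lemma is_derive_softmax_moment w v k t :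
  is_derive t (1 : R) (fun t => softmax_moment (ray w v t) v k)
    (gamma * (softmax_moment (ray w v t) v k.+1
      - softmax_moment (ray w v t) v k * softmax_moment (ray w v t) v 1)).
Proof.
rewrite (_ : (fun t => _) = fun t => num w v k t * (num w v 0 t)^-1); last first.
  by apply/funext => s; rewrite softmax_momentE.
rewrite !softmax_momentE.
have -> : gamma * (num w v k.+1 t / num w v 0 t -
      num w v k t / num w v 0 t * (num w v 1 t / num w v 0 t)) =
    num w v k t * (- num w v 0 t ^- 2 * (gamma * num w v 1 t)) +
      (num w v 0 t)^-1 * (gamma * num w v k.+1 t).
  by field; rewrite gt_eqF.
have dn := is_derive_num w v 0 t.
by apply: is_derive1M => //; apply: is_deriveV; rewrite gt_eqF.
Qed.

End softmax.

(** A smooth indicator at scale [delta] has bounds of order [delta^-1], [delta^-2] and [delta^-3].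
    As [delta^-1 <= gamma], all factors but the first are relaxed to [gamma], the scale of the
    derivatives of [lse]; [B] is a multiple of [delta^-1]. *)
Record smooth_test (R : realType) (gamma B : R) (f f1 f2 : R -> R) : Prop :=
  SmoothTest {
    test_derive : forall x : R, is_derive x (1 : R) f (f1 x);
    test_derive2 : forall x : R, is_derive x (1 : R) f1 (f2 x);
    test_range : forall x, 0 <= f x <= 1;
    test_bound1 : forall x, `|f1 x| <= B;
    test_bound2 : forall x, `|f2 x| <= B * gamma;
    test_lip2 : forall x y, `|f2 x - f2 y| <= B * gamma ^+ 2 * `|x - y| }.

Section softmax_taylor.
Context {R : realType} {d : nat} (gamma B : R) (f f1 f2 : R -> R).
Hypotheses (d0 : (0 < d)%N) (gamma0 : 0 < gamma).
Hypothesis tf : smooth_test gamma B f f1 f2.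
Implicit Types (w v : 'I_d -> R).

Local Notation ray w v t := (fun j => w j + v j * t).
Local Notation lse := (lse gamma).
Local Notation softmax := (softmax gamma).
Local Notation M := (softmax_moment gamma).

(** With [hess_form]: the first and second derivatives at [t = 0] of [f] composed with [lse] along
    [w + t v]. *)
Definition grad_form w v : R := f1 (lse w) * M w v 1.
Definition hess_form w v : R :=
  f2 (lse w) * M w v 1 ^+ 2 + gamma * f1 (lse w) * (M w v 2 - M w v 1 ^+ 2).

Definition abs_moment w v k : R := \sum_(j < d) softmax w j * `|v j| ^+ k.

Lemma test_bound_ge0 : 0 <= B.
Proof. exact: le_trans (test_bound1 tf 0). Qed.

Lemma abs_moment_ge0 w v k : 0 <= abs_moment w v k.
Proof. by apply: sumr_ge0 => j _; rewrite mulr_ge0 ?softmax_ge0 ?exprn_ge0. Qed.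

Lemma softmax_moment_le w v k : `|M w v k| <= abs_moment w v k.
Proof.
apply: le_trans (ler_norm_sum _ _ _) _; apply: ler_sum => j _.
by rewrite normrM normrX ger0_norm// softmax_ge0.
Qed.

(* Chebyshev's sum inequality for [|v|] and [|v|^2]. *)
Lemma abs_moment12 w v : abs_moment w v 1 * abs_moment w v 2 <= abs_moment w v 3.
Proof.
have S1 := sum_softmax gamma d0 w.
have Z1 : (\sum_(i < d) expR (gamma * w i)) / partition_function gamma w = 1.
  by rewrite mulr_suml.
have : 0 <= \sum_(j < d) \sum_(k < d) softmax w j * softmax w k *
    ((`|v j| - `|v k|) * (`|v j| ^+ 2 - `|v k| ^+ 2)).
  apply: sumr_ge0 => j _; apply: sumr_ge0 => k _.
  apply: mulr_ge0; first by rewrite mulr_ge0 ?softmax_ge0.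
  rewrite subr_sqr mulrA -expr2.
  by rewrite mulr_ge0 ?sqr_ge0 ?addr_ge0.
have -> : \sum_(j < d) \sum_(k < d) softmax w j * softmax w k *
    ((`|v j| - `|v k|) * (`|v j| ^+ 2 - `|v k| ^+ 2)) =
    2 * abs_moment w v 3 - 2 * (abs_moment w v 1 * abs_moment w v 2).
  transitivity (\sum_(j < d) (softmax w j * `|v j| ^+ 3 * 1
      - softmax w j * `|v j| ^+ 1 * abs_moment w v 2
      - softmax w j * `|v j| ^+ 2 * abs_moment w v 1
      + softmax w j * abs_moment w v 3)).
    apply: eq_bigr => j _.
    rewrite -{1}S1 /abs_moment !mulr_sumr -!sumrB -big_split/=.
    by apply: eq_bigr => k _; ring.
  rewrite big_split/= !sumrB -!mulr_suml Z1 -/(abs_moment w v 3).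
  by rewrite -/(abs_moment w v 1) -/(abs_moment w v 2); ring.
by lra.
Qed.

Lemma abs_moment1_sqr w v : abs_moment w v 1 ^+ 2 <= abs_moment w v 2.
Proof.
have S1 := sum_softmax gamma d0 w.
have Z1 : (\sum_(i < d) expR (gamma * w i)) / partition_function gamma w = 1.
  by rewrite mulr_suml.
have : 0 <= \sum_(j < d) softmax w j * (`|v j| - abs_moment w v 1) ^+ 2.
  by apply: sumr_ge0 => j _; rewrite mulr_ge0 ?softmax_ge0 ?sqr_ge0.
have -> : \sum_(j < d) softmax w j * (`|v j| - abs_moment w v 1) ^+ 2 =
    \sum_(j < d) (softmax w j * `|v j| ^+ 2
      - softmax w j * `|v j| ^+ 1 * (2 * abs_moment w v 1)
      + softmax w j * abs_moment w v 1 ^+ 2).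
  by apply: eq_bigr => j _; ring.
rewrite big_split/= sumrB -!mulr_suml Z1 -/(abs_moment w v 1) -/(abs_moment w v 2).
by lra.
Qed.

Lemma abs_moment1_cube w v : abs_moment w v 1 ^+ 3 <= abs_moment w v 3.
Proof.
apply: le_trans (abs_moment12 w v); rewrite exprS ler_wpM2l ?abs_moment_ge0//.
exact: abs_moment1_sqr.
Qed.

(** Every term in the variation of the second derivative is of degree three in [v]: a third moment,
    a product of a first and a second one, or the cube of a first one. The bounds [A1], [A2], [A3]
    are left abstract to serve both small increments, where they are moments at [w], and arbitrary
    ones, where they are powers of the sup norm. *)
Lemma taylor_lse w v (A1 A2 A3 : R) :
  (forall t, 0 <= t <= 1 -> [/\ abs_moment (ray w v t) v 1 <= A1,
     abs_moment (ray w v t) v 2 <= A2 & abs_moment (ray w v t) v 3 <= A3]) ->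
  A1 * A2 <= A3 -> A1 ^+ 3 <= A3 ->
  `|f (lse (fun j => w j + v j)) - f (lse w) - grad_form w v - hess_form w v / 2|
    <= 13 * (B * gamma ^+ 2 * A3).
Proof.
move=> bA A12 A111; have B0 := test_bound_ge0.
pose phi t := lse (ray w v t).
pose m k t := M (ray w v t) v k.
have bm k t A : abs_moment (ray w v t) v k <= A -> `|m k t| <= A.
  by apply: le_trans; exact: softmax_moment_le.
have m1b t : 0 <= t <= 1 -> `|m 1%N t| <= A1 by move=> /bA[/bm].
have m2b t : 0 <= t <= 1 -> `|m 2%N t| <= A2 by move=> /bA[_ /bm].
have m3b t : 0 <= t <= 1 -> `|m 3%N t| <= A3 by move=> /bA[_ _ /bm].
have I0 : 0 <= (0 : R) <= 1 by rewrite lexx ler01.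
have A10 : 0 <= A1 by apply: le_trans (m1b _ I0).
have A20 : 0 <= A2 by apply: le_trans (m2b _ I0).
have A30 : 0 <= A3 by apply: le_trans (m3b _ I0).
have dphi t : is_derive t (1 : R) phi (m 1%N t) by exact: is_derive_lse.
have dm k t : is_derive t (1 : R) (m k) (gamma * (m k.+1 t - m k t * m 1%N t)).
  exact: is_derive_softmax_moment.
pose V t := m 2%N t - m 1%N t * m 1%N t.
have dV t : is_derive t (1 : R) V (gamma * (m 3%N t - m 2%N t * m 1%N t) -
    (m 1%N t * (gamma * (m 2%N t - m 1%N t * m 1%N t)) +
     m 1%N t * (gamma * (m 2%N t - m 1%N t * m 1%N t)))).
  by apply: is_deriveB; exact: is_derive1M.
pose h1 t := f1 (phi t) * m 1%N t.
pose h2 t := f2 (phi t) * m 1%N t * m 1%N t + gamma * f1 (phi t) * V t.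
have dh t : is_derive t (1 : R) (fun t => f (phi t)) (h1 t).
  have df := test_derive tf (phi t).
  exact: (is_derive1_comp (f := f) (g := phi)).
have dh1 t : is_derive t (1 : R) h1 (h2 t).
  have df := test_derive2 tf (phi t).
  have dc := is_derive1_comp (f := f1) (g := phi) df (dphi t).
  rewrite (_ : h2 t = f1 (phi t) * (gamma * (m 2%N t - m 1%N t * m 1%N t)) +
    m 1%N t * (f2 (phi t) * m 1%N t)); last by rewrite /h2 /V; ring.
  exact: is_derive1M.
have m1sq t : 0 <= t <= 1 -> `|m 1%N t * m 1%N t| <= A1 ^+ 2.
  by move=> /m1b h; rewrite normrM expr2 ler_pM.
have mul1 t k A : `|m k t| <= A -> 0 <= t <= 1 -> `|m k t * m 1%N t| <= A * A1.
  by move=> h /m1b h'; rewrite normrM ler_pM.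
have Vb t : 0 <= t <= 1 -> `|V t| <= A2 + A1 ^+ 2.
  by move=> tI; rewrite (le_trans (ler_normB _ _))// lerD ?m2b ?m1sq.
have sub (F F' : R -> R) C : 0 <= C -> (forall t, is_derive t (1 : R) F (F' t)) ->
    (forall t, 0 <= t <= 1 -> `|F' t| <= C) ->
    forall t, 0 <= t <= 1 -> `|F t - F 0| <= C.
  move=> C0 dF bF t /andP[t0 t1].
  have bF' s : 0 <= s <= t -> `|F' s| <= C.
    by move=> /andP[s0 st]; rewrite bF// s0 (le_trans st).
  apply: le_trans (lipschitz_of_derive_bound t0 dF bF') _.
  by rewrite subr0 ler_piMr.
have phib := sub _ _ _ A10 dphi m1b.
have gA : 0 <= gamma * (A2 + A1 ^+ 2) by rewrite mulr_ge0 ?addr_ge0 ?exprn_ge0 ?(ltW gamma0).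
have m1l := sub _ _ _ gA (dm 1%N) _.
have {}m1l t : 0 <= t <= 1 -> `|m 1%N t - m 1%N 0| <= gamma * (A2 + A1 ^+ 2).
  apply: m1l => s sI; rewrite normrM (gtr0_norm gamma0) ler_wpM2l ?(ltW gamma0)//.
  by rewrite (le_trans (ler_normB _ _))// lerD ?m2b ?m1sq.
have gA' : 0 <= gamma * (A3 + 3 * (A1 * A2) + 2 * A1 ^+ 3).
  by rewrite mulr_ge0 ?addr_ge0 ?mulr_ge0 ?exprn_ge0 ?(ltW gamma0).
have Vl := sub _ _ _ gA' dV _.
have {}Vl t : 0 <= t <= 1 ->
    `|V t - V 0| <= gamma * (A3 + 3 * (A1 * A2) + 2 * A1 ^+ 3).
  apply: Vl => s sI.
  rewrite (_ : _ - _ = gamma * (m 3%N s - m 2%N s * m 1%N s - 2 * (m 1%N s * V s))); last first.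
    by rewrite /V; ring.
  rewrite normrM (gtr0_norm gamma0) ler_wpM2l ?(ltW gamma0)//.
  have := m3b _ sI; have := mul1 _ _ _ (m2b _ sI) sI.
  have : `|m 1%N s * V s| <= A1 * (A2 + A1 ^+ 2) by rewrite normrM ler_pM ?m1b ?Vb.
  move: (m 3%N s) (m 2%N s * m 1%N s) (m 1%N s * V s) => x y z.
  rewrite !ler_norml => /andP[z1 z2] /andP[y1 y2] /andP[x1 x2].
  have e3 : A1 ^+ 3 = A1 * A1 ^+ 2 by ring.
  rewrite e3; apply/andP; split; lra.
(* The increment is split into four, one factor varying at a time. In units of [B * gamma ^+ 2 * A3]
   they cost 1, 4, 2 and 6, hence 13. *)
have key t : 0 <= t <= 1 -> `|h2 t - h2 0| <= 13 * (B * gamma ^+ 2 * A3).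
  move=> tI.
  have f1l : `|f1 (phi t) - f1 (phi 0)| <= B * gamma * A1.
    have bf1 s : 0 <= s <= 1 -> `|f2 (phi s) * m 1%N s| <= B * gamma * A1.
      by move=> sI; rewrite normrM ler_pM ?(test_bound2 tf) ?m1b.
    apply: (sub (fun s => f1 (phi s)) (fun s => f2 (phi s) * m 1%N s)) => //.
      by rewrite !mulr_ge0// ltW.
    move=> s; have df := test_derive2 tf (phi s).
    exact: (is_derive1_comp (f := f1) (g := phi)).
  have f2l : `|f2 (phi t) - f2 (phi 0)| <= B * gamma ^+ 2 * A1.
    apply: le_trans (test_lip2 tf _ _) _.
    by rewrite ler_wpM2l ?phib// mulr_ge0// exprn_ge0// ltW.
  have -> : h2 t - h2 0 =
      (f2 (phi t) - f2 (phi 0)) * (m 1%N t * m 1%N t) +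
      f2 (phi 0) * ((m 1%N t - m 1%N 0) * (m 1%N t + m 1%N 0)) +
      gamma * ((f1 (phi t) - f1 (phi 0)) * V t) +
      gamma * (f1 (phi 0) * (V t - V 0)).
    by rewrite /h2; ring.
  have b1 : `|(f2 (phi t) - f2 (phi 0)) * (m 1%N t * m 1%N t)| <=
      B * gamma ^+ 2 * A1 ^+ 3.
    rewrite normrM [A1 ^+ 3]exprS mulrA.
    by apply: ler_pM => //; exact: m1sq.
  have b2 : `|f2 (phi 0) * ((m 1%N t - m 1%N 0) * (m 1%N t + m 1%N 0))| <=
      B * gamma ^+ 2 * (2 * (A1 * A2) + 2 * A1 ^+ 3).
    rewrite (_ : B * _ * _ = (B * gamma) * ((gamma * (A2 + A1 ^+ 2)) * (A1 + A1))); last by ring.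
    rewrite normrM; apply: ler_pM => //; first exact: test_bound2 tf _.
    rewrite normrM; apply: ler_pM => //; first exact: m1l.
    by rewrite (le_trans (ler_normD _ _))// lerD// m1b.
  have b3 : `|gamma * ((f1 (phi t) - f1 (phi 0)) * V t)| <=
      B * gamma ^+ 2 * (A1 * A2 + A1 ^+ 3).
    rewrite (_ : B * _ * _ = gamma * (B * gamma * A1 * (A2 + A1 ^+ 2))); last by ring.
    rewrite normrM (gtr0_norm gamma0) ler_wpM2l ?(ltW gamma0)//.
    by rewrite normrM; apply: ler_pM => //; exact: Vb.
  have b4 : `|gamma * (f1 (phi 0) * (V t - V 0))| <=
      B * gamma ^+ 2 * (A3 + 3 * (A1 * A2) + 2 * A1 ^+ 3).
    rewrite (_ : B * _ * _ = gamma * (B * (gamma * (A3 + 3 * (A1 * A2) + 2 * A1 ^+ 3))));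
      last by ring.
    rewrite normrM (gtr0_norm gamma0) ler_wpM2l ?(ltW gamma0)//.
    by rewrite normrM; apply: ler_pM => //; [exact: test_bound1 tf _|exact: Vl].
  have BG : 0 <= B * gamma ^+ 2 by rewrite mulr_ge0 ?exprn_ge0 ?(ltW gamma0).
  have c1 : B * gamma ^+ 2 * A1 ^+ 3 <= B * gamma ^+ 2 * A3 by rewrite ler_wpM2l.
  have c2 : B * gamma ^+ 2 * (A1 * A2) <= B * gamma ^+ 2 * A3 by rewrite ler_wpM2l.
  rewrite (le_trans (ler_normD _ _))// (le_trans (lerD (ler_normD _ _) (lexx _)))//.
  rewrite (le_trans (lerD (lerD (ler_normD _ _) (lexx _)) (lexx _)))//.
  apply: le_trans (lerD (lerD (lerD b1 b2) b3) b4) _.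
  by rewrite !mulrDr; lra.
have := taylor2 dh dh1 key.
have e0 : ray w v 0 = w by apply/funext => j; rewrite mulr0 addr0.
have e1 : ray w v 1 = (fun j => w j + v j) by apply/funext => j; rewrite mulr1.
rewrite /h2 /h1 /phi /V /m e0 e1 -mulrA -!expr2.
exact.
Qed.

End softmax_taylor.

(** * Error of replacing a single vector *)

Section swapping_errors.
Context {R : realType} {d : nat} (gamma B : R) (f f1 f2 : R -> R).
Hypotheses (d0 : (0 < d)%N) (gamma0 : 0 < gamma).
Hypothesis tf : smooth_test gamma B f f1 f2.
Implicit Types (w v x : 'I_d -> R).
Local Notation lse := (lse gamma).
Local Notation softmax := (softmax gamma).
Local Notation grad := (grad_form gamma f1).
Local Notation hess := (hess_form gamma f1 f2).
Local Notation abs_moment := (abs_moment gamma).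

(** Each exponential changes by a factor of at most [expR s], once in the numerator and once in the
    partition function. *)
Lemma softmax_stable w v s j : 0 <= s -> (forall i, `|v i| <= s * gamma^-1) ->
  softmax (fun i => w i + v i) j <= expR (2 * s) * softmax w j.
Proof.
move=> s0 vs.
have gv i : `|gamma * v i| <= s.
  by rewrite normrM (gtr0_norm gamma0) mulrC -ler_pdivlMr.
have Zw := partition_function_gt0 gamma d0 w.
rewrite /softmax ler_pdivrMr ?partition_function_gt0//.
have h1 : expR (gamma * (w j + v j)) <= expR s * expR (gamma * w j).
  rewrite -expRD ler_expR mulrDr addrC lerD2r.
  exact: le_trans (ler_norm _) (gv _).
have h2 : partition_function gamma w <=
    expR s * partition_function gamma (fun i => w i + v i).
  rewrite /partition_function mulr_sumr; apply: ler_sum => i _.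
  rewrite -expRD ler_expR mulrDr addrA addrAC lerDr.
  have := gv i; rewrite ler_norml => /andP[h _].
  by rewrite addrC -lerBlDr sub0r.
have -> : expR (2 * s) = expR s * expR s by rewrite -expRD mulr2n mulrDl mul1r.
apply: le_trans h1 _; set Z' := (X in _ <= _ * X) in h2 *.
rewrite (_ : _ * Z' = expR s * expR (gamma * w j) *
  (expR s * Z' / partition_function gamma w)); last by ring.
by rewrite ler_peMr ?mulr_ge0 ?expR_ge0// ler_pdivlMr// mul1r.
Qed.

Lemma taylor_lse_local w v : (forall j, `|v j| <= gamma^-1) ->
  `|f (lse (fun j => w j + v j)) - f (lse w) - grad w v - hess w v / 2|
    <= 13 * (B * gamma ^+ 2 * (expR 2 ^+ 3 * abs_moment w v 3)).
Proof.
move=> vb; have e1 : 1 <= expR (2 : R) by rewrite -expR0 ler_expR.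
have e0 : 0 <= expR (2 : R) by exact: expR_ge0.
have st t k : 0 <= t <= 1 ->
    abs_moment (fun j => w j + v j * t) v k <= expR 2 * abs_moment w v k.
  move=> /andP[t0 t1]; rewrite /abs_moment mulr_sumr; apply: ler_sum => j _.
  rewrite mulrA ler_wpM2r ?exprn_ge0//.
  have := @softmax_stable w (fun j => v j * t) 1 j ler01; rewrite mulr1; apply => i.
  by rewrite mul1r normrM (ger0_norm t0) (le_trans _ (vb i))// ler_piMr.
have am0 k : 0 <= abs_moment w v k by exact: abs_moment_ge0.
(* The factor [expR 2] would do for each moment; its powers 1, 2, 3 are chosen so that
   [A1 * A2 <= A3] and [A1 ^+ 3 <= A3] follow from the same relations between the moments at [w]. *)
apply: (taylor_lse d0 gamma0 tf (A1 := expR 2 * abs_moment w v 1)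
  (A2 := expR 2 ^+ 2 * abs_moment w v 2)).
- move=> t tI; split; first exact: st.
    apply: le_trans (st _ _ tI) _; rewrite ler_wpM2r// expr2 ler_peMr//.
  apply: le_trans (st _ _ tI) _; rewrite ler_wpM2r// exprS ler_peMr//.
  exact: exprn_ege1.
- rewrite mulrACA -exprS ler_wpM2l ?exprn_ge0//; exact: abs_moment12.
- rewrite exprMn ler_wpM2l ?exprn_ge0//; exact: abs_moment1_cube.
Qed.

Lemma taylor_lse_global w v m : (forall j, `|v j| <= m) ->
  `|f (lse (fun j => w j + v j)) - f (lse w) - grad w v - hess w v / 2|
    <= 13 * (B * gamma ^+ 2 * m ^+ 3).
Proof.
move=> vm; have m0 : 0 <= m by apply: le_trans (vm (Ordinal d0)).
have st w' k : abs_moment w' v k <= m ^+ k.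
  rewrite -[leRHS]mul1r -(sum_softmax gamma d0 w') mulr_suml.
  by apply: ler_sum => j _; rewrite ler_wpM2l ?softmax_ge0// lerXn2r// nnegrE.
apply: (taylor_lse d0 gamma0 tf (A1 := m) (A2 := m ^+ 2)) => //.
Qed.

Definition truncate (a : R) : R := if `|a| <= gamma^-1 then a else 0.

Lemma truncate_le a : `|truncate a| <= gamma^-1.
Proof. by rewrite /truncate; case: ifP => // _; rewrite normr0 invr_ge0 ltW. Qed.

Lemma truncate_norm a : `|truncate a| <= `|a|.
Proof. by rewrite /truncate; case: ifP => // _; rewrite normr0. Qed.

(** Beyond the threshold [gamma * |a|] exceeds 1, so its square may be inserted as a factor. *)
Lemma truncate_err a : `|truncate a - a| <= gamma ^+ 2 * `|a| ^+ 3.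
Proof.
rewrite /truncate; case: ifPn => [_|].
  by rewrite subrr normr0 mulr_ge0 ?exprn_ge0// ltW.
rewrite -ltNge => h; rewrite sub0r normrN.
have ga : 1 <= gamma * `|a| by rewrite -ler_pdivrMl// mulr1 ltW.
rewrite [X in _ * X]exprSr mulrA -exprMn ler_peMl//.
exact: exprn_ege1.
Qed.

(** If the larger factor survives truncation, so does the smaller one. Otherwise the product is at
    most the square of the larger factor, and [gamma * |a| >= 1] supplies the third power. *)
Lemma truncate_mul_err a b :
  `|truncate a * truncate b - a * b| <= gamma * (`|a| ^+ 3 + `|b| ^+ 3).
Proof.
wlog ab : a b / `|b| <= `|a|.
  move=> h; have [/h//|/ltW/h] := leP `|b| `|a|.
  by rewrite (mulrC (truncate b)) (mulrC b) (addrC (`|b| ^+ 3)).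
have g0 := ltW gamma0.
rewrite {1}/truncate; case: ifPn => [h|].
  rewrite /truncate (le_trans ab h) subrr normr0.
  by rewrite mulr_ge0 ?addr_ge0 ?exprn_ge0.
rewrite -ltNge => h; rewrite mul0r sub0r normrN normrM.
have ga : 1 <= gamma * `|a| by rewrite -ler_pdivrMl// mulr1 ltW.
apply: (@le_trans _ _ (gamma * `|a| ^+ 3)); last first.
  by rewrite ler_wpM2l// lerDl exprn_ge0.
rewrite exprS mulrA (le_trans (ler_wpM2l _ ab))// -expr2 ler_peMl//.
Qed.

(** Taylor's formula is applied to the truncated increment, then [x] itself is restored in the
    linear and quadratic terms. The restoration costs 1 in the gradient and half of 6 in the
    Hessian, whence the summand 4. *)
Lemma swap_error_local w x :
  `|f (lse (fun j => w j + truncate (x j))) - f (lse w) - grad w x - hess w x / 2|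
    <= (13 * expR 2 ^+ 3 + 4) * (B * gamma ^+ 2 * abs_moment w x 3).
Proof.
have g0 := ltW gamma0; have B0 := test_bound_ge0 tf.
pose tx j := truncate (x j).
have am0 : 0 <= abs_moment w x 3 by exact: abs_moment_ge0.
have BG : 0 <= B * gamma ^+ 2 by rewrite mulr_ge0 ?exprn_ge0.
have p0 j : 0 <= softmax w j by exact: softmax_ge0.
have T : `|f (lse (fun j => w j + tx j)) - f (lse w) - grad w tx - hess w tx / 2|
    <= 13 * expR 2 ^+ 3 * (B * gamma ^+ 2 * abs_moment w x 3).
  apply: le_trans (taylor_lse_local w (fun j => truncate_le (x j))) _.
  rewrite -[leRHS]mulrA [leRHS](_ : _ =
    13 * (B * gamma ^+ 2 * (expR 2 ^+ 3 * abs_moment w x 3))); last by ring.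
  rewrite ler_wpM2l// ler_wpM2l// ler_wpM2l ?exprn_ge0 ?expR_ge0//.
  by apply: ler_sum => j _; rewrite ler_wpM2l// lerXn2r ?nnegrE// truncate_norm.
have m1E : softmax_moment gamma w tx 1 - softmax_moment gamma w x 1 =
    \sum_(j < d) softmax w j * (tx j - x j).
  by rewrite -sumrB; apply: eq_bigr => j _; rewrite !expr1 mulrBr.
have G : `|grad w tx - grad w x| <= B * gamma ^+ 2 * abs_moment w x 3.
  rewrite -mulrBr m1E normrM -mulrA ler_pM ?(test_bound1 tf)//.
  apply: le_trans (ler_norm_sum _ _ _) _; rewrite mulr_sumr; apply: ler_sum => j _.
  by rewrite normrM ger0_norm// mulrCA ler_wpM2l// truncate_err.
have Q1 : `|softmax_moment gamma w tx 1 ^+ 2 - softmax_moment gamma w x 1 ^+ 2|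
    <= 2 * (gamma * abs_moment w x 3).
  have sq y : softmax_moment gamma w y 1 ^+ 2 =
      \sum_(j < d) \sum_(k < d) softmax w j * softmax w k * (y j * y k).
    rewrite expr2 mulr_suml; apply: eq_bigr => j _; rewrite mulr_sumr.
    by apply: eq_bigr => k _; rewrite !expr1; ring.
  have -> : 2 * (gamma * abs_moment w x 3) =
      \sum_(j < d) \sum_(k < d) softmax w j * softmax w k *
        (gamma * (`|x j| ^+ 3 + `|x k| ^+ 3)).
    transitivity (\sum_(j < d) (softmax w j * `|x j| ^+ 3 * gamma
        + softmax w j * (gamma * abs_moment w x 3))).
      have Z1 : (\sum_(i < d) expR (gamma * w i)) / partition_function gamma w = 1.
        by rewrite mulr_suml; exact: sum_softmax.
      rewrite big_split/= -!mulr_suml Z1 -/(abs_moment w x 3); ring.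
    apply: eq_bigr => j _.
    rewrite -[X in X + _]mulr1 -{1}(sum_softmax gamma d0 w) /abs_moment.
    rewrite !mulr_sumr -big_split/=.
    by apply: eq_bigr => k _; ring.
  rewrite !sq -sumrB (le_trans (ler_norm_sum _ _ _))//; apply: ler_sum => j _.
  rewrite -sumrB (le_trans (ler_norm_sum _ _ _))//; apply: ler_sum => k _.
  have pp : 0 <= softmax w j * softmax w k by exact: mulr_ge0 (p0 _) (p0 _).
  rewrite -mulrBr normrM ger0_norm// ler_wpM2l//.
  exact: truncate_mul_err.
have Q2 : `|softmax_moment gamma w tx 2 - softmax_moment gamma w x 2|
    <= 2 * (gamma * abs_moment w x 3).
  rewrite -sumrB (le_trans (ler_norm_sum _ _ _))// /abs_moment !mulr_sumr.
  apply: ler_sum => j _; rewrite -mulrBr normrM ger0_norm//.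
  rewrite (_ : 2 * _ = softmax w j * (gamma * (`|x j| ^+ 3 + `|x j| ^+ 3))); last by ring.
  by rewrite ler_wpM2l// !expr2 truncate_mul_err.
have H : `|hess w tx - hess w x| <= 6 * (B * gamma ^+ 2 * abs_moment w x 3).
  rewrite /hess_form.
  move: Q1 Q2; set a := _ ^+ 2; set a' := _ ^+ 2; set b := softmax_moment _ _ _ _.
  set b' := softmax_moment _ _ _ _ => Q1 Q2.
  rewrite (_ : _ - _ = f2 (lse w) * (a - a') + gamma * f1 (lse w) * ((b - b') - (a - a')));
    last by ring.
  rewrite (_ : 6 * _ = B * gamma * (2 * (gamma * abs_moment w x 3)) +
    gamma * B * (2 * (gamma * abs_moment w x 3) + 2 * (gamma * abs_moment w x 3))); last by ring.
  rewrite (le_trans (ler_normD _ _))// lerD//.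
    by rewrite normrM ler_pM ?(test_bound2 tf).
  rewrite normrM ler_pM// ?normrM ?(gtr0_norm gamma0) ?ler_wpM2l ?(test_bound1 tf)//.
  by rewrite (le_trans (ler_normB _ _))// lerD.
rewrite (_ : _ - _ - _ - _ / 2 = (f (lse (fun j => w j + tx j)) - f (lse w) - grad w tx
  - hess w tx / 2) + (grad w tx - grad w x) + (hess w tx - hess w x) / 2); last by rewrite /tx;
    field.
move: T G H; move: (B * _ * _) => C T G H.
apply: le_trans (ler_normD _ _) _.
apply: le_trans (lerD (le_trans (ler_normD _ _) (lerD T G)) (lexx _)) _.
rewrite normrM (@ger0_norm _ 2^-1) ?invr_ge0//.
by move: H; lra.
Qed.

End swapping_errors.

Section global_swapping_error.
Context {R : realType} {d : nat} (gamma delta C : R) (f f1 f2 : R -> R).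
Hypotheses (d0 : (0 < d)%N) (gamma0 : 0 < gamma) (delta0 : 0 < delta).
Hypotheses (gd : 1 <= gamma * delta) (C1 : 1 <= C).
Hypothesis tf : smooth_test gamma (C / delta) f f1 f2.
Implicit Types (w v : 'I_d -> R).
Local Notation lse := (lse gamma).
Local Notation grad := (grad_form gamma f1).
Local Notation hess := (hess_form gamma f1 f2).

(** Cube roots give [y <= a^(2/3)], and for a base of at least 1 the exponent may grow. *)
Lemma le_powR_of_cube_le_sqr (a y theta : R) : 1 <= a -> 0 <= y ->
  2 / 3 <= theta -> y ^+ 3 <= a ^+ 2 -> y <= a `^ theta.
Proof.
move=> a1 y0 th ya; have a0 : 0 <= a by apply: le_trans a1.
apply: (@le_trans _ _ (a `^ (2 / 3))); last exact: ler_powR.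
have -> : y = (y ^+ 3) `^ (3^-1).
  by rewrite -powR_mulrn// -powRrM mulfV ?powRr1.
have -> : a `^ (2 / 3) = (a ^+ 2) `^ (3^-1).
  by rewrite -powR_mulrn// -powRrM.
by apply: ge0_ler_powR; rewrite ?nnegrE ?invr_ge0 ?exprn_ge0.
Qed.

(** Interpolation with [theta = (2 + iota) / 3] and [a] the size of the third-order remainder: the
    claimed bound is a multiple of [a^theta]. If [a <= 1], then [a <= a^theta] and the remainder
    estimate suffices. If [a > 1], the increment of [f], the gradient and the Hessian are bounded
    separately by multiples of 1, [m / delta] and [gamma * m ^+ 2 / delta]; these are at most
    [a^theta] because [theta >= 2 / 3] and [gamma * delta >= 1]. *)
Lemma swap_error_global (iota m : R) w v : 0 <= iota <= 1 ->
  (forall j, `|v j| <= m) ->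
  `|f (lse (fun j => w j + v j)) - f (lse w) - grad w v - hess w v / 2|
    <= 13 * C * (gamma `^ ((4 + 2 * iota) / 3) * delta `^ (- ((2 + iota) / 3)) *
                 m `^ (2 + iota)).
Proof.
move=> /andP[i0 i1] vm.
have m0 : 0 <= m by apply: le_trans (vm (Ordinal d0)).
have g0 := ltW gamma0; have C0 : 0 <= C by apply: le_trans C1.
pose a := gamma ^+ 2 * delta^-1 * m ^+ 3; pose theta := (2 + iota) / 3.
have a0 : 0 <= a by rewrite !mulr_ge0 ?exprn_ge0 ?invr_ge0// ltW.
have -> : gamma `^ ((4 + 2 * iota) / 3) * delta `^ (- ((2 + iota) / 3)) *
    m `^ (2 + iota) = a `^ theta.
  rewrite /a powRM ?mulr_ge0 ?exprn_ge0 ?invr_ge0 ?(ltW delta0)//.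
  rewrite powRM ?exprn_ge0 ?invr_ge0 ?(ltW delta0)//.
  rewrite -!powR_mulrn// -!powRrM -(powR_inv1 (ltW delta0)) -powRrM.
  by congr (_ `^ _ * _ `^ _ * _ `^ _); rewrite /theta; field.
have th1 : theta <= 1 by rewrite /theta; lra.
have th2 : 2 / 3 <= theta by rewrite /theta; lra.
have th0 : 0 <= theta by rewrite /theta; lra.
have [a1|a1] := leP a 1.
  apply: le_trans (taylor_lse_global d0 gamma0 tf w vm) _.
  have -> : 13 * (C / delta * gamma ^+ 2 * m ^+ 3) = 13 * C * a by rewrite /a; ring.
  rewrite ler_wpM2l ?mulr_ge0//.
  have [->|aN0] := eqVneq a 0; first exact: powR_ge0.
  by apply: ger1_powR => //; rewrite a1 andbT lt0r aN0.
have st k : abs_moment gamma w v k <= m ^+ k.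
  rewrite -[leRHS]mul1r -[X in X * _](sum_softmax gamma d0 w) mulr_suml.
  by apply: ler_sum => j _; rewrite ler_wpM2l ?softmax_ge0// lerXn2r// nnegrE.
have M k : `|softmax_moment gamma w v k| <= m ^+ k.
  by apply: le_trans (st k); exact: softmax_moment_le.
have M11 : `|softmax_moment gamma w v 1 ^+ 2| <= m ^+ 2.
  by rewrite normrX lerXn2r// ?nnegrE// -[leRHS]expr1.
have G : `|grad w v| <= C * (m / delta).
  rewrite normrM (_ : C * _ = C / delta * m); last by ring.
  by rewrite ler_pM ?(test_bound1 tf)// -[leRHS]expr1.
have H : `|hess w v| <= 3 * (C * (gamma * m ^+ 2 / delta)).
  rewrite /hess_form (_ : 3 * _ = C / delta * gamma * m ^+ 2 +
    gamma * (C / delta) * (m ^+ 2 + m ^+ 2)); last by ring.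
  rewrite (le_trans (ler_normD _ _))// lerD//.
    by rewrite normrM ler_pM ?(test_bound2 tf).
  rewrite normrM ler_pM// ?normrM ?(gtr0_norm gamma0) ?ler_wpM2l ?(test_bound1 tf)//.
  by rewrite (le_trans (ler_normB _ _))// lerD.
have F : `|f (lse (fun j => w j + v j)) - f (lse w)| <= 1.
  have := test_range tf (lse (fun j => w j + v j)); have := test_range tf (lse w).
  by rewrite ler_norml; lra.
have e1 : 1 <= a `^ theta.
  by rewrite -[leLHS](powRr0 a); apply: ler_powR => //; exact: ltW.
have ad : 1 <= a * (gamma * delta) ^+ 2.
  by rewrite mulr_ege1 ?(ltW a1)// exprn_ege1.
(* [a ^+ 2] is [(m / delta) ^+ 3] times [a * (gamma * delta) ^+ 2]; in [e3] it is the cube of the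
   left-hand side times [gamma * delta]. Both extra factors are at least 1. *)
have e2 : m / delta <= a `^ theta.
  apply: le_powR_of_cube_le_sqr; rewrite ?(ltW a1)// ?divr_ge0 ?(ltW delta0)//.
  rewrite -[leLHS]mulr1.
  apply: le_trans (ler_wpM2l _ ad) _; first by rewrite exprn_ge0 ?divr_ge0 ?(ltW delta0).
  by rewrite le_eqVlt; apply/orP; left; apply/eqP; rewrite /a; field; rewrite gt_eqF.
have e3 : gamma * m ^+ 2 / delta <= a `^ theta.
  apply: le_powR_of_cube_le_sqr; rewrite ?(ltW a1)// ?divr_ge0 ?mulr_ge0 ?exprn_ge0 ?(ltW delta0)//.
  rewrite -[leLHS]mulr1.
  apply: le_trans (ler_wpM2l _ gd) _.
    by rewrite exprn_ge0 ?divr_ge0 ?mulr_ge0 ?exprn_ge0 ?(ltW delta0).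
  by rewrite le_eqVlt; apply/orP; left; apply/eqP; rewrite /a; field; rewrite gt_eqF.
have {}e1 : 1 <= C * a `^ theta by rewrite mulr_ege1.
have {}e2 : C * (m / delta) <= C * a `^ theta by rewrite ler_wpM2l.
have {}e3 : C * (gamma * m ^+ 2 / delta) <= C * a `^ theta by rewrite ler_wpM2l.
rewrite -mulrA; move: F G H e1 e2 e3; move: (C * a `^ theta) (C * (m / delta)) (C * (_ / _)).
move=> x y z; rewrite !ler_norml => /andP[? ?] /andP[? ?] /andP[? ?] ? ? ?.
by apply/andP; split; lra.
Qed.

End global_swapping_error.

(** * Averages over random orderings *)

Section shapley.
Context {R : realFieldType} {I : finType}.
Local Open Scope set_scope.
Local Open Scope ring_scope.
Implicit Types (S : {set I}) (i : I).

(* The average weights of [S] in a uniformly random ordering: the probability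
   that [S] is exactly the set of predecessors of a given element outside [S],
   and the probability that [S] is the initial segment of uniformly random length. *)
Definition shapley_weight S : R := (#|I| * 'C(#|I|.-1, #|S|))%:R^-1.
Definition segment_weight S : R := (#|I|.+1 * 'C(#|I|, #|S|))%:R^-1.

Lemma shapley_weight_ge0 S : 0 <= shapley_weight S.
Proof. by rewrite invr_ge0. Qed.

Lemma segment_weight_ge0 S : 0 <= segment_weight S.
Proof. by rewrite invr_ge0. Qed.

Let card_lt S i : i \notin S -> (#|S| < #|I|)%N.
Proof.
move=> iS; rewrite -cardsT; apply: proper_card; apply/properP; split.
  exact: finset.subsetT.
by exists i; rewrite ?inE.
Qed.

(** With N elements and s of them in [S], the two segment weights are the fractions (N - s) / (N +
    1) and (s + 1) / (N + 1) of the Shapley weight. *)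
Lemma shapley_weight_split S i : i \notin S ->
  shapley_weight S = segment_weight S + segment_weight (i |: S).
Proof.
move=> iS; have sI := card_lt iS.
rewrite /shapley_weight /segment_weight cardsU1 iS add1n.
have I0 : (0 < #|I|)%N by apply: leq_ltn_trans sI.
have c1 := mul_bin_down #|I| #|S|; have c2 := mul_bin_diag #|I| #|S|.
have C1 : (0 < 'C(#|I|, #|S|))%N by rewrite bin_gt0 ltnW.
have C2 : (0 < 'C(#|I|, #|S|.+1))%N by rewrite bin_gt0.
have -> : (#|I|.+1 * 'C(#|I|, #|S|))%:R^-1 =
    (#|I| - #|S|)%:R / (#|I|.+1%:R * (#|I| * 'C(#|I|.-1, #|S|))%:R) :> R.
  rewrite c1 !natrM; field.
  by rewrite nat1r !pnatr_eq0 -!lt0n C1 !subn_gt0 sI.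
have -> : (#|I|.+1 * 'C(#|I|, #|S|.+1))%:R^-1 =
    #|S|.+1%:R / (#|I|.+1%:R * (#|I| * 'C(#|I|.-1, #|S|))%:R) :> R.
  rewrite c2 !natrM; field.
  by rewrite !nat1r !pnatr_eq0 -!lt0n C2.
rewrite -mulrDl -natrD addnS (subnK (ltnW sI)).
rewrite invfM mulrA divff ?mul1r//; by rewrite pnatr_eq0.
Qed.

Lemma sum_setU1 (F : {set I} -> R) i :
  \sum_(S : {set I} | i \notin S) F (i |: S) = \sum_(S : {set I} | i \in S) F S.
Proof.
rewrite [RHS](reindex_onto (fun S : {set I} => i |: S) (fun S : {set I} => S :\ i : {set I})) /=;
  last first.
  by move=> S iS; rewrite finset.setD1K.
apply: eq_bigl => S; rewrite finset.setU11 /=; apply/idP/eqP => [iS|<-].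
  by rewrite finset.setU1K.
by rewrite finset.setD11.
Qed.

Lemma sum_segment_weight : \sum_(S : {set I}) segment_weight S = 1.
Proof.
rewrite (partition_big (fun S : {set I} => inord #|S| : 'I_#|I|.+1) xpredT)//=.
rewrite (eq_bigr (fun=> #|I|.+1%:R^-1)) => [|k _].
  by rewrite sumr_const card_ord -[_^-1 *+ _]mulr_natr mulVf// pnatr_eq0.
rewrite (eq_bigl (fun S : {set I} => #|S| == k)) => [|S]; last first.
  have : (#|S| < #|I|.+1)%N by rewrite ltnS max_card.
  by move=> lt; rewrite -val_eqE /= inordK.
rewrite (eq_bigr (fun=> (#|I|.+1 * 'C(#|I|, k))%:R^-1)) => [|S /eqP <-//].
rewrite (eq_bigl (fun S : {set I} => S \in [set S : {set I} | #|S| == k])) => [|S];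
  last by rewrite inE.
rewrite sumr_const card_draws -[LHS]mulr_natr natrM invfM -mulrA mulVf ?mulr1//.
by rewrite pnatr_eq0 -lt0n bin_gt0 -ltnS.
Qed.

(** The weight of a swap at [S] is shared between its two ends [S] and [i |: S], and every subset is
    such an end exactly once. The right-hand side has lost its dependence on [i] except through [H],
    which is what allows summing over [i] at fixed [S]. *)
Lemma shapley_bound i (u H : {set I} -> R) :
  (forall S, i \notin S -> u S <= H S) ->
  (forall S, i \notin S -> u S <= H (i |: S)) ->
  \sum_(S : {set I} | i \notin S) shapley_weight S * u S <= \sum_(S : {set I}) segment_weight S *
    H S.
Proof.
move=> uH uHU; rewrite [leRHS](bigID (fun S : {set I} => i \in S))/= addrC.
rewrite -(sum_setU1 (fun S : {set I} => segment_weight S * H S)) -big_split/=.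
apply: ler_sum => S iS; rewrite (shapley_weight_split iS) mulrDl.
by rewrite lerD// ler_wpM2l ?segment_weight_ge0 ?uH ?uHU.
Qed.

Lemma sum_shapley_weight i : \sum_(S : {set I} | i \notin S) shapley_weight S = 1.
Proof.
rewrite -sum_segment_weight [RHS](bigID (fun S : {set I} => i \in S))/= addrC.
rewrite -(sum_setU1 segment_weight) -big_split/=.
by apply: eq_bigr => S iS; exact: shapley_weight_split.
Qed.

(** The efficiency property of the Shapley value: the telescoping sum along an ordering, averaged
    over all orderings. Each [S] enters with the same coefficient as the upper and as the lower end
    of a swap, so only the full set, never a lower end, and the empty set, never an upper end,
    remain. *)
Lemma shapley_efficiency (G : {set I} -> R) : (0 < #|I|)%N ->
  G [set: I] - G finset.set0 =
  \sum_i \sum_(S : {set I} | i \notin S) shapley_weight S * (G (i |: S) - G S).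
Proof.
move=> I0.
(* The probability that [S] is an initial segment of a uniformly random ordering. *)
pose c S : R := ('C(#|I|, #|S|))%:R^-1.
have cE S i : i \in S -> shapley_weight (S :\ i) = #|S|%:R^-1 * c S.
  move=> iS; rewrite /shapley_weight /c -invfM -natrM mul_bin_diag.
  by have := cardsD1 i S; rewrite iS add1n => <-.
have cE' S i : i \notin S -> shapley_weight S = (#|I| - #|S|)%:R^-1 * c S.
  by move=> iS; rewrite /shapley_weight /c -invfM -natrM mul_bin_down.
have term1 : \sum_i \sum_(S : {set I} | i \notin S) shapley_weight S * G (i |: S) =
    \sum_(S : {set I} | S != finset.set0) c S * G S.
  transitivity (\sum_i \sum_(S : {set I} | i \in S) #|S|%:R^-1 * c S * G S).
    apply: eq_bigr => i _.
    rewrite -(sum_setU1 (fun S : {set I} => #|S|%:R^-1 * c S * G S)).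
    by apply: eq_bigr => S iS; rewrite -(cE _ i) ?finset.setU11// finset.setU1K.
  rewrite (exchange_big_dep xpredT)//= [RHS]big_mkcond; apply: eq_bigr => S _.
  rewrite sumr_const; case: ifPn => [S0|/negPn/eqP ->]; last by rewrite cards0 mulr0n.
  by rewrite -[LHS]mulr_natr mulrC !mulrA divff ?mul1r// pnatr_eq0 cards_eq0.
have term2 : \sum_i \sum_(S : {set I} | i \notin S) shapley_weight S * G S =
    \sum_(S : {set I} | S != [set: I]) c S * G S.
  transitivity (\sum_i \sum_(S : {set I} | i \notin S) (#|I| - #|S|)%:R^-1 * c S * G S).
    by apply: eq_bigr => i _; apply: eq_bigr => S iS; rewrite -(cE' _ _ iS).
  rewrite (exchange_big_dep xpredT)//= [RHS]big_mkcond; apply: eq_bigr => S _.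
  rewrite (eq_bigl (fun i => i \in ~: S)) => [|i]; last by rewrite inE.
  rewrite sumr_const; have -> : #|~: S| = (#|I| - #|S|)%N by rewrite cardsCs finset.setCK.
  case: ifPn => [S0|/negPn/eqP ->]; last by rewrite cardsT subnn mulr0n.
  rewrite -[LHS]mulr_natr mulrC !mulrA divff ?mul1r// pnatr_eq0 -lt0n subn_gt0.
  by rewrite -cardsT proper_card// finset.properT.
under eq_bigr do (under eq_bigr do rewrite mulrBr; rewrite sumrB).
rewrite sumrB term1 term2.
have T0 : [set: I] != finset.set0 by rewrite -cards_eq0 cardsT -lt0n.
rewrite (bigD1 [set: I])//= [X in _ = _ - X](bigD1 finset.set0)/=; last by rewrite eq_sym.
rewrite /c cardsT cards0 binn bin0 invr1 !mul1r opprD addrACA.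
rewrite (eq_bigl (fun S : {set I} => (S != finset.set0) && (S != [set: I])))//.
by rewrite [X in _ + (X - _)](eq_bigl (fun S : {set I} => (S != [set: I]) && (S != finset.set0)))
  ?subrr ?addr0// => S; rewrite andbC.
Qed.

End shapley.

(** * Lindeberg replacement *)

Section independence_tools.
Context dT (T : measurableType dT) {R : realType} (P : probability T R).

Definition independent_rvs d1 (U : measurableType d1) d2 (V : measurableType d2)
    (f : T -> U) (g : T -> V) : Prop :=
  forall A B, measurable A -> measurable B ->
    P (f @^-1` A `&` g @^-1` B) = (P (f @^-1` A) * P (g @^-1` B))%E.

(** The joint law agrees with the product of the marginal laws on rectangles, hence everywhere, and
    Fubini's theorem splits the integral. *)
Lemma integral_mul_independent d1 (U : measurableType d1) d2 (V : measurableType d2)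
    (f : {RV P >-> U}) (g : {RV P >-> V}) (F : U -> R) (G : V -> R) :
  independent_rvs f g ->
  measurable_fun setT F -> measurable_fun setT G ->
  P.-integrable setT (EFin \o (F \o f)) -> P.-integrable setT (EFin \o (G \o g)) ->
  P.-integrable setT (EFin \o (fun x => F (f x) * G (g x))) ->
  (\int[P]_x (F (f x) * G (g x))%:E =
   (\int[P]_x (F (f x))%:E) * (\int[P]_x (G (g x))%:E))%E.
Proof.
move=> ind mF mG intf intg intfg.
have mfg : measurable_fun setT (fun x => (f x, g x)) by exact: measurable_fun_pair.
pose fg : {RV P >-> (U * V)%type} := HB.pack (fun x => (f x, g x))
  (isMeasurableFun.Build _ _ _ _ _ mfg).
pose m : probability _ R := distribution P fg.
pose m1 : probability _ R := distribution P f.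
pose m2 : probability _ R := distribution P g.
have mE (A : set (U * V)) : measurable A -> (m1 \x m2)%E A = m A.
  by apply: product_measure_unique => B C mB mC; rewrite -ind.
pose h (z : U * V) : \bar R := (F z.1 * G z.2)%:E.
have mh : measurable_fun setT h.
  apply/measurable_EFinP; apply: measurable_funM.
    by apply: measurableT_comp => //; exact: measurable_fst.
  by apply: measurableT_comp => //; exact: measurable_snd.
have inth : m.-integrable setT h.
  by apply: integrable_pushforward => //; exact: intfg.
have inth' : (m1 \x m2)%E.-integrable setT h.
  apply/integrableP; split => //; move/integrableP: inth => [_].
  apply: le_lt_trans; rewrite le_eqVlt; apply/orP; left; apply/eqP.
  by apply: eq_measure_integral => A mA _; exact: mE.
have -> : (\int[P]_x (F (f x) * G (g x))%:E = \int[m]_z h z)%E.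
  by rewrite integral_pushforward.
have <- : (\int[m1 \x m2]_z h z = \int[m]_z h z)%E.
  by apply: eq_measure_integral => A mA _; exact: mE.
rewrite -integral12_prod_meas1// /fubini_F.
have mF' : measurable_fun setT (EFin \o F) by exact/measurable_EFinP.
have mG' : measurable_fun setT (EFin \o G) by exact/measurable_EFinP.
have intg' : m2.-integrable setT (EFin \o G) by exact: integrable_pushforward.
have intf' : m1.-integrable setT (EFin \o F) by exact: integrable_pushforward.
have Eg : (\int[P]_x (G (g x))%:E = \int[m2]_y (G y)%:E)%E.
  by rewrite integral_pushforward.
have Ef : (\int[P]_x (F (f x))%:E = \int[m1]_y (F y)%:E)%E.
  by rewrite integral_pushforward.
rewrite Ef Eg.
have [c cE] : exists c, (\int[m2]_y (G y)%:E = c%:E)%E.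
  by exists (fine (\int[m2]_y (G y)%:E)); rewrite fineK//; exact: integrable_fin_num.
rewrite cE -integralZr//; apply: eq_integral => x _.
by rewrite /h/= -cE -integralZl.
Qed.

End independence_tools.

(** * Independence of one variable from all the others *)

Section independence_of_the_rest.
Context dT (T : measurableType dT) {R : realType} (P : probability T R).
Context d (U : measurableType d) (J : finType) (X : J -> {RV P >-> U}).

Definition independent_family : Prop :=
  forall A : J -> set U, (forall j, measurable (A j)) ->
    P (\bigcap_j (X j @^-1` A j)) = (\prod_j P (X j @^-1` A j))%E.

(** The condition [A j0 = setT] leaves the variable [j0] unconstrained; the family is stable under
    intersection and generates the sigma-algebra of the remaining variables. *)
Definition cylinders_without (j0 : J) : set (set T) :=
  [set E | exists A : J -> set U, [/\ forall j, measurable (A j), A j0 = setT &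
     E = \bigcap_j (X j @^-1` A j)]].

(** The same points as [T] with a coarser sigma-algebra, so that depending only on the other
    variables becomes plain measurability from this type. *)
Definition sigma_without (j0 : J) := g_sigma_algebraType (cylinders_without j0).

Lemma measurable_cylinder (A : J -> set U) : (forall j, measurable (A j)) ->
  measurable (\bigcap_j (X j @^-1` A j)).
Proof.
move=> mA; apply: fin_bigcap_measurable => // j _.
exact: measurable_funPTI.
Qed.

Lemma measurable_sigma_without j0 (j : J) : j != j0 ->
  measurable_fun [set: sigma_without j0] (X j).
Proof.
move=> jj0 _ B mB; rewrite setTI; apply: sub_sigma_algebra.
exists (fun i => if i == j then B else setT); split.
- by move=> i; case: ifP.
- by rewrite eq_sym (negbTE jj0).
- apply/seteqP; split => [x Bx i _|x /(_ j Logic.I)]/=; last by rewrite eqxx.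
  by case: eqP => // ->.
Qed.

(** For fixed [C], both sides are finite measures in [E]. They agree on the cylinders, a generating
    pi-system, hence on the sigma-algebra. *)
Lemma independent_rest j0 (E : set T) (C : set U) : independent_family ->
  <<s cylinders_without j0 >> E -> measurable C ->
  P (E `&` X j0 @^-1` C) = (P E * P (X j0 @^-1` C))%E.
Proof.
move=> ind sE mC; have mXC : measurable (X j0 @^-1` C) by exact: measurable_funPTI.
pose c := fine (P (X j0 @^-1` C)).
have c0 : 0 <= c by rewrite fine_ge0.
have cE : P (X j0 @^-1` C) = c%:E by rewrite fineK// fin_num_measure.
pose m1 : {measure set T -> \bar R} := mrestr P mXC.
pose m2 : {measure set T -> \bar R} := mscale (NngNum c0) P.
have m12 : forall F, <<s cylinders_without j0 >> F -> m1 F = m2 F.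
  apply: (@g_sigma_algebra_measure_unique _ R T (cylinders_without j0)
    _ (fun=> setT) _ _ m1 m2).
  - by move=> _ [A [mA _ ->]]; exact: measurable_cylinder.
  - move=> _; exists (fun=> setT); split => //.
    by apply/seteqP; split.
  - by apply/seteqP; split => // x _; exists 0%N.
  - move=> _ _ [A [mA Aj0 ->]] [B [mB Bj0 ->]].
    exists (fun j => A j `&` B j); split.
    + by move=> j; exact: measurableI.
    + by rewrite Aj0 Bj0 setTI.
    + by rewrite -bigcapI.
  - move=> _ [A [mA Aj0 ->]].
    pose A' j := if j == j0 then C else A j.
    have mA' j : measurable (A' j) by rewrite /A'; case: ifP.
    change (P (\bigcap_j (X j @^-1` A j) `&` X j0 @^-1` C) =
      c%:E * P (\bigcap_j (X j @^-1` A j)))%E.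
    rewrite -cE.
    rewrite (_ : _ `&` _ = \bigcap_j (X j @^-1` A' j)); last first.
      apply/seteqP; split => [x [Ax Cx] j _|x A'x].
        by rewrite /A' /=; case: eqP => [->//|_]; exact: Ax.
      split; last by have := A'x j0 Logic.I; rewrite /A' eqxx.
      move=> j _; have := A'x j Logic.I; rewrite /A' /=.
      by case: eqP => [->|//]; rewrite Aj0.
    rewrite !ind// (bigD1 j0)//= [in RHS](bigD1 j0)//= /A' eqxx Aj0.
    rewrite preimage_setT probability_setT mul1e; congr (_ * _)%E.
    by apply: eq_bigr => j /negbTE ->.
  - move=> _; change (P (setT `&` X j0 @^-1` C) < +oo)%E.
    by rewrite setTI ltey_eq fin_num_measure.
by rewrite cE muleC; exact: m12 sE.
Qed.

End independence_of_the_rest.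

Section integrable_real_functions.
Context dT (T : measurableType dT) {R : realType} (P : probability T R).
Implicit Types f g : T -> R.

Definition L1 f : Prop := P.-integrable setT (EFin \o f).

Lemma L1_measurable f : L1 f -> measurable_fun setT f.
Proof. by move=> /integrableP[/measurable_EFinP]. Qed.

Lemma L1_dominated f g : measurable_fun setT f -> (forall x, `|f x| <= g x) ->
  L1 g -> L1 f.
Proof.
move=> mf fg Lg; apply: le_integrable Lg => //; first exact/measurable_EFinP.
by move=> x _ /=; rewrite lee_fin (le_trans (fg x))// ler_norm.
Qed.

Lemma L1_cst c : L1 (fun=> c).
Proof. exact: finite_measure_integrable_cst. Qed.

Lemma L1_bounded f c : measurable_fun setT f -> (forall x, `|f x| <= c) -> L1 f.
Proof. by move=> mf fc; exact: L1_dominated fc (L1_cst c). Qed.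

Lemma L1D f g : L1 f -> L1 g -> L1 (fun x => f x + g x).
Proof. by move=> Lf Lg; exact: eq_integrable (integrableD measurableT Lf Lg). Qed.

Lemma L1B f g : L1 f -> L1 g -> L1 (fun x => f x - g x).
Proof. by move=> Lf Lg; exact: eq_integrable (integrableB measurableT Lf Lg). Qed.

Lemma L1Z c f : L1 f -> L1 (fun x => c * f x).
Proof. by move=> Lf; exact: eq_integrable (integrableZl measurableT c Lf). Qed.

Lemma L1_norm f : L1 f -> L1 (fun x => `|f x|).
Proof. exact: integrable_norm. Qed.

Lemma L1_sum (I : Type) (s : seq I) (Q : pred I) (h : I -> T -> R) :
  (forall i, L1 (h i)) -> L1 (fun x => \sum_(i <- s | Q i) h i x).
Proof.
move=> Lh; have := @integrable_sum _ _ _ P setT measurableT I s Q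
  (fun i => EFin \o h i) (fun i _ => Lh i).
by apply: eq_integrable => // x _; rewrite /= sumEFin.
Qed.

Lemma Rintegral_sum (I : Type) (s : seq I) (Q : pred I) (h : I -> T -> R) :
  (forall i, L1 (h i)) ->
  \int[P]_x (\sum_(i <- s | Q i) h i x) = \sum_(i <- s | Q i) \int[P]_x h i x.
Proof.
move=> Lh; elim: s => [|i s IH].
  under eq_Rintegral do rewrite big_nil.
  by rewrite big_nil Rintegral_cst// mul0r.
rewrite big_cons -IH.
case: ifP => Qi; last by apply: eq_Rintegral => x _; rewrite big_cons Qi.
rewrite -(RintegralD measurableT (Lh i) (L1_sum s Q Lh)).
by apply: eq_Rintegral => x _; rewrite big_cons Qi.
Qed.

Lemma norm_Rintegral_le f g : L1 f -> L1 g -> (forall x, `|f x| <= g x) ->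
  `|\int[P]_x f x| <= \int[P]_x g x.
Proof.
move=> Lf Lg fg; apply: le_trans (le_normr_Rintegral measurableT Lf) _.
by apply: le_Rintegral => //; exact: L1_norm.
Qed.

Lemma EFin_Rintegral f : L1 f -> ((\int[P]_x f x)%:E = \int[P]_x (f x)%:E)%E.
Proof. by move=> Lf; rewrite fineK//; exact: integrable_fin_num. Qed.

Lemma Rintegral_mul_independent d2 (V : measurableType d2)
    (f : T -> R) (g : {RV P >-> V}) (G : V -> R) (c : R) :
  independent_rvs P f g ->
  measurable_fun setT f -> measurable_fun setT G -> (forall x, `|f x| <= c) ->
  L1 (fun x => G (g x)) ->
  L1 (fun x => f x * G (g x)) /\
  \int[P]_x (f x * G (g x)) = (\int[P]_x f x) * \int[P]_x G (g x).
Proof.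
move=> ind mf mG fc LG.
have Lf : L1 f by exact: L1_bounded fc.
have LfG : L1 (fun x => f x * G (g x)).
  apply: (L1_dominated (g := fun x => c * `|G (g x)|)).
  - by apply: measurable_funM => //; exact: L1_measurable.
  - by move=> x; rewrite normrM ler_wpM2r.
  - exact/L1Z/L1_norm.
split => //; apply: EFin_inj; rewrite EFinM !EFin_Rintegral//.
pose f' : {RV P >-> R} := HB.pack f (isMeasurableFun.Build _ _ _ _ _ mf).
exact: (@integral_mul_independent _ _ _ _ _ _ _ _ f' g id G).
Qed.

End integrable_real_functions.

Section measurable_softmax.
Context dT (T : measurableType dT) {R : realType} {d : nat} (gamma B : R).
Context (f f1 f2 : R -> R).
Hypothesis tf : smooth_test gamma B f f1 f2.
Variable w : T -> 'I_d -> R.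
Hypothesis mw : forall j, measurable_fun setT (w^~ j).

Lemma measurable_partition_function :
  measurable_fun setT (fun x => partition_function gamma (w x)).
Proof.
apply: measurable_sum => j; apply: measurableT_comp => //.
exact: measurable_funM.
Qed.

Lemma measurable_lse : measurable_fun setT (fun x => lse gamma (w x)).
Proof.
apply: measurable_funM => //; apply: measurableT_comp; first exact: measurable_ln.
exact: measurable_partition_function.
Qed.

Lemma measurable_softmax j : measurable_fun setT (fun x => softmax gamma (w x) j).
Proof.
have d0 : (0 < d)%N by case: (d) j => // -[].
rewrite (_ : (fun x => _) =
    fun x => expR (gamma * w x j - ln (partition_function gamma (w x)))); last first.
  by apply/funext => x; rewrite expRB lnK// posrE partition_function_gt0.
apply: measurableT_comp => //; apply: measurable_funB; first exact: measurable_funM.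
apply: measurableT_comp; first exact: measurable_ln.
exact: measurable_partition_function.
Qed.

Lemma measurable_test : measurable_fun setT f.
Proof.
exact: continuous_measurable_fun (continuous_of_is_derive (test_derive tf)).
Qed.

Lemma measurable_test1 : measurable_fun setT f1.
Proof.
exact: continuous_measurable_fun (continuous_of_is_derive (test_derive2 tf)).
Qed.

Lemma measurable_test2 : 0 < gamma -> measurable_fun setT f2.
Proof.
move=> g0; apply: continuous_measurable_fun => x; apply/cvgrPdist_lt => e e0.
have B0 : 0 <= B by exact: le_trans (test_bound1 tf 0).
have C0 : 0 < B * gamma ^+ 2 + 1 by rewrite ltr_wpDl// mulr_ge0// exprn_ge0// ltW.
near=> y; rewrite (le_lt_trans (test_lip2 tf _ _))//.
apply: (@le_lt_trans _ _ ((B * gamma ^+ 2 + 1) * `|x - y|)).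
  by rewrite ler_wpM2r// lerDl.
rewrite mulrC -ltr_pdivlMr//.
near: y; apply: cvgr_dist_lt => //; exact: divr_gt0.
Unshelve. all: by end_near. Qed.

End measurable_softmax.

Section hessian_coefficients.
Context {R : realType} {d : nat} (gamma B : R) (f f1 f2 : R -> R).
Hypotheses (gamma0 : 0 < gamma) (tf : smooth_test gamma B f f1 f2).
Implicit Types (w v : 'I_d -> R).

(** The Hessian matrix at [w] of [f] composed with [lse]. Its entries are bounded, so under
    independence the expected quadratic form depends on the increment through its covariances
    alone. *)
Definition hess_coef w (j k : 'I_d) : R :=
  (f2 (lse gamma w) - gamma * f1 (lse gamma w)) * (softmax gamma w j * softmax gamma w k)
  + (if j == k then gamma * f1 (lse gamma w) * softmax gamma w j else 0).

Lemma hess_formE w v :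
  hess_form gamma f1 f2 w v = \sum_(j < d) \sum_(k < d) hess_coef w j k * (v j * v k).
Proof.
have sq : softmax_moment gamma w v 1 ^+ 2 =
    \sum_(j < d) \sum_(k < d) softmax gamma w j * softmax gamma w k * (v j * v k).
  rewrite expr2 mulr_suml; apply: eq_bigr => j _; rewrite mulr_sumr.
  by apply: eq_bigr => k _; rewrite !expr1; ring.
transitivity ((f2 (lse gamma w) - gamma * f1 (lse gamma w)) *
    softmax_moment gamma w v 1 ^+ 2 +
    gamma * f1 (lse gamma w) * softmax_moment gamma w v 2).
  by rewrite /hess_form; ring.
rewrite sq /softmax_moment !mulr_sumr -big_split/=; apply: eq_bigr => j _.
rewrite /hess_coef; under [RHS]eq_bigr do rewrite mulrDl.
rewrite big_split/= mulr_sumr; congr (_ + _).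
  by apply: eq_bigr => k _; ring.
rewrite (bigD1 j)//= eqxx big1 ?addr0 => [|k /negbTE kj]; first by ring.
by rewrite eq_sym kj mul0r.
Qed.

Lemma softmax_le1 w j : softmax gamma w j <= 1.
Proof.
have d0 : (0 < d)%N by case: (d) j => // -[].
rewrite -(sum_softmax gamma d0 w) (bigD1 j)//= lerDl.
by apply: sumr_ge0 => k _; exact: softmax_ge0.
Qed.

Lemma hess_coef_bound w j k : `|hess_coef w j k| <= 3 * (B * gamma).
Proof.
have d0 : (0 < d)%N by case: (d) j => // -[].
have p01 i : 0 <= softmax gamma w i <= 1 by rewrite softmax_ge0// softmax_le1.
have b2 := test_bound2 tf (lse gamma w); have b1 := test_bound1 tf (lse gamma w).
have gb1 : `|gamma * f1 (lse gamma w)| <= B * gamma.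
  by rewrite normrM (gtr0_norm gamma0) mulrC ler_wpM2r// ltW.
have BG : 0 <= B * gamma by apply: le_trans gb1.
have h1 : `|(f2 (lse gamma w) - gamma * f1 (lse gamma w)) *
    (softmax gamma w j * softmax gamma w k)| <= 2 * (B * gamma).
  have /andP[pj0 pj1] := p01 j; have /andP[pk0 pk1] := p01 k.
  rewrite normrM -[leRHS]mulr1 ler_pM//.
    rewrite (le_trans (ler_normB _ _))//; lra.
  have pp : 0 <= softmax gamma w j * softmax gamma w k by exact: mulr_ge0.
  by rewrite ger0_norm// mulr_ile1.
have h2 : `|if j == k then gamma * f1 (lse gamma w) * softmax gamma w j else 0| <= B * gamma.
  case: ifP => _; last by rewrite normr0.
  have /andP[pj0 pj1] := p01 j.
  by rewrite normrM -[leRHS]mulr1 ler_pM// ger0_norm.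
by rewrite (le_trans (ler_normD _ _))//; move: h1 h2; lra.
Qed.

End hessian_coefficients.

Lemma measurable_coord dU (U : measurableType dU) {R : realType} d
    (Z : U -> d.-tuple R) j :
  measurable_fun setT Z -> measurable_fun setT (fun x => tnth (Z x) j).
Proof. by move=> mZ; exact: (measurableT_comp (measurable_tnth j) mZ). Qed.

Section lindeberg.
Context dT (T : measurableType dT) {R : realType} (P : probability T R).
Context {n d : nat} (X Y : 'I_n -> {RV P >-> d.-tuple R}).
Hypotheses (indX : mutually_independent X) (indY : mutually_independent Y).
Hypothesis indXY : independent_families X Y.

Local Notation L1 := (L1 P).

Let both (j : 'I_n + 'I_n) : {RV P >-> d.-tuple R} :=
  match j with inl i => X i | inr i => Y i end.

Let measurable_box (A : 'I_n -> set (d.-tuple R)) : (forall i, measurable (A i)) ->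
  measurable [set t : n.-tuple (d.-tuple R) | forall i, A i (tnth t i)].
Proof.
move=> mA; rewrite (_ : [set t | _] = \bigcap_i ((fun t => tnth t i) @^-1` A i)).
  apply: fin_bigcap_measurable => // i _; rewrite -[_ @^-1` _]setTI.
  exact: measurable_tnth.
by apply/seteqP; split => [t At i _|t At i]; [exact: At|exact: (At i Logic.I)].
Qed.

(** A leave-one-out sum mixes vectors of both families, so [X] and [Y] are pooled into one family.
    The probability of a box factors first between the families, then within each. *)
Lemma independent_both : independent_family both.
Proof.
move=> A mA.
have jointE (Z : 'I_n -> {RV P >-> d.-tuple R}) (B : 'I_n -> set (d.-tuple R)) :
    joint Z @^-1` [set t | forall i, B i (tnth t i)] = \bigcap_i (Z i @^-1` B i).
  apply/seteqP; split => x /= h i; first by move=> _; have := h i; rewrite tnth_mktuple.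
  by rewrite tnth_mktuple; exact: h.
rewrite (_ : \bigcap_j _ = (\bigcap_i (X i @^-1` A (inl i))) `&`
    (\bigcap_i (Y i @^-1` A (inr i)))); last first.
  apply/seteqP; split => [x Ax|x [AXx AYx] [i|i] _].
  - by split => i _; [exact: (Ax (inl i) Logic.I)|exact: (Ax (inr i) Logic.I)].
  - exact: AXx.
  - exact: AYx.
have mbX := measurable_box (fun i => mA (inl i)).
have mbY := measurable_box (fun i => mA (inr i)).
rewrite -!jointE (indXY mbX mbY).
rewrite (jointE X (fun i => A (inl i))) (jointE Y (fun i => A (inr i))).
have -> := indX (fun i => mA (inl i)); have -> := indY (fun i => mA (inr i)).
by rewrite big_sumType.
Qed.

(** Instantiated by the truncation for the first term of $L_n$ and by the identity for the
    second. *)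
Variable tau : R -> R.
Hypothesis mtau : measurable_fun setT tau.
Implicit Types (S : {set 'I_n}) (i : 'I_n) (x : T).

Definition pick S k : {RV P >-> d.-tuple R} := if k \in S then X k else Y k.

Definition mixed_sum S x (j : 'I_d) : R := \sum_k tau (tnth (pick S k x) j).

Definition mixed_sum_without S i x (j : 'I_d) : R :=
  \sum_(k | k != i) tau (tnth (pick S k x) j).

Let vec (Z : {RV P >-> d.-tuple R}) x (j : 'I_d) : R := tnth (Z x) j.

Lemma mixed_sum_in S i x : mixed_sum (i |: S)%SET x =
  fun j => mixed_sum_without S i x j + tau (tnth (X i x) j).
Proof.
apply/funext => j; rewrite /mixed_sum (bigD1 i)//= addrC; congr (_ + tau _).
  apply: eq_bigr => k ki; congr (tau (tnth _ _)).
  by rewrite /pick !inE (negbTE ki).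
by rewrite /pick !inE eqxx.
Qed.

Lemma mixed_sum_notin S i x : i \notin S -> mixed_sum S x =
  fun j => mixed_sum_without S i x j + tau (tnth (Y i x) j).
Proof.
move=> iS; apply/funext => j; rewrite /mixed_sum (bigD1 i)//= addrC.
by rewrite /pick (negbTE iS).
Qed.

Lemma measurable_mixed_sum S j : measurable_fun setT (fun x => mixed_sum S x j).
Proof.
apply: measurable_sum => k; apply: measurableT_comp => //.
exact: measurable_coord.
Qed.

(** Measurability of [phi] is asked over every measurable space because it is applied over
    [sigma_without], where the leave-one-out sum is measurable as a function of the variables other
    than [j0]. *)
Lemma independent_without S i (j0 : 'I_n + 'I_n) (phi : ('I_d -> R) -> R) :
  j0 = inl i \/ j0 = inr i ->
  (forall dU (U : measurableType dU) (w : U -> 'I_d -> R),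
    (forall j, measurable_fun setT (w^~ j)) ->
    measurable_fun setT (fun u => phi (w u))) ->
  independent_rvs P (fun x => phi (mixed_sum_without S i x)) (both j0).
Proof.
move=> j0i mphi A C mA mC.
have mpick k : k != i -> measurable_fun [set: sigma_without both j0] (pick S k).
  move=> ki; rewrite /pick; case: ifP => _.
    apply: (@measurable_sigma_without _ _ _ _ _ _ _ both j0 (inl k)).
    by case: j0i => ->//; apply: contra_neq ki => -[].
  apply: (@measurable_sigma_without _ _ _ _ _ _ _ both j0 (inr k)).
  by case: j0i => ->//; apply: contra_neq ki => -[].
have mw j : measurable_fun [set: sigma_without both j0]
    (fun x => mixed_sum_without S i x j).
  rewrite (_ : (fun x => _) =
      fun x => \sum_k (if k != i then tau (tnth (pick S k x) j) else 0)).
    apply: measurable_sum => k; have [ki|ki] := eqVneq k i => /=; first exact: measurable_cst.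
    by apply: measurableT_comp => //; apply: measurable_coord; exact: mpick.
  by apply/funext => x; rewrite /mixed_sum_without big_mkcond.
have mp := mphi _ _ _ mw.
apply: (independent_rest independent_both) => //.
by have := mp measurableT A mA; rewrite setTI.
Qed.

Context (gamma B : R) (f f1 f2 : R -> R).
Hypotheses (gamma0 : 0 < gamma) (tf : smooth_test gamma B f f1 f2).

Hypothesis intX : forall i j, L1 (fun x => tnth (X i x) j).
Hypothesis intY : forall i j, L1 (fun x => tnth (Y i x) j).
Hypothesis intXX : forall i j k, L1 (fun x => tnth (X i x) j * tnth (X i x) k).
Hypothesis intYY : forall i j k, L1 (fun x => tnth (Y i x) j * tnth (Y i x) k).
Hypothesis meanX : forall i j, \int[P]_x tnth (X i x) j = 0.
Hypothesis meanY : forall i j, \int[P]_x tnth (Y i x) j = 0.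
Hypothesis covXY : forall i j k, \int[P]_x (tnth (X i x) j * tnth (X i x) k) =
  \int[P]_x (tnth (Y i x) j * tnth (Y i x) k).

Let taylor2_terms S i (Z : {RV P >-> d.-tuple R}) x : R :=
  grad_form gamma f1 (mixed_sum_without S i x) (vec Z x) +
  2^-1 * hess_form gamma f1 f2 (mixed_sum_without S i x) (vec Z x).

Let intZ (j0 : 'I_n + 'I_n) j : L1 (fun x => tnth (both j0 x) j).
Proof. by case: j0 => i; [exact: intX|exact: intY]. Qed.

Let intZZ (j0 : 'I_n + 'I_n) j k : L1 (fun x => tnth (both j0 x) j * tnth (both j0 x) k).
Proof. by case: j0 => i; [exact: intXX|exact: intYY]. Qed.

Let meanZ (j0 : 'I_n + 'I_n) j : \int[P]_x tnth (both j0 x) j = 0.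
Proof. by case: j0 => i; [exact: meanX|exact: meanY]. Qed.

(** Independence factors each term of the forms: the linear part vanishes with the mean, the
    quadratic part sees only covariances. The value is therefore the same for [X i] and [Y i]. *)
Let taylor2_termsE S i (j0 : 'I_n + 'I_n) : j0 = inl i \/ j0 = inr i ->
  L1 (taylor2_terms S i (both j0)) /\
  \int[P]_x taylor2_terms S i (both j0) x =
    2^-1 * \sum_(j < d) \sum_(k < d)
      (\int[P]_x hess_coef gamma f1 f2 (mixed_sum_without S i x) j k) *
      \int[P]_x (tnth (both j0 x) j * tnth (both j0 x) k).
Proof.
move=> j0i; pose W := mixed_sum_without S i; pose Z := both j0.
have mf1 := measurable_test1 tf; have mf2 := measurable_test2 tf gamma0.
pose phi j (w : 'I_d -> R) := f1 (lse gamma w) * softmax gamma w j.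
have mphi j dU (U : measurableType dU) (w : U -> 'I_d -> R) :
    (forall j, measurable_fun setT (w^~ j)) -> measurable_fun setT (fun u => phi j (w u)).
  move=> mw; apply: measurable_funM; last exact: measurable_softmax.
  by apply: measurableT_comp => //; exact: measurable_lse.
have bphi j w : `|phi j w| <= B * 1.
  have d0 : (0 < d)%N by case: (d) j => // -[].
  rewrite normrM ler_pM ?(test_bound1 tf)// ger0_norm ?softmax_le1//.
  exact: softmax_ge0.
have mq j k dU (U : measurableType dU) (w : U -> 'I_d -> R) :
    (forall j, measurable_fun setT (w^~ j)) ->
    measurable_fun setT (fun u => hess_coef gamma f1 f2 (w u) j k).
  move=> mw; have ml := measurable_lse gamma mw; have ms := measurable_softmax gamma mw.
  have ml1 : measurable_fun setT (fun u => gamma * f1 (lse gamma (w u))).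
    by apply: measurable_funM => //; exact: measurableT_comp.
  apply: measurable_funD.
    apply: measurable_funM; last exact: measurable_funM.
    by apply: measurable_funB => //; exact: measurableT_comp.
  by case: (j == k) => //; exact: measurable_funM.
have mW j : measurable_fun setT (fun x => W x j).
  rewrite (_ : (fun x => _) =
      fun x => \sum_k (if k != i then tau (tnth (pick S k x) j) else 0)).
    apply: measurable_sum => k; have [ki|ki] := eqVneq k i => /=; first exact: measurable_cst.
    by apply: measurableT_comp => //; exact: measurable_coord.
  by apply/funext => x; rewrite /W /mixed_sum_without big_mkcond.
have G j := @Rintegral_mul_independent _ _ _ P _ _ (fun x => phi j (W x)) Z
  (fun t => tnth t j) _ (independent_without S j0i (mphi j)) (mphi j _ _ _ mW)
  (measurable_tnth j) (fun x => bphi j _) (intZ j0 j).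
have mjk j k : measurable_fun setT (fun t : d.-tuple R => tnth t j * tnth t k).
  by apply: measurable_funM; exact: measurable_tnth.
have Q j k := @Rintegral_mul_independent _ _ _ P _ _
  (fun x => hess_coef gamma f1 f2 (W x) j k) Z
  (fun t => tnth t j * tnth t k) _ (@independent_without S i j0 (fun w => hess_coef gamma f1 f2 w
    j k) j0i (mq j k)) (mq j k _ _ _ mW)
  (mjk j k) (fun x => hess_coef_bound gamma0 tf _ j k) (intZZ j0 j k).
have gE : (fun x => grad_form gamma f1 (W x) (vec Z x)) =
    fun x => \sum_(j < d) phi j (W x) * tnth (Z x) j.
  apply/funext => x; rewrite /grad_form /softmax_moment mulr_sumr.
  by apply: eq_bigr => j _; rewrite expr1 mulrA.
have hE : (fun x => hess_form gamma f1 f2 (W x) (vec Z x)) =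
    fun x => \sum_(j < d) \sum_(k < d)
      hess_coef gamma f1 f2 (W x) j k * (tnth (Z x) j * tnth (Z x) k).
  by apply/funext => x; rewrite hess_formE.
have Lg : L1 (fun x => grad_form gamma f1 (W x) (vec Z x)).
  by rewrite gE; apply: L1_sum => j; have [] := G j.
have Lh : L1 (fun x => hess_form gamma f1 f2 (W x) (vec Z x)).
  by rewrite hE; apply: L1_sum => j; apply: L1_sum => k; have [] := Q j k.
split; first by apply: L1D => //; exact: L1Z.
rewrite /taylor2_terms -/W RintegralD//; last exact: L1Z.
rewrite RintegralZl// gE hE Rintegral_sum => [|j]; last by have [] := G j.
rewrite big1 ?add0r => [|j _]; last by have [_ ->] := G j; rewrite meanZ mulr0.
congr (_ * _); rewrite Rintegral_sum => [|j]; last first.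
  by apply: L1_sum => k; have [] := Q j k.
apply: eq_bigr => j _; rewrite Rintegral_sum => [|k]; last by have [] := Q j k.
by apply: eq_bigr => k _; have [_ ->] := Q j k.
Qed.

Definition swap_error (w v : 'I_d -> R) : R :=
  f (lse gamma (fun j => w j + tau (v j))) - f (lse gamma w)
  - grad_form gamma f1 w v - hess_form gamma f1 f2 w v / 2.

Definition swap_difference S i x : R :=
  swap_error (mixed_sum_without S i x) (fun j => tnth (X i x) j) -
  swap_error (mixed_sum_without S i x) (fun j => tnth (Y i x) j).

Lemma L1_test_mixed_sum S : L1 (fun x => f (lse gamma (mixed_sum S x))).
Proof.
apply: (@L1_bounded _ _ _ _ _ 1) => [|x].
  apply: measurableT_comp; first exact: measurable_test tf.
  by apply: measurable_lse => j; exact: measurable_mixed_sum.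
by have := test_range tf (lse gamma (mixed_sum S x)); rewrite ler_norml; lra.
Qed.

(** The values of [f] at the leave-one-out sum cancel pointwise, and the Taylor terms cancel in
    expectation since they involve the vectors before [tau] is applied. *)
Lemma swap_difference_integral S i : i \notin S ->
  L1 (swap_difference S i) /\
  \int[P]_x swap_difference S i x =
    \int[P]_x f (lse gamma (mixed_sum (i |: S)%SET x)) -
    \int[P]_x f (lse gamma (mixed_sum S x)).
Proof.
move=> iS.
have [LX EX] := @taylor2_termsE S i (inl i) (or_introl erefl).
have [LY EY] := @taylor2_termsE S i (inr i) (or_intror erefl).
have L1' := L1_test_mixed_sum (i |: S)%SET; have L2' := L1_test_mixed_sum S.
have -> : swap_difference S i = fun x =>
    (f (lse gamma (mixed_sum (i |: S)%SET x)) - f (lse gamma (mixed_sum S x))) -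
    (taylor2_terms S i (both (inl i)) x - taylor2_terms S i (both (inr i)) x).
  apply/funext => x; rewrite mixed_sum_in (mixed_sum_notin x iS).
  by rewrite /swap_difference /swap_error /taylor2_terms /vec/=; ring.
split; first by apply: L1B; exact: L1B.
rewrite RintegralB//; [|exact: L1B|exact: L1B].
rewrite !RintegralB// EX EY; rewrite (_ : _ * _ - _ = 0) ?subr0//.
rewrite -mulrBr -sumrB big1 ?mulr0// => j _; rewrite -sumrB big1// => k _.
by rewrite -mulrBr covXY subrr mulr0.
Qed.

(** The absolute value stands outside the double sum and the bound is pointwise, so that
    contributions of different [i] may be combined at a fixed outcome. *)
Lemma lindeberg_bound (bound : T -> R) : (0 < n)%N -> L1 bound ->
  (forall x, `|\sum_i \sum_(S : {set 'I_n} | i \notin S)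
      shapley_weight S * swap_difference S i x| <= bound x) ->
  `|\int[P]_x f (lse gamma (fun j => \sum_i tau (tnth (X i x) j))) -
    \int[P]_x f (lse gamma (fun j => \sum_i tau (tnth (Y i x) j)))|
    <= \int[P]_x bound x.
Proof.
move=> n0 Lb hb.
have LD S i : L1 (fun x => if i \notin S then shapley_weight S * swap_difference S i x else 0).
  have [iS|iS] := boolP (i \in S) => /=; first exact: L1_cst.
  by apply: L1Z; have [] := swap_difference_integral iS.
have e1 : (fun x => \sum_i \sum_(S : {set 'I_n} | i \notin S)
      shapley_weight S * swap_difference S i x) = (fun x => \sum_i \sum_(S : {set 'I_n})
      if i \notin S then shapley_weight S * swap_difference S i x else 0).
  by apply/funext => x; apply: eq_bigr => i _; rewrite big_mkcond.
have LS : L1 (fun x => \sum_i \sum_(S : {set 'I_n} | i \notin S)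
      shapley_weight S * swap_difference S i x).
  by rewrite e1; apply: L1_sum => i; apply: L1_sum.
apply: le_trans (norm_Rintegral_le LS Lb hb).
pose G (S : {set 'I_n}) := \int[P]_x f (lse gamma (mixed_sum S x)).
have eX : (fun x => f (lse gamma (fun j => \sum_i tau (tnth (X i x) j)))) =
    fun x => f (lse gamma (mixed_sum [set: 'I_n]%SET x)).
  apply/funext => x; congr (f (lse gamma _)); apply/funext => j.
  by apply: eq_bigr => k _; rewrite /pick inE.
have eY : (fun x => f (lse gamma (fun j => \sum_i tau (tnth (Y i x) j)))) =
    fun x => f (lse gamma (mixed_sum finset.set0 x)).
  apply/funext => x; congr (f (lse gamma _)); apply/funext => j.
  by apply: eq_bigr => k _; rewrite /pick inE.
rewrite eX eY -/(G _) -/(G _) shapley_efficiency ?card_ord// e1.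
rewrite Rintegral_sum; last by move=> i; apply: L1_sum.
rewrite le_eqVlt; apply/orP; left; apply/eqP; congr `|_|; apply: eq_bigr => i _.
rewrite Rintegral_sum// [LHS]big_mkcond; apply: eq_bigr => S _.
have [iS|iS] := boolP (i \in S) => /=; first by rewrite Rintegral_cst// mul0r.
have [L E] := swap_difference_integral iS.
by rewrite RintegralZl// E.
Qed.

End lindeberg.

(** * Pathwise bounds on the averaged replacement error *)

Section pathwise_bounds.
Context dT (T : measurableType dT) {R : realType} (P : probability T R).
Context {n d : nat} (X Y : 'I_n -> {RV P >-> d.-tuple R}).
Context (gamma B : R) (f f1 f2 : R -> R).
Hypotheses (d0 : (0 < d)%N) (gamma0 : 0 < gamma).
Hypothesis tf : smooth_test gamma B f f1 f2.

(* The softmax weights at a leave-one-out sum are within a constant factor of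
   those at both completed sums. Hence the summands [|X i j|^3] can be
   collected over [i] before maximizing over [j]. *)
Lemma swap_difference_truncate x :
  `|\sum_i \sum_(S : {set 'I_n} | i \notin S) shapley_weight S *
      swap_difference X Y (truncate gamma) gamma f f1 f2 S i x|
    <= (13 * expR 2 ^+ 3 + 4) * expR 2 * (B * gamma ^+ 2) *
       (max_sum3 X x + max_sum3 Y x).
Proof.
pose c : R := 13 * expR 2 ^+ 3 + 4.
pose tau := truncate gamma.
have c0 : 0 <= c by rewrite addr_ge0 ?mulr_ge0 ?exprn_ge0 ?expR_ge0.
have B0 : 0 <= B by exact: test_bound_ge0 tf.
have BG : 0 <= B * gamma ^+ 2 by rewrite mulr_ge0 ?exprn_ge0// ltW.
have cBG : 0 <= c * (B * gamma ^+ 2) by exact: mulr_ge0.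
pose p S i j := softmax gamma (mixed_sum_without X Y tau S i x) j.
pose q S j := softmax gamma (mixed_sum X Y tau S x) j.
pose m i j := `|tnth (X i x) j| ^+ 3 + `|tnth (Y i x) j| ^+ 3.
have m0 i j : 0 <= m i j by rewrite addr_ge0 ?exprn_ge0.
have p0 S i j : 0 <= p S i j by exact: softmax_ge0.
have q0 S j : 0 <= q S j by exact: softmax_ge0.
have Dle S i : `|swap_difference X Y tau gamma f f1 f2 S i x| <=
    c * (B * gamma ^+ 2) * \sum_j p S i j * m i j.
  rewrite /swap_difference (le_trans (ler_normB _ _))//.
  apply: le_trans (lerD (swap_error_local d0 gamma0 tf _ _)
    (swap_error_local d0 gamma0 tf _ _)) _.
  rewrite -!mulrDr -/c mulrA ler_wpM2l// /abs_moment -big_split/=.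
  by apply: ler_sum => j _; rewrite -mulrDr.
(* Stability is used backwards: from the completed sum one returns to the leave-one-out sum by
   [- v]. *)
have stab (v w : 'I_d -> R) (j : 'I_d) : (forall j, `|v j| <= gamma^-1) ->
    softmax gamma w j <= expR 2 * softmax gamma (fun j => w j + v j) j.
  move=> vb; have := @softmax_stable R d gamma d0 gamma0
    (fun j => w j + v j) (fun j => - v j) 1 j ler01.
  rewrite mulr1 (_ : (fun i => w i + v i - v i) = w); last first.
    by apply/funext => i; rewrite addrK.
  by apply => i; rewrite normrN mul1r.
have pq (S : {set 'I_n}) i j : i \notin S -> p S i j <= expR 2 * q S j.
  move=> iS; rewrite /p /q (mixed_sum_notin X Y tau x iS); apply: stab => k.
  exact: truncate_le.
have pqU (S : {set 'I_n}) i j : i \notin S -> p S i j <= expR 2 * q (i |: S)%SET j.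
  move=> iS; rewrite /p /q (mixed_sum_in X Y tau S i x); apply: stab => k.
  exact: truncate_le.
have mle j : \sum_i m i j <= max_sum3 X x + max_sum3 Y x.
  rewrite big_split/= lerD//.
    exact: (vmax_ub (fun j => \sum_(i < n) `|tnth (X i x) j| ^+ 3)).
  exact: (vmax_ub (fun j => \sum_(i < n) `|tnth (Y i x) j| ^+ 3)).
apply: (@le_trans _ _ (\sum_i \sum_(S : {set 'I_n} | i \notin S)
    shapley_weight S * (c * (B * gamma ^+ 2) * \sum_j p S i j * m i j))).
  apply: le_trans (ler_norm_sum _ _ _) _; apply: ler_sum => i _.
  apply: le_trans (ler_norm_sum _ _ _) _; apply: ler_sum => S _.
  by rewrite normrM ger0_norm ?shapley_weight_ge0// ler_wpM2l ?shapley_weight_ge0.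
have -> : \sum_i \sum_(S : {set 'I_n} | i \notin S)
    shapley_weight S * (c * (B * gamma ^+ 2) * \sum_j p S i j * m i j) =
    c * (B * gamma ^+ 2) * \sum_i \sum_j m i j *
      \sum_(S : {set 'I_n} | i \notin S) shapley_weight S * p S i j.
  rewrite mulr_sumr; apply: eq_bigr => i _.
  under [in RHS]eq_bigr do rewrite mulr_sumr.
  rewrite exchange_big/= mulr_sumr; apply: eq_bigr => S _.
  rewrite mulrCA; congr (_ * _); rewrite mulr_sumr; apply: eq_bigr => j _.
  by ring.
rewrite [leRHS](_ : _ = c * (B * gamma ^+ 2) *
  (expR 2 * (max_sum3 X x + max_sum3 Y x))); last by rewrite /c; ring.
rewrite ler_wpM2l//.
apply: (@le_trans _ _ (\sum_i \sum_j m i j *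
    \sum_(S : {set 'I_n}) segment_weight S * (expR 2 * q S j))).
  apply: ler_sum => i _; apply: ler_sum => j _; rewrite ler_wpM2l//.
  by apply: (shapley_bound (H := fun S => expR 2 * q S j)) => S iS; [exact: pq|exact: pqU].
(* The weight of a pair [S], [j] is now the same for all [i]: the sum of [m i j] over [i] is formed
   and bounded uniformly in [j], after which both families of weights sum to 1. *)
have -> : \sum_i \sum_j m i j *
      (\sum_(S : {set 'I_n}) segment_weight S * (expR 2 * q S j)) =
    \sum_(S : {set 'I_n}) segment_weight S * (expR 2 * \sum_j q S j * (\sum_i m i j)).
  under eq_bigr do under eq_bigr do rewrite mulr_sumr.
  under eq_bigr do rewrite exchange_big/=.
  rewrite exchange_big/=; apply: eq_bigr => S _.
  rewrite exchange_big/= !mulr_sumr; apply: eq_bigr => j _.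
  by rewrite !mulr_sumr; apply: eq_bigr => i _; ring.
rewrite -[leRHS]mul1r -[X in X * _](@sum_segment_weight R 'I_n) mulr_suml.
apply: ler_sum => S _; rewrite ler_wpM2l ?segment_weight_ge0//.
rewrite ler_wpM2l ?expR_ge0// -[leRHS]mul1r.
rewrite -[X in X * _](sum_softmax gamma d0 (mixed_sum X Y tau S x)).
by rewrite mulr_suml; apply: ler_sum => j _; rewrite ler_wpM2l.
Qed.

Lemma vmax_norm_powR_le (q : R) (Z : 'I_n -> {RV P >-> d.-tuple R}) i x :
  vmax (fun j => `|tnth (Z i x) j|) `^ q <= max_pow Z i q x.
Proof.
have [j ->] := vmax_attained (fun j => `|tnth (Z i x) j|) d0.
exact: (vmax_ub (fun j => `|tnth (Z i x) j| `^ q)).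
Qed.

End pathwise_bounds.

Section pathwise_bounds_moments.
Context dT (T : measurableType dT) {R : realType} (P : probability T R).
Context {n d : nat} (X Y : 'I_n -> {RV P >-> d.-tuple R}).
Context (gamma delta C iota : R) (f f1 f2 : R -> R).
Hypotheses (d0 : (0 < d)%N) (gamma0 : 0 < gamma) (delta0 : 0 < delta).
Hypotheses (gd : 1 <= gamma * delta) (C1 : 1 <= C) (iota01 : 0 <= iota <= 1).
Hypothesis tf : smooth_test gamma (C / delta) f f1 f2.

(** Here the maximum over [j] stays inside the sum over [i], so each swap is bounded on its own and
    the Shapley weights of each [i] sum to 1. *)
Lemma swap_difference_id x :
  `|\sum_i \sum_(S : {set 'I_n} | i \notin S) shapley_weight S *
      swap_difference X Y id gamma f f1 f2 S i x|
    <= 13 * C * (gamma `^ ((4 + 2 * iota) / 3) * delta `^ (- ((2 + iota) / 3)) *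
       \sum_i (max_pow X i (2 + iota) x + max_pow Y i (2 + iota) x)).
Proof.
set kappa := gamma `^ _ * _.
have k0 : 0 <= kappa by rewrite mulr_ge0 ?powR_ge0.
have C0 : 0 <= C by apply: le_trans C1.
have err (Z : 'I_n -> {RV P >-> d.-tuple R}) i w :
    `|swap_error id gamma f f1 f2 w (fun j => tnth (Z i x) j)| <=
    13 * C * (kappa * max_pow Z i (2 + iota) x).
  have vb j : `|tnth (Z i x) j| <= vmax (fun j => `|tnth (Z i x) j|).
    exact: (vmax_ub (fun j => `|tnth (Z i x) j|)).
  apply: le_trans (swap_error_global d0 gamma0 delta0 gd C1 tf w iota01 vb) _.
  by rewrite ler_wpM2l ?mulr_ge0// ler_wpM2l// vmax_norm_powR_le.
rewrite !mulr_sumr; apply: le_trans (ler_norm_sum _ _ _) _; apply: ler_sum => i _.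
rewrite -[leRHS]mul1r -[X in X * _](@sum_shapley_weight R 'I_n i) mulr_suml.
apply: le_trans (ler_norm_sum _ _ _) _; apply: ler_sum => S _.
rewrite normrM ger0_norm ?shapley_weight_ge0// ler_wpM2l ?shapley_weight_ge0//.
rewrite /swap_difference (le_trans (ler_normB _ _))//.
by rewrite !mulrDr; apply: lerD; exact: err.
Qed.

End pathwise_bounds_moments.

(** * Moments of Gaussian vectors *)

Section gaussian_moments.
Context {R : realType}.
Local Notation mu := (@lebesgue_measure R).

Lemma ge0_integral_normal_prob (s : R) (f : R -> \bar R) :
  measurable_fun setT f -> (forall x, 0 <= f x)%E ->
  (\int[normal_prob 0 s]_x f x = \int[mu]_x (f x * (normal_pdf 0 s x)%:E))%E.
Proof.
move=> mf f0; have dom := normal_prob_dominates (0 : R) s.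
rewrite -(Radon_Nikodym_SigmaFinite.change_of_variables dom f0 measurableT mf).
have mpdf : measurable_fun setT (EFin \o normal_pdf 0 s).
  by apply/measurable_EFinP; exact: measurable_normal_pdf.
have intRN := Radon_Nikodym_SigmaFinite.f_integrable dom.
apply: ae_eq_integral => //.
- apply: emeasurable_funM => //; exact: measurable_int intRN.
- exact: emeasurable_funM.
- apply: ae_eqe_mul2l; apply: integral_ae_eq => // E _ mE.
  by rewrite -(Radon_Nikodym_SigmaFinite.f_integral dom).
Qed.

(* [exp (- y) >= 1 - y] with [y = (t^-2 - 1) x^2 / (2 s^2)]: rescaling the
   variance bounds the second moment from both sides. *)
Lemma normal_pdf_tangent (s t x : R) : 0 < s -> 0 < t ->
  normal_pdf 0 s x * (1 - (t ^- 2 - 1) * (x ^+ 2 / (s ^+ 2 *+ 2))) <=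
  t * normal_pdf 0 (t * s) x.
Proof.
move=> s0 t0; rewrite !normal_pdfE ?gt_eqF ?mulr_gt0//.
rewrite /normal_peak /normal_fun subr0.
have -> : Num.sqrt ((t * s) ^+ 2 * pi *+ 2) = t * Num.sqrt (s ^+ 2 * pi *+ 2).
  rewrite exprMn -mulrA -mulrnAr sqrtrM ?sqr_ge0//.
  by rewrite sqrtr_sqr gtr0_norm.
set S := Num.sqrt _; rewrite [(t * S)^-1]invfM [leRHS]mulrA mulVKf ?gt_eqF// -[leLHS]mulrA.
rewrite ler_wpM2l ?invr_ge0 ?sqrtr_ge0//.
set y := (t ^- 2 - 1) * _.
have -> : - x ^+ 2 / ((t * s) ^+ 2 *+ 2) = - x ^+ 2 / (s ^+ 2 *+ 2) - y.
  by rewrite /y; field; rewrite !gt_eqF.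
by rewrite expRD ler_wpM2l ?expR_ge0// expR_ge1Dx.
Qed.

(** Integrating the tangent inequality gives [1 - (t^-2 - 1) r <= t] for all [t > 0], where [r] is
    the second moment divided by twice [s ^+ 2]. Both sides equal 1 at [t = 1], so their derivatives
    there, [2 r] and 1, must agree. *)
Lemma normal_second_moment (s : R) : 0 < s ->
  (\int[normal_prob 0 s]_x (x ^+ 2)%:E = (s ^+ 2)%:E)%E.
Proof.
move=> s0; rewrite ge0_integral_normal_prob; last 2 first.
- by apply/measurable_EFinP; exact: measurable_funX.
- by move=> x; rewrite lee_fin sqr_ge0.
pose a : R := (s ^+ 2 *+ 2)^-1.
have a0 : 0 < a by rewrite invr_gt0 pmulrn_lgt0// exprn_gt0.
have a1 : 0 <= a^-1 by rewrite invr_ge0 ltW.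
pose g x : R := x ^+ 2 * normal_pdf 0 s x.
have g0 x : 0 <= g x by rewrite mulr_ge0 ?sqr_ge0 ?normal_pdf_ge0.
have mg : measurable_fun setT g.
  by apply: measurable_funM; [exact: measurable_funX|exact: measurable_normal_pdf].
have Lp u : mu.-integrable setT (EFin \o normal_pdf 0 u) by exact: integrable_normal_pdf.
have Lg : mu.-integrable setT (EFin \o g).
  (* At [t = 2] the tangent inequality dominates the integrand by a multiple of the density with
     standard deviation [2 * s]. *)
  have Lc := integrableZl measurableT (8 / 3 * a^-1) (Lp (2 * s)).
  apply: (le_integrable measurableT _ _ Lc); first exact/measurable_EFinP.
  move=> x _ /=; rewrite lee_fin ger0_norm// ger0_norm; last first.
    by apply: mulr_ge0; [apply: mulr_ge0; rewrite // invr_ge0 ltW|exact: normal_pdf_ge0].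
  have := @normal_pdf_tangent s 2 x s0 _; rewrite ltr0n => /(_ isT).
  have p0 := normal_pdf_ge0 0 s x; move: p0 (g0 x); rewrite /g.
  rewrite -/a; move: (normal_pdf 0 s x) (normal_pdf 0 (2 * s) x) => p q p0 xp h.
  have h' : p * (3 / 4 * (x ^+ 2 * a)) <= 2 * q.
    by apply: le_trans h; rewrite -subr_ge0 (_ : _ - _ = p)//; field.
  rewrite -[leLHS](mulfK (lt0r_neq0 a0)) [_ / 3 * _ * q](_ : _ = 4 / 3 * (2 * q) * a^-1);
    last by ring.
  rewrite ler_wpM2r//; move: h'.
  by rewrite (_ : p * _ = 3 / 4 * (x ^+ 2 * p * a)); [lra|ring].
pose m := \int[mu]_x g x.
have -> : (\int[mu]_x ((x ^+ 2)%:E * (normal_pdf 0 s x)%:E) = m%:E)%E.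
  by rewrite /m /Rintegral fineK ?integrable_fin_num.
have int1 u : \int[mu]_x normal_pdf 0 u x = 1 :> R.
  by rewrite /Rintegral integral_normal_pdf.
have key t : 0 < t -> 1 - (t ^- 2 - 1) * (a * m) <= t.
  move=> t0.
  have -> : 1 - (t ^- 2 - 1) * (a * m) =
      \int[mu]_x (normal_pdf 0 s x - ((t ^- 2 - 1) * a) * g x).
    rewrite RintegralB//; last exact: eq_integrable (integrableZl measurableT _ Lg).
    by rewrite RintegralZl// int1 -/m mulrA.
  rewrite -[leRHS]mulr1 -[X in _ <= _ * X](int1 (t * s)) -RintegralZl//.
  have LI1 : mu.-integrable setT
      (EFin \o (fun x => normal_pdf 0 s x - ((t ^- 2 - 1) * a) * g x)).
    exact: eq_integrable (integrableB measurableT (Lp s)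
      (integrableZl measurableT ((t ^- 2 - 1) * a) Lg)).
  have LI2 : mu.-integrable setT (EFin \o (fun x => t * normal_pdf 0 (t * s) x)).
    exact: eq_integrable (integrableZl measurableT t (Lp _)).
  apply: le_Rintegral => // x _; apply: le_trans (normal_pdf_tangent x s0 t0).
  by rewrite /g -/a le_eqVlt; apply/orP; left; apply/eqP; ring.
(* The upper bound uses [t = 1 + e], the lower bound [t = (1 + e)^-1]. *)
have am : a * m = 2^-1.
  move: key; move: (a * m) => r key.
  apply/eqP; rewrite eq_le; apply/andP; split; apply/ler_addgt0Pr => e e0.
  - have t0 : 0 < 1 + e by rewrite addr_gt0.
    have := key _ t0; rewrite -(ler_pM2r (exprn_gt0 2 t0)).
    rewrite (_ : (1 - _) * _ = (1 + e) ^+ 2 - (1 - (1 + e) ^+ 2) * r); last first.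
      by field; rewrite gt_eqF.
    move=> h; have {}h : e * ((2 + e) * r) <= e * (1 + e) ^+ 2 by lra.
    rewrite ler_pM2l// in h.
    have e2 : 0 < 2 + e by rewrite addr_gt0.
    rewrite -(ler_pM2l e2) (le_trans h)// -subr_ge0.
    rewrite (_ : _ - _ = e / 2); last by field.
    by rewrite divr_ge0// ltW.
  - have t0 : 0 < 1 + e by rewrite addr_gt0.
    have t0' : 0 < (1 + e)^-1 by rewrite invr_gt0.
    have := key _ t0'; rewrite exprVn invrK -(ler_pM2r t0) mulVf ?gt_eqF//.
    move=> h; have {}h : e * 1 <= e * ((2 + e) * (1 + e) * r) by lra.
    rewrite ler_pM2l// in h.
    have e2 : 0 < (2 + e) * (1 + e) by rewrite mulr_gt0// addr_gt0.
    rewrite -(ler_pM2l e2); apply: (@le_trans _ _ (1 + (2 + e) * (1 + e) * e)).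
      rewrite -subr_ge0.
      rewrite (_ : _ - _ = e / 2 + 5 / 2 * e ^+ 2 + e ^+ 3); last by field.
      by rewrite !addr_ge0 ?mulr_ge0 ?exprn_ge0 ?divr_ge0// ltW.
    by rewrite [leRHS]mulrDr lerD2r.
rewrite -[m](mulKf (lt0r_neq0 a0)) am /a invrK -[in LHS]mulr_natr.
by rewrite -mulrA divff ?mulr1.
Qed.

End gaussian_moments.

Section gaussian_vectors.
Context dT (T : measurableType dT) {R : realType} (P : probability T R).

Lemma centered_normal_second_moment (Z : {RV P >-> R}) (v : R) : 0 <= v ->
  (forall A, measurable A -> P (Z @^-1` A) = centered_normal v A) ->
  L1 P (fun x => Z x ^+ 2) /\ \int[P]_x (Z x ^+ 2) = v.
Proof.
move=> v0 lawZ.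
have mZ2 : measurable_fun setT (fun x => Z x ^+ 2) by exact: measurable_funX.
have E : (\int[P]_x (Z x ^+ 2)%:E = v%:E)%E.
  pose h (y : R) : \bar R := (y ^+ 2)%:E.
  have mh : measurable_fun setT h by apply/measurable_EFinP; exact: measurable_funX.
  have h0 y : (0 <= h y)%E by rewrite lee_fin sqr_ge0.
  have [v00|vN0] := eqVneq v 0.
    transitivity (\int[distribution P Z]_y h y)%E; first by rewrite ge0_integral_distribution.
    rewrite (eq_measure_integral (\d_(0 : R))); last first.
      by move=> A mA _; have := lawZ _ mA; rewrite /centered_normal v00 eqxx; exact.
    by rewrite integral_dirac// diracT mul1e /h expr0n v00.
  have mZ' : measurable_fun [set: T] (Z : T -> measurableTypeR R).
    exact: (measurable_funP Z).
  pose Z' : {RV P >-> measurableTypeR R} := HB.pack (Z : T -> measurableTypeR R)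
    (isMeasurableFun.Build _ _ _ _ _ mZ').
  transitivity (\int[distribution P Z']_y h y)%E.
    by rewrite (@ge0_integral_distribution _ _ _ _ _ P Z').
  transitivity (\int[normal_prob 0 (Num.sqrt v)]_y h y)%E.
    by apply: eq_measure_integral => A mA _; have := lawZ _ mA;
      rewrite /centered_normal (negbTE vN0); exact.
  by rewrite normal_second_moment ?sqrtr_gt0 ?lt0r ?vN0// sqr_sqrtr.
have L : L1 P (fun x => Z x ^+ 2).
  apply/integrableP; split; first exact/measurable_EFinP.
  under eq_integral do rewrite /= ger0_norm ?sqr_ge0//.
  by rewrite E ltry.
by split => //; rewrite /Rintegral E.
Qed.

(** A symmetric law has mean zero; for a Gaussian coordinate symmetry holds because opposite linear
    forms have the same variance. *)
Lemma centered_normal_mean (Z Z' : {RV P >-> R}) :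
  (forall A, measurable A -> P (Z @^-1` A) = P (Z' @^-1` A)) ->
  (forall x, Z' x = - Z x) -> L1 P Z -> \int[P]_x Z x = 0.
Proof.
move=> law ZN LZ.
have LZ' : L1 P Z'.
  by rewrite (_ : (Z' : T -> R) = fun x => (- 1) * Z x); [exact: L1Z|apply/funext => x;
    rewrite ZN mulN1r].
have e (W : {RV P >-> R}) : L1 P W ->
    (\int[P]_x (W x)%:E = \int[distribution P W]_y y%:E)%E.
  by move=> LW; rewrite integral_distribution//; exact: measurable_EFin.
have : \int[P]_x Z x = \int[P]_x Z' x.
  rewrite /Rintegral; congr fine; rewrite !e//.
  by apply: eq_measure_integral => A mA _; exact: law.
have -> : \int[P]_x Z' x = - 1 * \int[P]_x Z x.
  by rewrite -RintegralZl//; apply: eq_Rintegral => x _; rewrite ZN mulN1r.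
by lra.
Qed.

Lemma L1_of_sqr (f : T -> R) : measurable_fun setT f ->
  L1 P (fun x => f x ^+ 2) -> L1 P f.
Proof.
move=> mf Lf; apply: (L1_dominated (g := fun x => 1 + f x ^+ 2)) => //.
  move=> x; rewrite -real_normK ?num_real//; have := normr_ge0 (f x).
  by have := sqr_ge0 (`|f x| - 1); rewrite sqrrB1 => h0 h1; lra.
by apply: L1D => //; exact: L1_cst.
Qed.

Lemma L1_mul_of_sqr (f g : T -> R) : measurable_fun setT f -> measurable_fun setT g ->
  L1 P (fun x => f x ^+ 2) -> L1 P (fun x => g x ^+ 2) -> L1 P (fun x => f x * g x).
Proof.
move=> mf mg Lf Lg; apply: (L1_dominated (g := fun x => f x ^+ 2 + g x ^+ 2)).
- exact: measurable_funM.
- move=> x; rewrite ler_norml; have := sqr_ge0 (f x + g x); have := sqr_ge0 (f x - g x).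
  by rewrite sqrrB sqrrD => h1 h2; have := sqr_ge0 (f x); have := sqr_ge0 (g x); lra.
- exact: L1D.
Qed.

Context {k : nat} (Sigma : 'M[R]_k) (Y : {RV P >-> k.-tuple R}).
Hypothesis gY : is_gaussian_vector Sigma Y.
Hypothesis Sigma_sym : forall i j, Sigma i j = Sigma j i.
Hypothesis Sigma_psd : forall t : 'rV[R]_k, 0 <= (t *m Sigma *m t^T) 0 0.

Let form (t : 'rV[R]_k) x : R := \sum_(j < k) t 0 j * tnth (Y x) j.

Lemma measurable_coordinate j : measurable_fun setT (fun x => tnth (Y x) j).
Proof. exact: measurable_coord. Qed.

Let mform t : measurable_fun setT (form t).
Proof. by apply: measurable_sum => j; apply: measurable_funM => //;
  exact: measurable_coordinate. Qed.

Let rv_form t : {RV P >-> R} := HB.pack (form t) (isMeasurableFun.Build _ _ _ _ _ (mform t)).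

Let form2 t : L1 P (fun x => form t x ^+ 2) /\
  \int[P]_x (form t x ^+ 2) = (t *m Sigma *m t^T) 0 0.
Proof. by apply: (@centered_normal_second_moment (rv_form t)) => // A mA; exact: gY. Qed.

Let unit_row (j : 'I_k) : 'rV[R]_k := delta_mx 0 j.

Let formE j x : form (unit_row j) x = tnth (Y x) j.
Proof.
rewrite /form (bigD1 j)//= mxE !eqxx mul1r big1 ?addr0// => i /negbTE ij.
by rewrite mxE ij andbF mul0r.
Qed.

Let quadE i j : (unit_row i *m Sigma *m (unit_row j)^T) 0 0 = Sigma i j.
Proof. by rewrite /unit_row -rowE trmx_delta -colE !mxE. Qed.

Lemma gaussian_sqr_integrable j : L1 P (fun x => tnth (Y x) j ^+ 2).
Proof.
by have [L _] := form2 (unit_row j);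
  rewrite (_ : (fun x => _) = fun x => form (unit_row j) x ^+ 2)//; apply/funext => x;
    rewrite formE.
Qed.

Lemma gaussian_integrable j : L1 P (fun x => tnth (Y x) j).
Proof. by apply: L1_of_sqr; [exact: measurable_coordinate|exact: gaussian_sqr_integrable]. Qed.

Lemma gaussian_mul_integrable i j : L1 P (fun x => tnth (Y x) i * tnth (Y x) j).
Proof.
by apply: L1_mul_of_sqr;
  [exact: measurable_coordinate..|exact: gaussian_sqr_integrable|exact: gaussian_sqr_integrable].
Qed.

Lemma gaussian_mean j : \int[P]_x tnth (Y x) j = 0.
Proof.
have -> : (fun x => tnth (Y x) j) = rv_form (unit_row j).
  by apply/funext => x; rewrite -formE.
apply: (@centered_normal_mean _ (rv_form (- unit_row j))).
- move=> A mA; have := gY (unit_row j) mA; have := gY (- unit_row j) mA.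
  by rewrite linearN /= mulmxN !mulNmx opprK => <- <-.
- move=> x; rewrite /= /form -sumrN; apply: eq_bigr => i _.
  by rewrite mxE mulNr.
- by rewrite (_ : (rv_form _ : T -> R) = fun x => tnth (Y x) j);
  [exact: gaussian_integrable|apply/funext => x; rewrite /= formE].
Qed.

(** Polarization: expand the second moment of the sum of two coordinates. *)
Lemma gaussian_covariance i j : \int[P]_x (tnth (Y x) i * tnth (Y x) j) = Sigma i j.
Proof.
have [_ E] := form2 (unit_row i + unit_row j).
have [_ Ei] := form2 (unit_row i); have [_ Ej] := form2 (unit_row j).
have Li := gaussian_sqr_integrable i; have Lj := gaussian_sqr_integrable j.
have Lij := gaussian_mul_integrable i j.
have sqE l : (fun x => form (unit_row l) x ^+ 2) = (fun x => tnth (Y x) l ^+ 2).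
  by apply/funext => x; rewrite formE.
rewrite sqE quadE in Ei; rewrite sqE quadE in Ej.
have Q : ((unit_row i + unit_row j) *m Sigma *m (unit_row i + unit_row j)^T) 0 0 =
    Sigma i i + Sigma j i + (Sigma i j + Sigma j j).
  rewrite linearD/= mulmxDr !mulmxDl.
  by rewrite [LHS]mxE [X in X + _ = _]mxE [X in _ + X = _]mxE !quadE.
move: E; rewrite Q.
have -> : (fun x => form (unit_row i + unit_row j) x ^+ 2) = (fun x =>
    (tnth (Y x) i ^+ 2 + tnth (Y x) j ^+ 2) + 2 * (tnth (Y x) i * tnth (Y x) j)).
  apply/funext => x; have -> : form (unit_row i + unit_row j) x =
      tnth (Y x) i + tnth (Y x) j.
    rewrite -!formE /form -big_split/=; apply: eq_bigr => l _.
    by rewrite mxE mulrDl.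
  by ring.
rewrite RintegralD//; [|exact: L1D|exact: L1Z].
rewrite RintegralD// RintegralZl// Ei Ej (Sigma_sym j i).
by lra.
Qed.

Lemma gaussian_coordinate_no_atom j c : Sigma j j != 0 ->
  P [set x | tnth (Y x) j = c] = 0%E.
Proof.
move=> sN0; have := gY (unit_row j) (measurable_set1 c).
rewrite /centered_normal quadE (negbTE sN0) => h.
transitivity (normal_prob 0 (Num.sqrt (Sigma j j)) [set c]).
  rewrite -h; congr (P _); apply/seteqP.
  by split => x /=; have := formE j x; rewrite /form => ->.
have := normal_prob_dominates (0 : R) (Num.sqrt (Sigma j j)).
move=> /null_content_dominatesP; apply => //.
exact: lebesgue_measure_set1.
Qed.

End gaussian_vectors.

(** * Realizing couplings on the given probability space *)

Section quantile_transform.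
Context {R : realType}.

Lemma measurable_upper_level dT (T : measurableType dT) (f : T -> R) c :
  measurable_fun setT f -> measurable [set t | c <= f t].
Proof.
move=> mf; rewrite (_ : mkset _ = setT `&` f @^-1` [set` `[c, +oo[]); first exact: mf.
by apply/seteqP; split => t /=; rewrite in_itv/= andbT => // -[].
Qed.

Lemma measurable_strict_upper_level dT (T : measurableType dT) (f : T -> R) c :
  measurable_fun setT f -> measurable [set t | c < f t].
Proof.
move=> mf; rewrite (_ : mkset _ = setT `&` f @^-1` [set` `]c, +oo[]); first exact: mf.
by apply/seteqP; split => t /=; rewrite in_itv/= andbT => // -[].
Qed.

Lemma measurable_of_rays dT (T : measurableType dT) (f : T -> R) :
  (forall x, measurable [set t | f t <= x]) -> measurable_fun setT f.
Proof.
move=> mf _; apply: (measurability _ (RGenOInfty.measurableE R)) => //.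
move=> _ [_ [x ->] <-]; rewrite setTI.
rewrite (_ : _ @^-1` _ = ~` [set t | f t <= x]); first exact: measurableC.
by apply/seteqP; split => t /=; rewrite in_itv/= andbT ltNge => /negP.
Qed.

Lemma probability_eq_of_rays (m m' : probability (measurableTypeR R) R) :
  (forall x : R, m `]-oo, x]%classic = m' `]-oo, x]%classic) ->
  forall A, measurable A -> m A = m' A.
Proof.
move=> mm' A mA.
apply: (@measure_unique _ R (measurableTypeR R) (@RGenOInfty.G R)
  (fun n => `](- n%:R), +oo[%classic) (@RGenOInfty.measurableE R) _ _ _ m m' _ _ A mA).
- move=> _ _ [x ->] [y ->]; exists (Num.max x y).
  apply/seteqP; split => z /=; rewrite !in_itv/= !andbT gt_max; first by case=> -> ->.
  by move=> /andP[].
- by move=> n; exists (- n%:R).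
- apply/seteqP; split => // x _; exists (Num.truncn `|x|).+1 => //=.
  rewrite in_itv/= andbT ltrNl (le_lt_trans _ (truncnS_gt _))//.
  by rewrite -normrN ler_norm.
- move=> _ [x ->].
  have e (k : probability (measurableTypeR R) R) :
      (k `]x, +oo[%classic = 1 - k `]-oo, x]%classic)%E.
    by rewrite -setCitvl probability_setC.
  by rewrite [LHS]e [RHS]e mm'.
- by move=> k; rewrite (le_lt_trans (probability_le1 _ _)) ?ltry//; exact: measurable_itv.
Qed.

Context dT (T : measurableType dT) (P : probability T R) (V : {RV P >-> R}).
Hypothesis no_atom : forall c, P (V @^-1` [set c]) = 0%E.

Let F v : R := fine (cdf V v).

Let FE v : (F v)%:E = P (V @^-1` `]-oo, v]%classic).
Proof. by rewrite fineK// fin_num_measure. Qed.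

Let F_nd x y : x <= y -> F x <= F y.
Proof. by move=> xy; rewrite fine_le ?fin_num_measure// cdf_nondecreasing. Qed.

Definition uniform_of t : R := F (V t).

Lemma measurable_uniform_of : measurable_fun setT uniform_of.
Proof.
apply: (measurableT_comp (f := F)) => //.
by apply: nondecreasing_measurable => // x y; exact: F_nd.
Qed.

Let mU_le u : measurable [set t | uniform_of t <= u].
Proof.
rewrite (_ : mkset _ = setT `&` uniform_of @^-1` `]-oo, u]%classic).
  exact: measurable_uniform_of.
by rewrite setTI; apply/seteqP; split => t /=; rewrite in_itv.
Qed.

Let mU_lt u : measurable [set t | uniform_of t < u].
Proof.
rewrite (_ : mkset _ = setT `&` uniform_of @^-1` `]-oo, u[%classic).
  exact: measurable_uniform_of.
by rewrite setTI; apply/seteqP; split => t /=; rewrite in_itv.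
Qed.

Let cvgFy : F @ +oo --> (1 : R).
Proof. exact/fine_cvg/cvg_cdfy1. Qed.

Let cvgFNy : F @ -oo --> (0 : R).
Proof. exact/fine_cvg/cvg_cdfNy0. Qed.

(** Left continuity of [F]: its left limit at [c] is the probability of [V < c], which is [F c] in
    the absence of atoms. *)
Let F_below c u : (forall v, v < c -> F v < u) -> F c <= u.
Proof.
move=> hu; rewrite -lee_fin FE.
have -> : V @^-1` `]-oo, c] = V @^-1` `]-oo, c[ `|` V @^-1` [set c].
  apply/seteqP; split => t /=; rewrite !in_itv/= ?le_eqVlt; last first.
    by case=> [->|->]; rewrite ?eqxx ?orbT.
  by case/orP => [/eqP|]; [right|left].
have mc : measurable (V @^-1` [set c]) by exact: measurable_funPTI.
have mlt : measurable (V @^-1` `]-oo, c[) by exact: measurable_funPTI.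
apply: (@le_trans _ _ (P (V @^-1` `]-oo, c[%classic) + P (V @^-1` [set c]))%E).
  exact: measureU2.
rewrite no_atom adde0.
pose E n := V @^-1` `]-oo, c - n.+1%:R^-1].
have mE n : measurable (E n) by exact: measurable_funPTI.
have EU : V @^-1` `]-oo, c[ = \bigcup_n E n.
  apply/seteqP; split => [t /=|t [n _]]; rewrite /E /= !in_itv/=.
    move=> tc; have ct : 0 < c - V t by rewrite subr_gt0.
    exists (Num.truncn (c - V t)^-1) => //=; rewrite in_itv/= lerBrDr -lerBrDl.
    by rewrite -[leRHS]invrK lef_pV2 ?posrE ?invr_gt0// ltW// truncnS_gt.
  by move=> /le_lt_trans; apply; rewrite ltrBlDr ltrDl invr_gt0.
have bE : measurable (\bigcup_n E n) by exact: bigcup_measurable.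
have ndE : nondecreasing_seq E.
  move=> n m nm; apply/subsetPset => t; rewrite /E /= !in_itv/= => /le_trans; apply.
  by rewrite lerB// lef_pV2 ?posrE// ler_nat.
have cvgE : P (E n) @[n --> \oo] --> P (\bigcup_n E n) := nondecreasing_cvg_mu mE bE ndE.
rewrite EU -(cvg_lim _ cvgE)//; apply: lime_le; first by apply/cvg_ex; exists (P (\bigcup_n E n)).
apply: nearW => n; rewrite -FE lee_fin ltW// hu//.
by rewrite ltrBlDr ltrDl invr_gt0.
Qed.

(** The Galois connection between a distribution function and its quantile function. The limits at
    infinity make the infimum meaningful, and right continuity makes it attained. *)
Lemma quantile_exists (G : R -> R) (u : R) : nondecreasing G -> right_continuous G ->
  G @ +oo --> (1 : R) -> G @ -oo --> (0 : R) -> 0 < u < 1 ->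
  forall v, (u <= G v) = (inf [set v | u <= G v] <= v).
Proof.
move=> G_nd G_rc Gy GNy /andP[u0 u1] v; set S := [set v | u <= G v].
have [b Sb] : S !=set0.
  have : \forall v \near +oo, u < G v by exact: (cvgr_gt _ Gy).
  by move=> /filter_ex[b ub]; exists b; exact: ltW.
have [a Ga] : exists a, G a < u.
  have : \forall v \near -oo, G v < u by exact: (cvgr_lt _ GNy).
  by move=> /filter_ex[a]; exists a.
have lbS : has_lbound S.
  exists a => w Sw; rewrite leNgt; apply/negP => wa.
  by have := lt_le_trans Ga (le_trans Sw (G_nd _ _ (ltW wa))); rewrite ltxx.
apply/idP/idP => [uv|cv]; first exact: ge_inf.
rewrite leNgt; apply/negP => Gvu.
near v^'+ => w.
have Gwu : G w < u by near: w; exact: (cvgr_lt _ (G_rc v)).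
have vw : v < w by near: w; exact: nbhs_right_gt.
have [z Sz zw] : exists2 z, S z & z < w.
  apply: inf_lt; first by exists b.
  exact: le_lt_trans vw.
by have := lt_le_trans Gwu (le_trans Sz (G_nd _ _ (ltW zw))); rewrite ltxx.
Unshelve. all: by end_near. Qed.

Let F_rc : right_continuous F.
Proof.
move=> a; apply: fine_cvg.
by rewrite fineK ?fin_num_measure//; exact: cdf_right_continuous.
Qed.

Let F_surj u : 0 < u < 1 -> exists c, F c = u.
Proof.
move=> u01; have q := quantile_exists F_nd F_rc cvgFy cvgFNy u01.
exists (inf [set v | u <= F v]); apply/eqP; rewrite eq_le q lexx andbT.
by apply: F_below => v; rewrite !ltNge q.
Qed.

Let U_le u : 0 < u < 1 -> P [set t | uniform_of t <= u] = u%:E.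
Proof.
have lt_le w : 0 < w < 1 -> (P [set t | (uniform_of t < w)%R] <= w%:E)%E.
  move=> /F_surj[c cw]; rewrite -cw FE; apply: le_measure; rewrite ?inE.
  - exact: mU_lt.
  - exact: measurable_funPTI.
  - move=> t /= Ut; rewrite in_itv/= leNgt; apply/negP => ct.
    by have := lt_le_trans Ut (F_nd (ltW ct)); rewrite ltxx.
move=> /andP[u0 u1]; apply/eqP; rewrite eq_le; apply/andP; split; last first.
  have [c cu] : exists c, F c = u by apply: F_surj; rewrite u0.
  rewrite -{1}cu FE; apply: le_measure; rewrite ?inE.
  - exact: measurable_funPTI.
  - exact: mU_le.
  - by move=> t /=; rewrite in_itv/= /uniform_of -cu; exact: F_nd.
apply/lee_addgt0Pr => e e0.
(* A level strictly above [u], within [e] of it and still below 1. *)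
pose w := Num.min (u + e) ((u + 1) / 2).
have w1 : w < 1 by rewrite gt_min; apply/orP; right; lra.
have wu : u < w by rewrite lt_min ltrDl e0/=; lra.
apply: (@le_trans _ _ w%:E); last by rewrite -EFinD lee_fin ge_min lexx.
apply: le_trans (lt_le w _); last by rewrite w1 (lt_trans u0).
apply: le_measure; rewrite ?inE; [exact: mU_le|exact: mU_lt|].
by move=> t /= /le_lt_trans; apply.
Qed.

(** At levels outside []0, 1[] the infimum defining a quantile may be over an empty or unbounded
    set. The complement of this event is null, so default values there do no harm. *)
Let interior := [set t | 0 < uniform_of t < 1].

Let m_interior : measurable interior.
Proof.
rewrite (_ : interior = [set t | uniform_of t < 1] `\` [set t | uniform_of t <= 0]).
  by apply: measurableD.
by apply/seteqP; split => t /=; [move=> /andP[h3 h4]; split => //; rewrite leNgt h3|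
  case=> h3 /negP; rewrite -ltNge /interior/= h3 andbT].
Qed.

Let U_interior : P [set t | 0 < uniform_of t < 1] = 1%E.
Proof.
apply/eqP; rewrite eq_le; apply/andP; split.
  exact: probability_le1.
apply/lee_addgt0Pr => e e0.
pose w := Num.min (e / 2) (1 / 3).
have w0 : 0 < w by rewrite lt_min; apply/andP; split; lra.
have w1 : w <= 1 / 3 by rewrite ge_min lexx orbT.
have we : w <= e / 2 by rewrite ge_min lexx.
have h1 : P [set t | uniform_of t <= 1 - w] = (1 - w)%:E by apply: U_le; lra.
have h2 : P [set t | uniform_of t <= w] = w%:E by apply: U_le; lra.
have mI := m_interior.
have h3 : (P [set t | (uniform_of t <= 1 - w)%R] <=
    P ([set t | (0 < uniform_of t < 1)%R] `|` [set t | (uniform_of t <= w)%R]))%E.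
  apply: le_measure; rewrite ?inE//; first exact: measurableU.
  move=> t /= Ut; have [Uw|wU] := leP (uniform_of t) w; [by right|left].
  by apply/andP; split; lra.
have hU : (P ([set t | (0 < uniform_of t < 1)%R] `|` [set t | (uniform_of t <= w)%R]) <=
    P [set t | (0 < uniform_of t < 1)%R] + P [set t | (uniform_of t <= w)%R])%E.
  exact: measureU2.
have := le_trans h3 hU; rewrite h1 h2.
have -> : P [set t | 0 < uniform_of t < 1] = (fine (P [set t | 0 < uniform_of t < 1]))%:E.
  by rewrite fineK// fin_num_measure.
by rewrite -!EFinD !lee_fin; lra.
Qed.

Let P_interior (A : set T) : measurable A -> P A = P (A `&` interior).
Proof.
move=> mA; have PC : P (~` interior) = 0%E.
  by rewrite probability_setC// U_interior subee.
have PD : P (A `\` interior) = 0%E.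
  apply/eqP; rewrite eq_le measure_ge0 andbT -PC; apply: le_measure; rewrite ?inE.
  - exact: measurableD.
  - exact: measurableC.
  - by move=> t [].
have AE : A = (A `&` interior) `|` (A `\` interior) by rewrite setUIDK.
rewrite {1}AE measureU//;
  [by rewrite [X in (_ + X)%E]PD adde0|exact: measurableI|exact: measurableD|].
by rewrite setDE setIACA setICr setI0.
Qed.

(** [F (V)] is uniform because [V] has no atoms; composing with the quantile function of [kappa]
    gives the law [kappa]. The result is a function of [V] alone, hence inherits any independence of
    [V]. *)
Lemma quantile_transform (kappa : probability (measurableTypeR R) R) :
  exists2 r : R -> R, measurable_fun setT r &
    forall A, measurable A -> P (V @^-1` (r @^-1` A)) = kappa A.
Proof.
pose idR : measurableTypeR R -> R := idfun.
have m_id : measurable_fun setT idR by exact: measurable_id.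
pose X : {RV kappa >-> R} := HB.pack idR (isMeasurableFun.Build _ _ _ _ _ m_id).
pose G x := fine (cdf X x).
have GE x : (G x)%:E = kappa `]-oo, x]%classic by rewrite fineK// fin_num_measure.
have G_nd : nondecreasing G.
  by move=> x y xy; rewrite fine_le ?fin_num_measure// cdf_nondecreasing.
have G_rc : right_continuous G.
  by move=> a; apply: fine_cvg; rewrite fineK ?fin_num_measure//; exact: cdf_right_continuous.
have Gy : G @ +oo --> (1 : R) by exact/fine_cvg/cvg_cdfy1.
have GNy : G @ -oo --> (0 : R) by exact/fine_cvg/cvg_cdfNy0.
have G01 x : 0 <= G x <= 1.
  rewrite fine_ge0//= -lee_fin GE; apply: probability_le1; exact: measurable_itv.
have qE := quantile_exists G_nd G_rc Gy GNy.
pose q u := if 0 < u < 1 then inf [set x | u <= G x] else 0.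
have mq : measurable_fun setT q.
  apply: measurable_of_rays => x.
  rewrite (_ : mkset _ = (`]0, 1[%classic `&` `]-oo, G x]%classic) `|`
      (~` `]0, 1[%classic `&` (if 0 <= x then setT else set0))).
    by apply: measurableU; apply: measurableI => //; [exact: measurableC|case: ifP].
  apply/seteqP; split => u /=; rewrite /q !in_itv/=.
    case: ifPn => u01 h; [left|right]; first by rewrite (qE u u01).
    by split; [exact/negP|rewrite h].
  case=> [[u01]|[/negP/negbTE -> ]]; first by rewrite u01 (qE u u01).
  by case: ifP.
have mF : measurable_fun setT F by apply: nondecreasing_measurable => // x y; exact: F_nd.
exists (q \o F); first exact: measurableT_comp.
have mqU : measurable_fun setT (q \o uniform_of).
  by apply: measurableT_comp => //; exact: measurable_uniform_of.
pose qU : {RV P >-> measurableTypeR R} := HB.pack (q \o uniform_of : T -> measurableTypeR R)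
  (isMeasurableFun.Build _ _ _ _ _ (mqU : measurable_fun setT (q \o uniform_of : T ->
    measurableTypeR R))).
move=> A mA; rewrite -(probability_eq_of_rays (m := distribution P qU)) => // x.
rewrite -GE; have m1 : measurable [set t | q (uniform_of t) <= x].
  rewrite (_ : mkset _ = setT `&` (q \o uniform_of) @^-1` `]-oo, x]%classic).
    exact: (mqU measurableT _ (measurable_itv _)).
  by rewrite setTI; apply/seteqP; split => t /=; rewrite in_itv.
transitivity (P [set t | q (uniform_of t) <= x]).
  by congr (P _); apply/seteqP; split => t /=; rewrite in_itv.
rewrite P_interior//.
have -> : [set t | q (uniform_of t) <= x] `&` interior = [set t | uniform_of t <= G x] `&` interior.
  by apply/seteqP; split => t [/= h1 h2]; split => //=; move: h1; rewrite /q h2 qE.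
rewrite -P_interior//; have /andP[G0 G1] := G01 x.
have [g0|g0] := eqVneq (G x) 0.
  rewrite g0 P_interior// (_ : _ `&` _ = set0) ?measure0//.
  apply/seteqP; split => t //= [/= h1 /andP[h2 _]].
  by have := lt_le_trans h2 h1; rewrite ltxx.
have [g1|g1] := eqVneq (G x) 1.
  rewrite g1 P_interior// (_ : _ `&` _ = interior) ?U_interior//.
  apply/seteqP; split => [t []//|t It]; split => //=.
  by move: It => /andP[_ /ltW].
by apply: U_le; rewrite lt0r g0 G0 lt_neqAle g1.
Qed.

End quantile_transform.

(** * From a coupling of finitely many cells to random variables *)

Section cell_coupling.
Context {R : realType} dT (T : measurableType dT) (P : probability T R).
Context {N : nat} (cell : R -> 'I_N.+1).
Hypothesis mcell : forall k, measurable (cell @^-1` [set k]).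

Let m_cell_of (X : {RV P >-> R}) k : measurable [set t | cell (X t) = k].
Proof. exact: (measurable_funPTI X (mcell k)). Qed.

Lemma sum_cells (X : {RV P >-> R}) (A : set T) (S : pred 'I_N.+1) : measurable A ->
  P (A `&` [set t | S (cell (X t))]) =
  (\sum_(k < N.+1 | S k) P (A `&` [set t | cell (X t) = k]))%E.
Proof.
move=> mA; rewrite -measure_bigsetU_ord_cond; last 2 first.
- by move=> k _; apply: measurableI => //; exact: m_cell_of.
- by move=> i j _ _ [t [[_ /= <-] [_ /= <-]]].
congr (P _); rewrite -bigcup_seq_cond; apply/seteqP; split => [t [At St]|t [k /=]].
  by exists (cell (X t)) => //=; rewrite mem_index_enum.
by rewrite mem_index_enum => Sk [At kE]; split => //=; rewrite kE.
Qed.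

Let prob (A : set T) : R := fine (P A).

Let probE A : measurable A -> P A = (prob A)%:E.
Proof. by move=> mA; rewrite /prob fineK// fin_num_measure. Qed.

Let prob_ge0 A : 0 <= prob A. Proof. exact: fine_ge0. Qed.

(** Let [p] couple the laws of the cells. Given that [Z] lies in cell [i], [Z'] is a function of [V]
    whose law picks cell [k] with probability [p i k / a i], then a point distributed as [W]
    conditioned on cell [k]. Since [V] is independent of [Z], the cells of [Z] and [Z'] are jointly
    distributed as [p], and summing over [i] restores the law of [W]. *)
Lemma cell_coupling (e : 'I_N.+1 -> pred 'I_N.+1) (Z W V : {RV P >-> R}) (eta : R) :
  0 <= eta -> (forall c, P (V @^-1` [set c]) = 0%E) -> independent_rvs P Z V ->
  (forall S : {set 'I_N.+1}, (P [set t | cell (Z t) \in S] <=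
     P [set t | cell (W t) \in neighbours e S] + eta%:E)%E) ->
  exists Z' : {RV P >-> R}, same_law P Z' W /\
    (P [set t | ~~ e (cell (Z t)) (cell (Z' t))] <= eta%:E)%E.
Proof.
move=> eta0 Vatom ZV hall.
pose a i := prob [set t | cell (Z t) = i].
pose b k := prob [set t | cell (W t) = k].
have sumS (X : {RV P >-> R}) (A : set T) (S : pred 'I_N.+1) : measurable A ->
    prob (A `&` [set t | S (cell (X t))]) =
    \sum_(k < N.+1 | S k) prob (A `&` [set t | cell (X t) = k]).
  move=> mA; rewrite {1}/prob sum_cells//.
  rewrite (eq_bigr (fun k => (prob (A `&` [set t | cell (X t) = k]))%:E)) ?sumEFin//.
  by move=> k _; apply: probE; apply: measurableI => //; exact: m_cell_of.
have sumT (X : {RV P >-> R}) (S : pred 'I_N.+1) : prob [set t | S (cell (X t))] =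
    \sum_(k < N.+1 | S k) prob [set t | cell (X t) = k].
  rewrite -[X in prob X]setTI sumS//.
  by apply: eq_bigr => k _; rewrite setTI.
have probT : prob setT = 1 by rewrite /prob probability_setT.
have sum1 (X : {RV P >-> R}) : \sum_k prob [set t | cell (X t) = k] = 1.
  by rewrite -(sumT X xpredT) -probT; congr (prob _); apply/seteqP; split.
have mS (X : {RV P >-> R}) (S : {set 'I_N.+1}) : measurable [set t | cell (X t) \in S].
  rewrite (_ : mkset _ = \bigcup_(k in [set k | k \in S]) [set t | cell (X t) = k]).
    by apply: fin_bigcup_measurable => // k _; exact: m_cell_of.
  apply/seteqP; split => [t tS|t [k /= kS kE]]; last by rewrite kE.
  by exists (cell (X t)).
have [||p [p0 pa pb pe]] := @deficient_coupling R _ e a b eta eta0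
    (fun i => prob_ge0 _) (fun i => prob_ge0 _).
- by rewrite /a /b !sum1.
- move=> S; rewrite -(sumT Z (mem S)) -(sumT W (mem (neighbours e S))).
  by have := hall S; rewrite !(probE (mS _ _)) -EFinD lee_fin.
have pak i k : a i = 0 -> p i k = 0.
  move=> ai0; move: (pa i); rewrite ai0 => /psumr_eq0P; apply => //.
have pbk i k : b k = 0 -> p i k = 0.
  move=> bk0; move: (pb k); rewrite bk0 => /psumr_eq0P; apply => //.
pose W' : {RV P >-> measurableTypeR R} := HB.pack (W : T -> measurableTypeR R)
  (isMeasurableFun.Build _ _ _ _ _ (measurable_funP W : measurable_fun setT (W : T ->
    measurableTypeR R))).
pose mu_ k : {measure set (measurableTypeR R) -> \bar R} :=
  mrestr (distribution P W') (mcell k).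
have c0 i k : 0 <= p i k / (a i * b k).
  by rewrite divr_ge0// mulr_ge0// prob_ge0.
(* [mu_ k] has mass [b k], so division by [b k] is conditioning on cell [k]. If [b k = 0], then
   [p i k = 0] and the term vanishes. *)
pose kappa_ i : {measure set (measurableTypeR R) -> \bar R} :=
  msum (fun k => mscale (NngNum (c0 i (inord k))) (mu_ (inord k))) N.+1.
have kappaE i A : measurable A -> kappa_ i A =
    (\sum_k p i k / (a i * b k) * prob (W @^-1` A `&` [set t | cell (W t) = k]))%:E.
  move=> mA; rewrite -sumEFin /kappa_ /= /msum; apply: eq_bigr => k _.
  rewrite /mscale/= inord_val EFinM -probE//.
  by apply: measurableI; [exact: (measurable_funPTI W mA)|exact: m_cell_of].
have kappaT i : a i != 0 -> kappa_ i setT = 1%E.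
  move=> ai; rewrite kappaE//; congr (_%:E).
  have -> : 1 = (a i)^-1 * \sum_k p i k by rewrite pa mulVf.
  rewrite mulr_sumr; apply: eq_bigr => k _; rewrite preimage_setT setTI -/(b k).
  have [bk|bk] := eqVneq (b k) 0; first by rewrite pbk// !mul0r mulr0.
  by rewrite invfM mulrCA -mulrA divfK.
have r_ i : exists2 r : R -> R, measurable_fun setT r & forall A, measurable A ->
    a i * prob (V @^-1` (r @^-1` A)) =
    \sum_k p i k / b k * prob (W @^-1` A `&` [set t | cell (W t) = k]).
  have [ai|ai] := eqVneq (a i) 0.
    (* A cell of probability zero is almost never visited, so any measurable function serves. *)
    exists id => // A mA; rewrite ai mul0r big1// => k _.
    by rewrite pak// !mul0r.
  pose kappa : probability (measurableTypeR R) R := HB.pack (Measure.sort (kappa_ i))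
    (Measure.class (kappa_ i))
    (Measure_isProbability.Build _ _ _ (kappa_ i) (kappaT i ai)).
  have [r mr rE] := quantile_transform Vatom kappa.
  exists r => // A mA; rewrite /prob rE// [kappa A]kappaE//= mulr_sumr.
  by apply: eq_bigr => k _; rewrite invfM !mulrA [a i * _]mulrC mulfK.
have /choice[r rP] : forall i, exists f : R -> R, measurable_fun setT f /\
    forall A, measurable A -> a i * prob (V @^-1` (f @^-1` A)) =
    \sum_k p i k / b k * prob (W @^-1` A `&` [set t | cell (W t) = k]).
  by move=> i; have [f mf fE] := r_ i; exists f.
pose z t := r (cell (Z t)) (V t).
have mri i A : measurable A -> measurable (r i @^-1` A).
  by move=> mA; have [mr _] := rP i; rewrite -[_ @^-1` _]setTI; exact: mr.
have zE i A : z @^-1` A `&` [set t | cell (Z t) = i] =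
    Z @^-1` (cell @^-1` [set i]) `&` V @^-1` (r i @^-1` A).
  by apply/seteqP; split => t [/=]; rewrite /z => + +;
    [move=> zA kE; rewrite -kE|move=> kE; rewrite -kE].
have mz : measurable_fun setT z.
  move=> _ A mA; rewrite setTI.
  rewrite (_ : _ @^-1` _ = \bigcup_i (z @^-1` A `&` [set t | cell (Z t) = i])).
    apply: fin_bigcup_measurable => // i _; rewrite zE; apply: measurableI.
      exact: m_cell_of.
    exact: (measurable_funPTI V (mri i A mA)).
  by apply/seteqP; split => [t Azt|t [i _ []]]//; exists (cell (Z t)).
pose Z' : {RV P >-> R} := HB.pack z (isMeasurableFun.Build _ _ _ _ _ mz).
have joint i A : measurable A -> prob (z @^-1` A `&` [set t | cell (Z t) = i]) =
    \sum_k p i k / b k * prob (W @^-1` A `&` [set t | cell (W t) = k]).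
  move=> mA; have [_ <-//] := rP i.
  rewrite zE /prob ZV//; last exact: mri.
  by rewrite fineM// fin_num_measure//;
    [exact: m_cell_of|exact: (measurable_funPTI V (mri i A mA))].
have mzA A : measurable A -> measurable (z @^-1` A).
  by move=> mA; exact: (measurable_funPTI Z' mA).
exists Z'; split.
  move=> A mA; rewrite !probE; [|exact: (measurable_funPTI W mA)|exact: mzA].
  congr (_%:E); have all_cells (X : {RV P >-> R}) (B : set T) : measurable B ->
      prob B = \sum_k prob (B `&` [set t | cell (X t) = k]).
    move=> mB; rewrite -(sumS X B xpredT)//; congr (prob _).
    by apply/seteqP; split => // t [].
  rewrite (all_cells Z); last exact: mzA.
  rewrite (all_cells W (W @^-1` A)); last exact: (measurable_funPTI W mA).
  under eq_bigr do rewrite joint//.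
  rewrite exchange_big/=; apply: eq_bigr => k _.
  rewrite -mulr_suml -mulr_suml pb.
  have [bk|bk] := eqVneq (b k) 0; last by rewrite divff// mul1r.
  rewrite bk mul0r mul0r; apply/esym/eqP; rewrite eq_le prob_ge0 andbT -bk.
  have mI : measurable (W @^-1` A `&` [set t | cell (W t) = k]).
    by apply: measurableI; [exact: (measurable_funPTI W mA)|exact: m_cell_of].
  rewrite -lee_fin -(probE mI) -(probE (m_cell_of W k)).
  by apply: le_measure; rewrite ?inE//; exact: m_cell_of.
apply: (@le_trans _ _ (\sum_i \sum_(k | ~~ e i k) p i k)%:E); last by rewrite lee_fin.
have cellprob i k : prob ([set t | cell (Z t) = i] `&` [set t | cell (z t) = k]) = p i k.
  rewrite setIC (joint i (cell @^-1` [set k]))// (bigD1 k)//= big1 ?addr0 => [|l lk].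
    rewrite (_ : _ `&` _ = [set t | cell (W t) = k]); last by rewrite setIid.
    have [bk|bk] := eqVneq (b k) 0; last by rewrite divfK.
    by rewrite pbk// !mul0r.
  rewrite (_ : _ `&` _ = set0) ?/prob ?measure0 ?mulr0//.
  by apply/seteqP; split => // t [/= -> kl]; rewrite kl eqxx in lk.
have mbad i : measurable ([set t | cell (Z t) = i] `&` [set t | ~~ e i (cell (z t))]).
  apply: measurableI => //; rewrite (_ : [set t | ~~ e i (cell (z t))] =
    \bigcup_(k in [set k | ~~ e i k]) [set t | cell (Z' t) = k]).
    by apply: fin_bigcup_measurable => // k _; exact: m_cell_of.
  apply/seteqP; split => [t te|t [k /= ek kE]]; last by rewrite kE.
  by exists (cell (z t)).
rewrite (_ : [set t | _] = \big[setU/set0]_(i < N.+1)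
    ([set t | cell (Z t) = i] `&` [set t | ~~ e i (cell (z t))])).
  rewrite measure_bigsetU_ord_cond//; last first.
    by move=> i j _ _ [t [[/= <- _] [/= <- _]]].
  rewrite -sumEFin; apply: lee_sum => i _.
  apply: (@le_trans _ _ (prob ([set t | cell (Z t) = i] `&` [set t | ~~ e i (cell (z t))]))%:E).
    by rewrite -probE.
  rewrite lee_fin (sumS Z' _ (fun k => ~~ e i k)); last exact: m_cell_of.
  by apply: ler_sum => k _; rewrite cellprob.
rewrite -bigcup_seq; apply/seteqP; split => [t te|t [i /= _ [/= <-]]]//.
by exists (cell (Z t)) => //=; rewrite mem_index_enum.
Qed.

End cell_coupling.

(** * Strassen's criterion on the line *)

Section strassen_coupling.
Context {R : realType}.

Section cells.
Context (m : nat) (h : R).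
Hypothesis h0 : 0 < h.

(* [ord0] is the cell of all points outside of [[-mh, mh[]; the others are the
   half-open intervals of length [h]. *)
Definition grid_cell (x : R) : 'I_(2 * m).+1 :=
  if (0 <= x / h + m%:R) && (x / h + m%:R < (2 * m)%:R)
  then inord (Num.truncn (x / h + m%:R)).+1 else ord0.

Lemma grid_cell_eq (x : R) (k : 'I_(2 * m).+1) : k != ord0 ->
  (grid_cell x == k) = (((k : nat).-1)%:R <= x / h + m%:R < (k : nat)%:R).
Proof.
move=> k0; have kp : (0 < k)%N by rewrite lt0n.
rewrite /grid_cell; set y := x / h + m%:R.
have [/andP[y0 ym]|out] := boolP ((0 <= y) && (y < (2 * m)%:R)).
  have ltm : ((Num.truncn y).+1 < (2 * m).+1)%N.
    by rewrite ltnS -(ltr_nat R); apply: le_lt_trans ym; rewrite truncn_le.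
  rewrite -val_eqE /= inordK//.
  by rewrite -[in LHS](prednK kp) eqSS truncn_eq// (prednK kp).
rewrite eq_sym (negbTE k0); apply/esym/negbTE; apply: contra out => /andP[ky yk].
rewrite (le_trans _ ky)//=; apply: (lt_le_trans yk).
by rewrite ler_nat -ltnS.
Qed.

Lemma measurable_grid_cell k : measurable (grid_cell @^-1` [set k]).
Proof.
have mnon0 (l : 'I_(2 * m).+1) : l != ord0 -> measurable (grid_cell @^-1` [set l]).
  move=> l0; rewrite (_ : _ @^-1` _ =
      [set` `[(((l : nat).-1)%:R - m%:R) * h, ((l : nat)%:R - m%:R) * h[]);
        first exact: measurable_itv.
  apply/seteqP; split => x /=; rewrite in_itv/=.
    move/eqP; rewrite grid_cell_eq// => /andP[l1 l2].
    by rewrite -ler_pdivlMr// -ltr_pdivrMr// lerBlDr ltrBrDr l1.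
  rewrite -ler_pdivlMr// -ltr_pdivrMr// lerBlDr ltrBrDr => l12.
  by apply/eqP; rewrite grid_cell_eq.
have [->|] := eqVneq k ord0; last exact: mnon0.
rewrite (_ : _ @^-1` _ = ~` (\bigcup_(l in [set l | l != ord0]) (grid_cell @^-1` [set l]))).
  by apply: measurableC; apply: fin_bigcup_measurable; [exact: finite_finset|exact: mnon0].
apply/seteqP; split => [x /= x0 [l /= l0 lE]|x /= nl]; first by rewrite -lE x0 eqxx in l0.
by apply/eqP/negPn/negP => x0; apply: nl; exists (grid_cell x).
Qed.

Lemma grid_cell_close x y : grid_cell x = grid_cell y -> grid_cell x != ord0 ->
  `|x - y| <= h.
Proof.
move=> xy x0; have := grid_cell_eq x x0; have := grid_cell_eq y x0.
rewrite {1}xy !eqxx => /esym/andP[y1 y2] /esym/andP[x1 x2].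
have kp : (0 < grid_cell x)%N by rewrite lt0n.
have kE : (grid_cell x : nat)%:R = ((grid_cell x : nat).-1)%:R + 1 :> R.
  by rewrite natr1 prednK.
rewrite kE in x2 y2.
have -> : x - y = (x / h - y / h) * h by rewrite mulrBl !divfK ?gt_eqF.
rewrite normrM (gtr0_norm h0) -[leRHS]mul1r ler_wpM2r ?(ltW h0)// ler_norml.
by apply/andP; split; lra.
Qed.

Lemma grid_cell_outside x : grid_cell x = ord0 -> m%:R * h <= `|x|.
Proof.
move=> x0; rewrite leNgt; apply/negP; rewrite ltr_norml -mulNr => /andP[].
rewrite -ltr_pdivlMr// => x1; rewrite -ltr_pdivrMr// => x2.
have y0 : 0 <= x / h + m%:R by lra.
have ym : x / h + m%:R < (2 * m)%:R by rewrite natrM; lra.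
move/eqP: x0; rewrite /grid_cell y0 ym/= -val_eqE/= inordK//.
by rewrite ltnS -(ltr_nat R); apply: le_lt_trans ym; rewrite truncn_le.
Qed.

Lemma grid_cell_lower_bound x : grid_cell x != ord0 -> - (m%:R * h) <= x.
Proof.
move=> x0; have := grid_cell_eq x x0; rewrite eqxx => /esym/andP[x1 _].
have : 0 <= x / h + m%:R by apply: le_trans x1.
by rewrite -mulNr -ler_pdivlMr// => ?; lra.
Qed.

End cells.

Context dT (T : measurableType dT) (P : probability T R).

Lemma tail_small (U : {RV P >-> R}) (h e : R) : 0 < h -> 0 < e ->
  exists m : nat, (P [set t | (m%:R * h <= U t)%R] <= e%:E)%E.
Proof.
move=> h0 e0; pose F m := [set t | m%:R * h <= U t].
have mF m : measurable (F m).
  exact: measurable_upper_level.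
have F0 : \bigcap_m F m = set0.
  apply/seteqP; split => // t /(_ (Num.truncn (`|U t| / h)).+1 Logic.I).
  rewrite /F/= leNgt => /negP; apply.
  by rewrite -ltr_pdivrMr//; apply: le_lt_trans (truncnS_gt _); apply: ler_wpM2r;
    rewrite ?invr_ge0 ?ler_norm// ltW.
have cvgF : P \o F @ \oo --> P (\bigcap_m F m).
  apply: nonincreasing_cvg_mu => //; [|by rewrite F0|].
    by rewrite (le_lt_trans (probability_le1 _ _))// ltry.
  move=> a b ab; apply/subsetPset => t; apply: le_trans.
  by rewrite ler_wpM2r ?ler_nat// ltW.
move: cvgF; rewrite F0 measure0 => /fine_cvgP[_ /cvgrPdist_lt /(_ _ e0)].
move=> [m _ /(_ m (leqnn _))] /=; rewrite sub0r normrN => Pm; exists m.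
have fP : P (F m) \is a fin_num by exact: fin_num_measure.
rewrite -[leLHS](fineK fP) lee_fin ltW//.
by apply: le_lt_trans Pm; exact: ler_norm.
Qed.

(** Two inner cells are adjacent if they contain points within [rho]; arbitrary points of adjacent
    cells are then within [rho + 2 * h]. The outside cell is adjacent to nothing, and the tails of
    [Z] and [W] are charged [e / 2] each. *)
Lemma strassen_coupling (Z W V : {RV P >-> R}) (rho theta h e : R) :
  0 <= theta -> 0 < h -> 0 < e ->
  (forall c, P (V @^-1` [set c]) = 0%E) -> independent_rvs P Z V ->
  (forall A B : set R, measurable A -> measurable B -> A !=set0 ->
    (exists lb, forall a, A a -> lb <= a) ->
    (forall a b, A a -> `|a - b| <= rho -> B b) ->
    (P (Z @^-1` A) <= P (W @^-1` B) + theta%:E)%E) ->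
  exists Z' : {RV P >-> R}, same_law P Z' W /\
    (P [set t | (rho + 2 * h < `|Z t - Z' t|)%R] <= (theta + e)%:E)%E.
Proof.
move=> theta0 h0 e0 Vatom ZV hyp.
have mU : measurable_fun setT (fun t => `|Z t| + `|W t|).
  by apply: measurable_funD; exact: measurableT_comp.
pose U : {RV P >-> R} := HB.pack (fun t => `|Z t| + `|W t|)
  (isMeasurableFun.Build _ _ _ _ _ mU).
have e20 : 0 < e / 2 by rewrite divr_gt0.
have [m tail] := tail_small U h0 e20.
pose cell := grid_cell m h.
pose adj i k := [&& i != ord0, k != ord0 &
  `[< exists a b, [/\ cell a = i, cell b = k & `|a - b| <= rho] >]].
have mcell k : measurable (cell @^-1` [set k]) by exact: measurable_grid_cell.
have mcells (S : pred 'I_(2 * m).+1) : measurable [set x | S (cell x)].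
  rewrite (_ : mkset _ = \bigcup_(k in [set k | S k]) (cell @^-1` [set k])).
    by apply: fin_bigcup_measurable => // k _; exact: mcell.
  apply/seteqP; split => [x Sx|x [k /= kS kE]]; last by rewrite kE.
  by exists (cell x).
have out_le (X : {RV P >-> R}) : (forall t, `|X t| <= U t) ->
    (P [set t | cell (X t) = ord0] <= (e / 2)%:E)%E.
  move=> XU; apply: le_trans tail; apply: le_measure; rewrite ?inE.
  - exact: (measurable_funPTI X (mcell ord0)).
  - exact: measurable_upper_level.
  - by move=> t /= /(grid_cell_outside h0) /le_trans; apply; exact: XU.
have ZU t : `|Z t| <= U t by rewrite lerDl.
have WU t : `|W t| <= U t by rewrite lerDr.
have eta0 : 0 <= theta + e by rewrite addr_ge0// ltW.
have [|Z' [law Padj]] := cell_coupling mcell (e := adj) eta0 Vatom ZV (W := W).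
  move=> S.
  (* Removing the outside cell makes [A] bounded below; adding it to [B] catches points near [A]
     that leave the grid. *)
  pose A := [set x | (cell x \in S) && (cell x != ord0)].
  pose B := [set x | (cell x \in neighbours adj S) || (cell x == ord0)].
  have mA : measurable A by exact: mcells (fun k => (k \in S) && (k != ord0)).
  have mB : measurable B by exact: mcells (fun k => (k \in neighbours adj S) || (k == ord0)).
  have m0 (X : {RV P >-> R}) : measurable [set t | cell (X t) = ord0].
    exact: (measurable_funPTI X (mcell ord0)).
  have mS (X : {RV P >-> R}) (Q : {set 'I_(2 * m).+1}) : measurable [set t | cell (X t) \in Q].
    exact: (measurable_funPTI X (mcells (fun k => k \in Q))).
  have PA : (P (Z @^-1` A) <= P (W @^-1` B) + theta%:E)%E.
    have [A0|/set0P[a Aa]] := eqVneq A set0.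
      by rewrite A0 preimage_set0 measure0 adde_ge0.
    apply: hyp => //; first by exists a.
      by exists (- (m%:R * h)) => x /andP[_]; exact: grid_cell_lower_bound.
    move=> x y /andP[xS x0] xy; apply/orP.
    have [y0|y0] := eqVneq (cell y) ord0; [by right|left].
    apply/in_neighbours; exists (cell x) => //.
    by rewrite /adj x0 y0/=; apply/asboolP; exists x, y.
  have PZ : (P [set t | cell (Z t) \in S] <= P (Z @^-1` A) + (e / 2)%:E)%E.
    apply: (@le_trans _ _ (P (Z @^-1` A `|` [set t | cell (Z t) = ord0]))).
      apply: le_measure; rewrite ?inE//.
        by apply: measurableU => //; exact: (measurable_funPTI Z mA).
      move=> t /= tS; have [?|t0] := eqVneq (cell (Z t)) ord0; [by right|left].
      by rewrite /A/= tS.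
    apply: (le_trans (measureU2 P (measurable_funPTI Z mA) (m0 Z))).
    by apply: leeD => //; exact: out_le.
  have PW : (P (W @^-1` B) <= P [set t | cell (W t) \in neighbours adj S] + (e / 2)%:E)%E.
    apply: (@le_trans _ _ (P ([set t | cell (W t) \in neighbours adj S] `|` [set t | cell (W t) =
      ord0]))).
      apply: le_measure; rewrite ?inE.
      - exact: (measurable_funPTI W mB).
      - exact: measurableU.
      - by move=> t /orP[|/eqP]; [left|right].
    apply: (le_trans (measureU2 P (mS W _) (m0 W))).
    by apply: leeD => //; exact: out_le.
  apply: (le_trans PZ); apply: (le_trans (leeD PA (lexx _))).
  apply: (le_trans (leeD (leeD PW (lexx _)) (lexx _))).
  rewrite -!addeA -!EFinD leeD2l// lee_fin; lra.
exists Z'; split => //; apply: le_trans Padj; apply: le_measure; rewrite ?inE.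
- apply: measurable_strict_upper_level.
  by apply: measurableT_comp => //; exact: measurable_funB.
- rewrite (_ : mkset _ = \bigcup_(i in setT) \bigcup_(k in [set k | ~~ adj i k])
      ((Z @^-1` (cell @^-1` [set i])) `&` (Z' @^-1` (cell @^-1` [set k])))).
    apply: fin_bigcup_measurable; [exact: finite_finset|move=> i _].
    apply: fin_bigcup_measurable; [exact: finite_finset|move=> k _].
    by apply: measurableI;
      [exact: (measurable_funPTI Z (mcell i))|exact: (measurable_funPTI Z' (mcell k))].
  apply/seteqP; split => [t /= nadj|t [i _] [k /= nadj [-> ->]]//].
  by exists (cell (Z t)) => //; exists (cell (Z' t)).
- move=> t /=; apply: contraTN => /and3P[z0 z'0 /asboolP[a [b [az bz ab]]]].
  rewrite -leNgt.
  have d1 : `|Z t - a| <= h by exact: (grid_cell_close h0 (esym az) z0).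
  have d2 : `|b - Z' t| <= h by apply: (grid_cell_close h0 bz); rewrite -/cell bz.
  have -> : Z t - Z' t = (Z t - a) + (a - b) + (b - Z' t) by ring.
  by rewrite (le_trans (ler_normD _ _))//; have := ler_normD (Z t - a) (a - b); lra.
Qed.

End strassen_coupling.

(** * Comparison of the laws of the two maxima *)

Section probability_calculus.
Context dT (T : measurableType dT) {R : realType} (P : probability T R).

Lemma L1_indic A : measurable A -> L1 P (\1_A : T -> R).
Proof.
move=> mA; apply: (@L1_bounded _ _ _ _ _ 1); first exact: measurable_indic.
by move=> x; rewrite indicE; case: (_ \in _); rewrite ?normr1 ?normr0.
Qed.

Lemma Rintegral_indic A : measurable A -> \int[P]_x \1_A x = fine (P A).
Proof. by move=> mA; rewrite /Rintegral integral_indic// setIT. Qed.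

Lemma fine_probability A : measurable A -> (fine (P A))%:E = P A.
Proof. by move=> mA; rewrite fineK// fin_num_measure. Qed.

Lemma markov_L1 (f : T -> R) (t : R) : 0 < t -> L1 P f -> (forall x, 0 <= f x) ->
  fine (P [set x | t <= f x]) <= (\int[P]_x f x) / t.
Proof.
move=> t0 Lf f0; have mA : measurable [set x | t <= f x].
  exact: measurable_upper_level (L1_measurable Lf).
rewrite ler_pdivlMr// mulrC -Rintegral_indic// -RintegralZl//; last exact: L1_indic.
apply: le_Rintegral => //; first by apply: L1Z; exact: L1_indic.
move=> x _; rewrite indicE; have [|_] := boolP (x \in _); last by rewrite mulr0.
by rewrite inE/= mulr1.
Qed.

Lemma measurable_vmax dU (U : measurableType dU) d (w : U -> 'I_d -> R) : (0 < d)%N ->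
  (forall j, measurable_fun setT (w^~ j)) -> measurable_fun setT (fun x => vmax (w x)).
Proof.
move=> d0 mw; apply: measurable_of_rays => c.
rewrite (_ : mkset _ = \bigcap_j ((w^~ j) @^-1` [set` `]-oo, c]])).
  apply: fin_bigcap_measurable; first exact: finite_finset.
  by move=> j _; rewrite -[_ @^-1` _]setTI; exact: mw.
apply/seteqP; split => x /= h.
  by move=> j _ /=; rewrite in_itv/=; apply: le_trans (vmax_ub (w x) j) h.
by have [j ->] := vmax_attained (w x) d0; have := h j Logic.I; rewrite /= in_itv.
Qed.

Context {n d : nat} (d0 : (0 < d)%N).
Implicit Types X : 'I_n -> {RV P >-> d.-tuple R}.

Lemma measurable_max_sum X : measurable_fun setT (max_sum X).
Proof.
apply: measurable_vmax => // j; apply: measurable_sum => i.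
exact: measurable_coord.
Qed.

Lemma measurable_max_sum3 X : measurable_fun setT (max_sum3 X).
Proof.
apply: measurable_vmax => // j; apply: measurable_sum => i.
by apply: measurable_funX; apply: measurableT_comp => //; exact: measurable_coord.
Qed.

Lemma measurable_max_pow X i q : measurable_fun setT (max_pow X i q).
Proof.
apply: measurable_vmax => // j; apply: (measurableT_comp (measurable_powR q)).
by apply: measurableT_comp => //; exact: measurable_coord.
Qed.

Lemma max_sum3_ge0 X x : 0 <= max_sum3 X x.
Proof.
rewrite /max_sum3; have [j ->] := vmax_attained (fun j => \sum_(i < n) `|tnth (X i x) j| ^+ 3) d0.
by apply: sumr_ge0 => i _; exact: exprn_ge0.
Qed.

Lemma max_pow_ge0 X i q x : 0 <= max_pow X i q x.
Proof.
rewrite /max_pow; have [j ->] := vmax_attained (fun j => `|tnth (X i x) j| `^ q) d0.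
exact: powR_ge0.
Qed.

End probability_calculus.

Lemma vmax_dist (R : realType) d (u v : 'I_d -> R) (e : R) : (0 < d)%N ->
  (forall j, `|u j - v j| <= e) -> `|vmax u - vmax v| <= e.
Proof.
move=> d0; wlog uv : u v / vmax v <= vmax u => [hw uve|uve].
  have [vu|/ltW vu] := leP (vmax v) (vmax u); first exact: hw.
  by rewrite distrC; apply: (hw v u) => // j; rewrite distrC.
rewrite ger0_norm ?subr_ge0//; have [j jE] := vmax_attained u d0.
rewrite jE; apply: le_trans (uve j); apply: le_trans (ler_norm _).
by rewrite lerD2l lerN2; exact: vmax_ub.
Qed.

(** * From smooth test functions to sets *)

Section set_comparison.
Context dT (T : measurableType dT) {R : realType} (P : probability T R).
Context {n d : nat} (X Y : 'I_n -> {RV P >-> d.-tuple R}).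
Hypotheses (n0 : (0 < n)%N) (d0 : (0 < d)%N).
Hypotheses (indX : mutually_independent X) (indY : mutually_independent Y).
Hypothesis indXY : independent_families X Y.
Hypothesis intX : forall i j, L1 P (fun x => tnth (X i x) j).
Hypothesis intY : forall i j, L1 P (fun x => tnth (Y i x) j).
Hypothesis intXX : forall i j k, L1 P (fun x => tnth (X i x) j * tnth (X i x) k).
Hypothesis intYY : forall i j k, L1 P (fun x => tnth (Y i x) j * tnth (Y i x) k).
Hypothesis meanX : forall i j, \int[P]_x tnth (X i x) j = 0.
Hypothesis meanY : forall i j, \int[P]_x tnth (Y i x) j = 0.
Hypothesis covXY : forall i j k, \int[P]_x (tnth (X i x) j * tnth (X i x) k) =
  \int[P]_x (tnth (Y i x) j * tnth (Y i x) k).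
Context (gamma delta C : R).
Hypothesis C_large : 4000 <= C.
Hypotheses (gamma0 : 0 < gamma) (delta0 : 0 < delta) (gd : 1 <= gamma * delta).

(** With [r = delta / 10] the support reaches [5 * r = delta / 2], and the Lipschitz bound
    [4 * r^-1 ^+ 3] equals 4000 times [delta^-1 ^+ 3]: this is where 4000 comes from. *)
Lemma smooth_test_of_indicator (A : set R) (lb : R) : A !=set0 -> (forall a, A a -> lb <= a) ->
  exists f f1 f2, [/\ smooth_test gamma (C / delta) f f1 f2,
    forall x, A x -> f x = 1 &
    forall x, f x != 0 -> exists2 a, A a & `|x - a| <= delta / 2].
Proof.
move=> A0 Alb; have r0 : 0 < delta / 10 by rewrite divr_gt0.
have [f [f1 [f2 [fd f01 fA fout fb]]]] := smooth_indicator r0 A0 Alb.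
have dg : delta^-1 <= gamma by rewrite -[leLHS]mul1r ler_pdivrMr.
have d1 : 0 < delta^-1 by rewrite invr_gt0.
have C0 : 0 <= C by move: C_large; lra.
have b0 : 0 <= C / delta by exact: mulr_ge0 C0 (ltW d1).
have rE : (delta / 10)^-1 = 10 / delta by rewrite invf_div.
exists f, f1, f2; split=> //; last first.
  move=> x /fout[a Aa xa]; exists a => //; rewrite (le_trans xa)//.
  by rewrite mulrCA ler_wpM2l ?(ltW delta0)//; lra.
split.
- by move=> x; have [] := fd x.
- by move=> x; have [] := fd x.
- exact: f01.
- move=> x; have [b1 _ _] := fb x x; rewrite (le_trans b1)// rE ler_wpM2r ?(ltW d1)//.
  by move: C_large; lra.
- move=> x; have [_ b2 _] := fb x x; rewrite (le_trans b2)// rE.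
  apply: (@le_trans _ _ (C / delta * delta^-1)); last by rewrite ler_wpM2l.
  rewrite (_ : 2 * (10 / delta) ^+ 2 = 200 / delta * delta^-1); last by rewrite exprMn; ring.
  rewrite ler_wpM2r ?(ltW d1)// ler_wpM2r ?(ltW d1)//.
  by move: C_large; lra.
- move=> x y; have [_ _ b3] := fb x y; rewrite (le_trans b3)// ler_wpM2r// rE.
  apply: (@le_trans _ _ (C / delta * delta^-1 ^+ 2)).
    rewrite (_ : 4 * (10 / delta) ^+ 3 = 4000 / delta * delta^-1 ^+ 2); last by rewrite exprMn;
      ring.
    by rewrite ler_wpM2r ?exprn_ge0 ?(ltW d1)// ler_wpM2r ?(ltW d1).
  by rewrite ler_wpM2l// ler_pXn2r ?nnegrE// ltW.
Qed.

Context (tau : R -> R) (mtau : measurable_fun setT tau).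
Context (badX badY : set T) (bound : T -> R).
Hypotheses (mbadX : measurable badX) (mbadY : measurable badY).
Hypothesis goodX : forall x, ~ badX x -> forall j,
  `|\sum_i tau (tnth (X i x) j) - \sum_i tnth (X i x) j| <= delta / 4.
Hypothesis goodY : forall x, ~ badY x -> forall j,
  `|\sum_i tau (tnth (Y i x) j) - \sum_i tnth (Y i x) j| <= delta / 4.
Hypothesis intbound : L1 P bound.
Hypothesis pathwise : forall f f1 f2, smooth_test gamma (C / delta) f f1 f2 ->
  forall x, `|\sum_i \sum_(S : {set 'I_n} | i \notin S)
      shapley_weight S * swap_difference X Y tau gamma f f1 f2 S i x| <= bound x.

(** Off the bad events, [max_sum X] in [A] forces [f = 1], and [f != 0] at the [Y] sum forces
    [max_sum Y] in [B]. The distance is [delta / 4] for each truncation and [delta / 2] for the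
    support of [f]. The error of [lse] is one-sided, so [cgamma] is paid in one direction on each
    side and enters only once. *)
Lemma set_comparison (A B : set R) : measurable A -> measurable B -> A !=set0 ->
  (exists lb, forall a, A a -> lb <= a) ->
  (forall a b, A a -> `|a - b| <= cgamma d gamma + delta -> B b) ->
  (P (max_sum X @^-1` A) <= P (max_sum Y @^-1` B) +
    (fine (P badX) + fine (P badY) + \int[P]_x bound x)%:E)%E.
Proof.
move=> mA mB [a0 Aa0] [lb Alb] AB.
have d40 : 0 < delta / 4 by exact: divr_gt0.
have : 0 <= cgamma d gamma.
  by rewrite /cgamma mulr_ge0 ?invr_ge0 ?(ltW gamma0)// ln_ge0// ler1n.
have lseP (w : 'I_d -> R) : vmax w <= lse gamma w <= vmax w + cgamma d gamma.
  by apply/andP; split; [exact: vmax_le_lse|exact: lse_le_vmax].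
move: lseP AB; move: (cgamma d gamma) => c lseP AB c0.
(* All values [lse] can take when the untruncated maximum is a point of [A]. *)
pose A' := [set x | exists2 a, A a & a - delta / 4 <= x <= a + c + delta / 4].
have A'0 : A' !=set0.
  exists a0; exists a0 => //; apply/andP; split; lra.
have A'lb x : A' x -> lb - delta / 4 <= x.
  by case=> a Aa /andP[ax _]; rewrite (le_trans _ ax)// lerD2r; exact: Alb.
have [f [f1 [f2 [tf fA fout]]]] := smooth_test_of_indicator A'0 A'lb.
pose L (Z : 'I_n -> {RV P >-> d.-tuple R}) x :=
  lse gamma (fun j => \sum_i tau (tnth (Z i x) j)).
have comp : `|\int[P]_x f (L X x) - \int[P]_x f (L Y x)| <= \int[P]_x bound x.
  exact: (lindeberg_bound indX indY indXY mtau gamma0 tf intX intY intXX intYY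
    meanX meanY covXY n0 intbound (pathwise tf)).
have Lf (Z : 'I_n -> {RV P >-> d.-tuple R}) : L1 P (fun x => f (L Z x)).
  apply: (@L1_bounded _ _ _ _ _ 1); last first.
    by move=> x; have /andP[f0 f1'] := test_range tf (L Z x); rewrite ger0_norm.
  apply: measurableT_comp; first exact: (measurable_test tf).
  apply: measurable_lse => j; apply: measurable_sum => i; apply: measurableT_comp => //.
  exact: measurable_coord.
have mZ (Z : 'I_n -> {RV P >-> d.-tuple R}) D : measurable D ->
    measurable (max_sum Z @^-1` D).
  by move=> mD; rewrite -[_ @^-1` _]setTI; exact: (measurable_max_sum d0 Z).
have lower : fine (P (max_sum X @^-1` A)) <= \int[P]_x f (L X x) + fine (P badX).
  rewrite -(Rintegral_indic P (mZ X A mA)) -(Rintegral_indic P mbadX).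
  rewrite -RintegralD//; [|exact: Lf|exact: L1_indic].
  apply: le_Rintegral => //; [exact: L1_indic (mZ X A mA)|by apply: L1D;
    [exact: Lf|exact: L1_indic]|].
  move=> x _; have /andP[f0 _] := test_range tf (L X x).
  have i0 D : 0 <= (\1_D : T -> R) x by rewrite indicE; case: (_ \in _).
  rewrite [leLHS]indicE; have [xA|_] := boolP (x \in _); last by rewrite addr_ge0.
  rewrite [X in _ + X]indicE; have [_|/negP xb] := boolP (x \in badX); first by rewrite lerDr.
  have {}xb : ~ badX x by move=> h; apply: xb; rewrite inE.
  rewrite addr0 fA//; exists (max_sum X x); first by rewrite inE in xA.
  have /andP[l1 l2] := lseP (fun j => \sum_i tau (tnth (X i x) j)).
  have := vmax_dist d0 (goodX xb).
  rewrite ler_norml => /andP[g1 g2]; rewrite /L /max_sum.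
  by apply/andP; split; lra.
have upper : \int[P]_x f (L Y x) <= fine (P (max_sum Y @^-1` B)) + fine (P badY).
  rewrite -(Rintegral_indic P (mZ Y B mB)) -(Rintegral_indic P mbadY).
  rewrite -RintegralD//; [|exact: L1_indic (mZ Y B mB)|exact: L1_indic].
  apply: le_Rintegral => //; [exact: Lf|by apply: L1D;
    [exact: L1_indic (mZ Y B mB)|exact: L1_indic]|].
  move=> x _; have /andP[_ fle1] := test_range tf (L Y x).
  have i0 D : 0 <= (\1_D : T -> R) x by rewrite indicE; case: (_ \in _).
  have [->|f0] := eqVneq (f (L Y x)) 0; first by rewrite addr_ge0.
  rewrite (le_trans fle1)// [X in _ + X]indicE.
  have [_|/negP xb] := boolP (x \in badY); first by rewrite lerDr.
  have {}xb : ~ badY x by move=> h; apply: xb; rewrite inE.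
  rewrite addr0 indicE (_ : x \in _)//; rewrite inE /=.
  have [y [a Aa /andP[ay ya]]] := fout _ f0.
  have /andP[l1 l2] := lseP (fun j => \sum_i tau (tnth (Y i x) j)).
  have := vmax_dist d0 (goodY xb).
  rewrite /L !ler_norml => /andP[g1 g2] /andP[y1 y2]; apply: (AB a) => //.
  by rewrite ler_norml /max_sum; apply/andP; split; lra.
rewrite -(fine_probability P (mZ X A mA)) -(fine_probability P (mZ Y B mB)) -EFinD lee_fin.
have {}comp := le_trans (ler_norm _) comp.
move: lower upper comp.
move: (fine (P (max_sum X @^-1` A))) (fine (P (max_sum Y @^-1` B))) (fine (P badX)).
move: (fine (P badY)) (\int[P]_x f (L X x)) (\int[P]_x f (L Y x)) (\int[P]_x bound x).
by move=> *; lra.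
Qed.

End set_comparison.

Section moments.
Context dT (T : measurableType dT) {R : realType} (P : probability T R).

Lemma L1_of_expectation (f : T -> R) : measurable_fun setT f -> (forall x, 0 <= f x) ->
  ('E_P[f] < +oo)%E -> L1 P f.
Proof.
move=> mf f0; rewrite unlock => fin; apply/integrableP; split; first exact/measurable_EFinP.
apply: le_lt_trans fin; rewrite le_eqVlt; apply/orP; left; apply/eqP.
by apply: eq_integral => x _ /=; rewrite ger0_norm.
Qed.

Lemma expectation_Rintegral (f : T -> R) : L1 P f -> ('E_P[f] = (\int[P]_x f x)%:E)%E.
Proof. by move=> Lf; rewrite unlock EFin_Rintegral. Qed.

Lemma sqr_le_powR (a iota : R) : 0 <= iota -> a ^+ 2 <= 1 + `|a| `^ (2 + iota).
Proof.
move=> i0; rewrite -real_normK ?num_real//; have := normr_ge0 a.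
move: `|a| => b b0; have [b1|/ltW b1] := leP b 1.
  by rewrite (le_trans (exprn_ile1 _ b0 b1))// lerDl powR_ge0.
rewrite -powR_mulrn// (le_trans (ler_powR b1 (_ : 2 <= 2 + iota)))//; first by rewrite lerDl.
by rewrite lerDr.
Qed.

Lemma L1_sqr_of_powR (f : T -> R) (iota : R) : measurable_fun setT f -> 0 <= iota ->
  ('E_P[fun x => (`|f x| `^ (2 + iota))%R] < +oo)%E -> L1 P (fun x => f x ^+ 2).
Proof.
move=> mf i0 fin; have Lp : L1 P (fun x => `|f x| `^ (2 + iota)).
  apply: L1_of_expectation fin => [|x]; last exact: powR_ge0.
  by apply: (measurableT_comp (measurable_powR _)); exact: measurableT_comp.
apply: (L1_dominated (g := fun x => 1 + `|f x| `^ (2 + iota))).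
- exact: measurable_funX.
- by move=> x; rewrite ger0_norm ?sqr_ge0// sqr_le_powR.
- by apply: L1D => //; exact: L1_cst.
Qed.

Lemma second_moment_psd d (X : {RV P >-> d.-tuple R}) (Sigma : 'M[R]_d) :
  (forall j k, L1 P (fun x => tnth (X x) j * tnth (X x) k)) ->
  (forall j k, \int[P]_x (tnth (X x) j * tnth (X x) k) = Sigma j k) ->
  forall t : 'rV[R]_d, 0 <= (t *m Sigma *m t^T) 0 0.
Proof.
move=> LX cov t.
have -> : (t *m Sigma *m t^T) 0 0 = \int[P]_x (\sum_k \sum_j t 0 j * t 0 k * (tnth (X x) j * tnth
  (X x) k)).
  rewrite Rintegral_sum; last by move=> k; apply: L1_sum => j; exact: L1Z.
  rewrite mxE; apply: eq_bigr => k _; rewrite Rintegral_sum; last by move=> j; exact: L1Z.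
  rewrite !mxE mulr_suml; apply: eq_bigr => j _; rewrite RintegralZl; [|by []|exact: LX].
  by rewrite cov mulrAC.
apply: Rintegral_ge0 => x _.
rewrite (_ : \sum_k _ = (\sum_k t 0 k * tnth (X x) k) ^+ 2) ?sqr_ge0//.
rewrite expr2 mulr_sumr; apply: eq_bigr => k _; rewrite mulr_suml.
by apply: eq_bigr => j _; ring.
Qed.

End moments.

Section comparison_bounds.
Context dT (T : measurableType dT) {R : realType} (P : probability T R).
Context {n d : nat} (X Y : 'I_n -> {RV P >-> d.-tuple R}).
Hypotheses (n0 : (0 < n)%N) (d0 : (0 < d)%N).
Hypotheses (indX : mutually_independent X) (indY : mutually_independent Y).
Hypothesis indXY : independent_families X Y.
Hypothesis intX : forall i j, L1 P (fun x => tnth (X i x) j).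
Hypothesis intY : forall i j, L1 P (fun x => tnth (Y i x) j).
Hypothesis intXX : forall i j k, L1 P (fun x => tnth (X i x) j * tnth (X i x) k).
Hypothesis intYY : forall i j k, L1 P (fun x => tnth (Y i x) j * tnth (Y i x) k).
Hypothesis meanX : forall i j, \int[P]_x tnth (X i x) j = 0.
Hypothesis meanY : forall i j, \int[P]_x tnth (Y i x) j = 0.
Hypothesis covXY : forall i j k, \int[P]_x (tnth (X i x) j * tnth (X i x) k) =
  \int[P]_x (tnth (Y i x) j * tnth (Y i x) k).
Context (gamma delta iota C : R).
Hypothesis C_large : 4000 <= C.
Hypotheses (gamma0 : 0 < gamma) (delta0 : 0 < delta) (gd : 1 <= gamma * delta).
Hypothesis iota01 : 0 <= iota <= 1.

Definition comparison (theta : R) : Prop := forall A B : set R,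
  measurable A -> measurable B -> A !=set0 -> (exists lb, forall a, A a -> lb <= a) ->
  (forall a b, A a -> `|a - b| <= cgamma d gamma + delta -> B b) ->
  (P (max_sum X @^-1` A) <= P (max_sum Y @^-1` B) + theta%:E)%E.

Lemma measurable_truncate : measurable_fun setT (truncate gamma : R -> R).
Proof.
apply: measurable_fun_ifT => //.
by apply: measurable_fun_ler => //; exact: measurableT_comp.
Qed.

Lemma truncation_deviation (Z : 'I_n -> {RV P >-> d.-tuple R}) x j :
  `|\sum_i truncate gamma (tnth (Z i x) j) - \sum_i tnth (Z i x) j|
    <= gamma ^+ 2 * max_sum3 Z x.
Proof.
rewrite -sumrB (le_trans (ler_norm_sum _ _ _))//.
apply: (@le_trans _ _ (gamma ^+ 2 * \sum_i `|tnth (Z i x) j| ^+ 3)).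
  by rewrite mulr_sumr; apply: ler_sum => i _; exact: truncate_err.
rewrite ler_wpM2l ?exprn_ge0 ?(ltW gamma0)//.
exact: (vmax_ub (fun j => \sum_(i < n) `|tnth (Z i x) j| ^+ 3)).
Qed.

Let c3 : R := (13 * expR 2 ^+ 3 + 4) * expR 2.

(** The 4 is Markov's inequality for the events that truncation moves some coordinate of the sum by
    [delta / 4] or more; the rest is the pathwise replacement bound with [C / delta] in the role of
    [B]. *)
Lemma comparison_third_moment : 
  (((gamma ^+ 2 * delta^-1)%:E * 'E_P[fun w => (max_sum3 X w + max_sum3 Y w)%R])%E < +oo)%E ->
  exists r, [/\ 0 <= r, ((gamma ^+ 2 * delta^-1)%:E *
     'E_P[fun w => (max_sum3 X w + max_sum3 Y w)%R] = r%:E)%E &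
     comparison ((4 + C * c3) * r)].
Proof.
set S := fun w => max_sum3 X w + max_sum3 Y w => fin.
have a0 : 0 < gamma ^+ 2 * delta^-1 by rewrite mulr_gt0 ?invr_gt0 ?exprn_gt0.
have S0 x : 0 <= S x by rewrite addr_ge0 ?max_sum3_ge0.
have mS : measurable_fun setT S by apply: measurable_funD; exact: measurable_max_sum3.
have LS : L1 P S.
  apply: L1_of_expectation => //; have [//|] := ltP ('E_P[S])%E +oo%E.
  by rewrite leye_eq => /eqP E; move: fin; rewrite E gt0_muley.
have part (Z : 'I_n -> {RV P >-> d.-tuple R}) : (forall x, max_sum3 Z x <= S x) -> L1 P (max_sum3
  Z).
  move=> ZS; apply: (L1_dominated (g := S)) => //; first exact: measurable_max_sum3.
  by move=> x; rewrite ger0_norm ?max_sum3_ge0.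
have LX : L1 P (max_sum3 X) by apply: part => x; rewrite lerDl max_sum3_ge0.
have LY : L1 P (max_sum3 Y) by apply: part => x; rewrite lerDr max_sum3_ge0.
have IS0 : 0 <= \int[P]_x S x by exact: Rintegral_ge0.
exists (gamma ^+ 2 * delta^-1 * \int[P]_x S x); split.
- by rewrite mulr_ge0// ltW.
- by rewrite expectation_Rintegral.
move=> A B mA mB A0 Alb AB.
pose bad (Z : 'I_n -> {RV P >-> d.-tuple R}) := [set x | delta / 4 <= gamma ^+ 2 * max_sum3 Z x].
have mbad Z : measurable (bad Z).
  apply: measurable_upper_level.
  by apply: measurable_funM => //; exact: measurable_max_sum3.
have good Z x : ~ bad Z x -> forall j,
    `|\sum_i truncate gamma (tnth (Z i x) j) - \sum_i tnth (Z i x) j| <= delta / 4.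
  move=> nb j; apply: le_trans (truncation_deviation Z x j) _.
  by rewrite leNgt; apply/negP => /ltW.
have d40 : 0 < delta / 4 by exact: divr_gt0.
have Pbad Z : L1 P (max_sum3 Z) ->
    fine (P (bad Z)) <= 4 * (gamma ^+ 2 * delta^-1) * \int[P]_x max_sum3 Z x.
  move=> LZ; have Lg : L1 P (fun x => gamma ^+ 2 * max_sum3 Z x) by exact: L1Z.
  apply: le_trans (markov_L1 d40 Lg _) _.
    by move=> x; rewrite mulr_ge0 ?max_sum3_ge0// exprn_ge0// ltW.
  rewrite RintegralZl// invf_div le_eqVlt; apply/orP; left; apply/eqP.
  by rewrite mulrAC; congr (_ * _); rewrite mulrCA mulrA.
pose bound x := c3 * (C / delta * gamma ^+ 2) * S x.
have Lbound : L1 P bound by exact: L1Z.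
have pw f f1 f2 : smooth_test gamma (C / delta) f f1 f2 -> forall x,
    `|\sum_i \sum_(S : {set 'I_n} | i \notin S) shapley_weight S *
      swap_difference X Y (truncate gamma) gamma f f1 f2 S i x| <= bound x.
  by move=> tf x; exact: (swap_difference_truncate X Y d0 gamma0 tf x).
have := set_comparison n0 d0 indX indY indXY intX intY intXX intYY meanX meanY covXY
  C_large gamma0 delta0 gd measurable_truncate (mbad X) (mbad Y) (good X) (good Y)
  Lbound pw mA mB A0 Alb AB.
move=> /le_trans; apply; rewrite leeD2l// lee_fin RintegralZl//.
have ISE : \int[P]_x S x = \int[P]_x max_sum3 X x + \int[P]_x max_sum3 Y x.
  by rewrite -RintegralD.
move: (Pbad X LX) (Pbad Y LY); rewrite ISE.
move: (fine (P (bad X))) (fine (P (bad Y))).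
move: (\int[P]_x max_sum3 X x) (\int[P]_x max_sum3 Y x) => u v p q hp hq.
rewrite [leRHS](_ : _ = 4 * (gamma ^+ 2 * delta^-1) * u + 4 * (gamma ^+ 2 * delta^-1) * v +
  c3 * (C / delta * gamma ^+ 2) * (u + v)); last by ring.
by rewrite lerD2r lerD.
Qed.

(** With [tau] the identity nothing is truncated, so the bad events are empty and only the
    replacement bound remains. *)
Lemma comparison_low_moment (kappa := gamma `^ ((4 + 2 * iota) / 3) * delta `^ (- ((2 + iota) /
  3))) :
  ((kappa%:E * \sum_(i < n) Cmoment X Y i (2 + iota))%E < +oo)%E ->
  exists r, [/\ 0 <= r, (kappa%:E * \sum_(i < n) Cmoment X Y i (2 + iota) = r%:E)%E &
     comparison (13 * C * r)].
Proof.
move=> fin.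
have k0 : 0 < kappa by rewrite mulr_gt0 ?powR_gt0.
pose S i w := max_pow X i (2 + iota) w + max_pow Y i (2 + iota) w.
have S0 i x : 0 <= S i x by rewrite addr_ge0 ?max_pow_ge0.
have mS i : measurable_fun setT (S i) by apply: measurable_funD; exact: measurable_max_pow.
have E0 i : (0 <= 'E_P[S i])%E by apply: expectation_ge0.
have LS i : L1 P (S i).
  apply: L1_of_expectation => //; have [//|] := ltP ('E_P[S i])%E +oo%E.
  rewrite leye_eq => /eqP E; move: fin; rewrite (bigD1 i)//= {1}/Cmoment E.
  have s0 : (0 <= \sum_(l < n | l != i) Cmoment X Y l (2 + iota))%E by apply: sume_ge0 => l _;
    exact: E0.
  by rewrite addye ?gt0_muley// gt_eqF// (lt_le_trans ltNy0 s0).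
have sumE : (\sum_(i < n) Cmoment X Y i (2 + iota) = (\int[P]_x \sum_i S i x)%:E)%E.
  rewrite Rintegral_sum// -sumEFin; apply: eq_bigr => i _.
  by rewrite /Cmoment expectation_Rintegral//; exact: LS.
exists (kappa * \int[P]_x \sum_i S i x); split.
- rewrite mulr_ge0 ?(ltW k0)//; apply: Rintegral_ge0 => x _; exact: sumr_ge0.
- by rewrite sumE.
move=> A B mA mB A0 Alb AB.
pose bound x := 13 * C * (kappa * \sum_i S i x).
have Lsum : L1 P (fun x => \sum_i S i x) by exact: L1_sum.
have Lbound : L1 P bound by apply: L1Z; exact: L1Z.
have C1 : 1 <= C by move: C_large; lra.
have pw f f1 f2 : smooth_test gamma (C / delta) f f1 f2 -> forall x,
    `|\sum_i \sum_(S : {set 'I_n} | i \notin S) shapley_weight S *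
      swap_difference X Y id gamma f f1 f2 S i x| <= bound x.
  by move=> tf x; exact: (swap_difference_id X Y d0 gamma0 delta0 gd C1 iota01 tf x).
have good (Z : 'I_n -> {RV P >-> d.-tuple R}) x : ~ (set0 : set T) x -> forall j,
    `|\sum_i id (tnth (Z i x) j) - \sum_i tnth (Z i x) j| <= delta / 4.
  by move=> _ j; rewrite subrr normr0 ltW// divr_gt0.
have := set_comparison n0 d0 indX indY indXY intX intY intXX intYY meanX meanY covXY
  C_large gamma0 delta0 gd (@measurable_id _ _ _) measurable0 measurable0 (good X) (good Y)
  Lbound pw mA mB A0 Alb AB.
rewrite measure0 /= !add0r /bound RintegralZl//; last exact: L1Z.
by rewrite RintegralZl.
Qed.

End comparison_bounds.

(** * The coupling in the degenerate and the nondegenerate case *)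

Section coupling_cases.
Context dT (T : measurableType dT) {R : realType} (P : probability T R).
Context {n d : nat} (X Y : 'I_n -> {RV P >-> d.-tuple R}).
Hypotheses (n0 : (0 < n)%N) (d0 : (0 < d)%N).

(** All coordinates vanish almost surely. Markov's inequality for the sum of all squares, whose
    expectation is zero, makes this quantitative, and [max_sum Y] itself is already close to
    [max_sum X]. *)
Lemma degenerate_coupling (t : R) : 0 < t ->
  (forall i j, L1 P (fun x => tnth (X i x) j * tnth (X i x) j)) ->
  (forall i j, L1 P (fun x => tnth (Y i x) j * tnth (Y i x) j)) ->
  (forall i j, \int[P]_x (tnth (X i x) j * tnth (X i x) j) = 0) ->
  (forall i j, \int[P]_x (tnth (Y i x) j * tnth (Y i x) j) = 0) ->
  (P [set w | (t <= `|max_sum X w - max_sum Y w|)%R] <= 0)%E.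
Proof.
move=> t0 LX LY X0 Y0.
pose q i j x := tnth (X i x) j * tnth (X i x) j + tnth (Y i x) j * tnth (Y i x) j.
have q0 i j x : 0 <= q i j x by rewrite addr_ge0// -expr2 sqr_ge0.
have Lq i j : L1 P (q i j) by apply: L1D; [exact: LX|exact: LY].
have Iq i j : \int[P]_x q i j x = 0.
  by rewrite RintegralD//; [rewrite X0 Y0 addr0|exact: LX|exact: LY].
pose D x := \sum_i \sum_j q i j x.
have LD : L1 P D by apply: L1_sum => i; exact: L1_sum.
have ID : \int[P]_x D x = 0.
  rewrite Rintegral_sum; last by move=> i; exact: L1_sum.
  by rewrite big1// => i _; rewrite Rintegral_sum// big1.
have D0 x : 0 <= D x by apply: sumr_ge0 => i _; exact: sumr_ge0.
have nR : 0 < n%:R :> R by rewrite ltr0n.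
(* Each entry satisfies [|a| <= s + a * a / s]. The constant parts of [n] pairs add up to [t / 2],
   which leaves [t / 2] for the squares. *)
pose s := t / (4 * n%:R).
have s0 : 0 < s by rewrite divr_gt0// mulr_gt0.
have sn : 2 * s *+ n = t / 2.
  rewrite -mulr_natr /s; field; exact: lt0r_neq0.
have c0 : 0 < s * (t / 2) by rewrite mulr_gt0// divr_gt0.
have mD : measurable [set x | s * (t / 2) <= D x].
  exact: measurable_upper_level (L1_measurable LD).
have mXY : measurable [set w | t <= `|max_sum X w - max_sum Y w|].
  apply: measurable_upper_level; apply: measurableT_comp => //.
  by apply: measurable_funB; exact: measurable_max_sum.
apply: (@le_trans _ _ (P [set x | s * (t / 2) <= D x])).
  apply: le_measure; rewrite ?inE// => x /= tx; rewrite leNgt; apply/negP => Dx.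
  move: tx; apply/negP; rewrite -ltNge.
  have abs_le a : `|a| <= s + a * a / s.
    rewrite -(ler_pM2r s0) mulrDl divfK ?lt0r_neq0// -!expr2 -(real_normK (num_real a)).
    have := normr_ge0 a; have := sqr_ge0 (`|a| - s); rewrite sqrrB => h1 h2.
    have : 0 <= `|a| * s by rewrite mulr_ge0// ltW.
    by move: h1; lra.
  have dist : `|max_sum X x - max_sum Y x| <= t / 2 + D x / s.
    apply: vmax_dist => // j; rewrite -sumrB (le_trans (ler_norm_sum _ _ _))//.
    apply: (@le_trans _ _ (\sum_(i < n) (2 * s + q i j x / s))).
      apply: ler_sum => i _; rewrite (le_trans (ler_normB _ _))//.
      rewrite /q [(_ + _) / s]mulrDl.
      by have := abs_le (tnth (X i x) j); have := abs_le (tnth (Y i x) j); lra.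
    rewrite big_split/= sumr_const card_ord sn lerD2l -mulr_suml.
    rewrite ler_wpM2r ?invr_ge0 ?(ltW s0)//; apply: ler_sum => i _.
    by rewrite (bigD1 j)//= lerDl; exact: sumr_ge0.
  apply: (le_lt_trans dist); rewrite -ltrBrDl.
  rewrite (_ : t - t / 2 = t / 2); last by lra.
  by rewrite ltr_pdivrMr// mulrC.
rewrite -(fine_probability P mD) lee_fin (le_trans (markov_L1 c0 LD D0))//.
by rewrite ID mul0r.
Qed.

Hypothesis indXY : independent_families X Y.

(** [Z] is a function of the family [X] and [V] of the family [Y], hence they are independent. Only
    the law of [W] enters the construction, so drawing randomness from a coordinate of [Y] creates
    no conflict. With [h = delta / 2] the distance is [cgamma + 2 * delta], which turns the strict
    inequality into the large one at [3 * delta]. *)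
Lemma comparison_coupling (Z W V : {RV P >-> R}) (i : 'I_n) (j : 'I_d)
    (gamma delta theta e : R) :
  (forall x, Z x = max_sum X x) -> (forall x, W x = max_sum Y x) ->
  (forall x, V x = tnth (Y i x) j) ->
  (forall c, P (V @^-1` [set c]) = 0%E) ->
  0 < delta -> 0 <= theta -> 0 < e ->
  comparison X Y gamma delta theta ->
  exists Z' : {RV P >-> R}, same_law P Z' (max_sum Y) /\
    (P [set w | (cgamma d gamma + 3 * delta <= `|max_sum X w - Z' w|)%R]
      <= (theta + e)%:E)%E.
Proof.
move=> ZE WE VE Vatom delta0 theta0 e0 cmp.
have {}ZE : (Z : T -> R) = max_sum X by apply/funext.
have {}WE : (W : T -> R) = max_sum Y by apply/funext.
have ZV : independent_rvs P Z V.
  move=> A B mA mB.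
  pose G (t : n.-tuple (d.-tuple R)) := vmax (fun l => \sum_k tnth (tnth t k) l).
  pose H (t : n.-tuple (d.-tuple R)) := tnth (tnth t i) j.
  have mco k l : measurable_fun setT (fun t : n.-tuple (d.-tuple R) => tnth (tnth t k) l).
    exact: measurable_coord (measurable_tnth k).
  have mG : measurable_fun setT G.
    by apply: measurable_vmax => // l; exact: measurable_sum.
  have mH : measurable_fun setT H by exact: mco.
  have ZG : Z @^-1` A = joint X @^-1` (G @^-1` A).
    rewrite ZE (_ : max_sum X = G \o joint X)//; apply/funext => x /=.
    congr (vmax _); apply/funext => l; apply: eq_bigr => k _.
    by rewrite tnth_mktuple.
  have VH : V @^-1` B = joint Y @^-1` (H @^-1` B).
    by apply/seteqP; split => x /=; rewrite /H tnth_mktuple VE.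
  rewrite ZG VH; apply: indXY; rewrite -[_ @^-1` _]setTI; [exact: mG|exact: mH].
have h0 : 0 < delta / 2 by exact: divr_gt0.
have [|Z' [law PZ']] := @strassen_coupling _ _ _ P Z W V (cgamma d gamma + delta) theta
    (delta / 2) e theta0 h0 e0 Vatom ZV.
  by rewrite ZE WE.
exists Z'; rewrite -WE; split => //; apply: le_trans PZ'; rewrite -ZE.
have mZZ : measurable_fun setT (fun w => `|Z w - Z' w|).
  by apply: measurableT_comp => //; exact: measurable_funB.
apply: le_measure; rewrite ?inE.
- exact: measurable_upper_level.
- exact: measurable_strict_upper_level.
- by move=> x /=; apply: lt_le_trans; lra.
Qed.

End coupling_cases.

Lemma epsilon_gt0 (R : realType) (gamma delta : R) : 0 < gamma -> 0 < delta ->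
  0 < epsilon gamma delta.
Proof. by move=> g0 d0; rewrite /epsilon mulr_gt0 ?expR_gt0// mulr_gt0. Qed.

Theorem theorem1p1 (R : realType) :
  exists K : R, 0 < K /\
  forall (n d : nat) (iota : R),
    (1 <= n)%N -> (1 <= d)%N -> 0 <= iota <= 1 ->
  forall (disp : measure_display) (T : measurableType disp)
    (P : probability T R)
    (Sigma : 'M[R]_d) (X Y : 'I_n -> {RV P >-> d.-tuple R}),
    mutually_independent X ->
    (forall (i : 'I_n) (j : 'I_d), ('E_P[fun w => tnth (X i w) j] = 0)%E) ->
    (forall (i : 'I_n) (j : 'I_d),
      ('E_P[fun w => (`|tnth (X i w) j| `^ (2 + iota))%R] < +oo)%E) ->
    (forall (i : 'I_n) (j k : 'I_d),
      ('E_P[fun w => (tnth (X i w) j * tnth (X i w) k)%R] = (Sigma j k)%:E)%E) ->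
    mutually_independent Y ->
    independent_families X Y ->
    (forall i : 'I_n, is_gaussian_vector Sigma (Y i)) ->
  forall gamma delta : R,
    0 < delta -> 0 < gamma -> 1 < gamma * delta ->
    epsilon gamma delta < 1 ->
  exists Zdag : {RV P >-> R},
    same_law P Zdag (max_sum Y) /\
    (P [set w | (cgamma d gamma + 3 * delta <= `|max_sum X w - Zdag w|)%R]
     <= K%:E * (((epsilon gamma delta)%:E + Ln X Y gamma delta iota)
                * ((1 - epsilon gamma delta)^-1)%:E))%E.
Proof.
(* The constant is made opaque; every later estimate goes through this inequality. *)
have [C C_large] : exists C : R, 4000 <= C by exists 4000.
have C0 : 0 <= C by move: C_large; lra.
pose c3 : R := (13 * expR 2 ^+ 3 + 4) * expR 2.
have c30 : 0 <= c3 by rewrite mulr_ge0 ?addr_ge0 ?mulr_ge0 ?exprn_ge0 ?expR_ge0.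
pose K1 : R := 4 + C * c3; pose K2 : R := 13 * C.
have K10 : 0 <= K1 by rewrite addr_ge0// mulr_ge0.
have K20 : 0 <= K2 by rewrite mulr_ge0.
have K0 : 0 < 1 + K1 + K2 by rewrite -addrA ltr_pwDl// addr_ge0.
exists (1 + K1 + K2); split=> // n d iota n0 d0 iota01 disp T P Sigma X Y indX EX EXp EXX
  indY indXY gaussY gamma delta delta0 gamma0 gd1 eps1.
move: (epsilon_gt0 gamma0 delta0) eps1; move: (epsilon gamma delta) => e e0 e1.
have gd := ltW gd1; have /andP[iota0 _] := iota01.
have mX i j : measurable_fun setT (fun x => tnth (X i x) j) by exact: measurable_coord.
have L2 i j : L1 P (fun x => tnth (X i x) j ^+ 2) by exact: L1_sqr_of_powR (EXp i j).
have intX i j : L1 P (fun x => tnth (X i x) j) by exact: L1_of_sqr (L2 i j).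
have intXX i j k : L1 P (fun x => tnth (X i x) j * tnth (X i x) k) by exact: L1_mul_of_sqr.
have meanX i j : \int[P]_x tnth (X i x) j = 0.
  by apply/EFin_inj; rewrite -(expectation_Rintegral (intX i j)) EX.
have covX i j k : \int[P]_x (tnth (X i x) j * tnth (X i x) k) = Sigma j k.
  by apply/EFin_inj; rewrite -(expectation_Rintegral (intXX i j k)) EXX.
pose i0 : 'I_n := Ordinal n0.
have sym j k : Sigma j k = Sigma k j.
  by rewrite -!(covX i0); apply: eq_Rintegral => x _; rewrite mulrC.
have psd := second_moment_psd (intXX i0) (covX i0).
have intY i j := gaussian_integrable (gaussY i) psd j.
have intYY i j k := gaussian_mul_integrable (gaussY i) psd j k.
have meanY i j := gaussian_mean (gaussY i) psd j.
have covY i j k := gaussian_covariance (gaussY i) sym psd j k.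
have covXY i j k : \int[P]_x (tnth (X i x) j * tnth (X i x) k) =
  \int[P]_x (tnth (Y i x) j * tnth (Y i x) k) by rewrite covX covY.
pose Z : {RV P >-> R} := HB.pack (max_sum X)
  (isMeasurableFun.Build _ _ _ _ _ (measurable_max_sum d0 X)).
pose W : {RV P >-> R} := HB.pack (max_sum Y)
  (isMeasurableFun.Build _ _ _ _ _ (measurable_max_sum d0 Y)).
have cg0 : 0 <= cgamma d gamma.
  by rewrite /cgamma mulr_ge0 ?invr_ge0 ?(ltW gamma0)// ln_ge0// ler1n.
have i1 : 1 <= (1 - e)^-1 by rewrite invf_ge1 ?subr_gt0// gerBl ltW.
have i0' : 0 < (1 - e)^-1 by exact: lt_le_trans i1.
have [fin|] := ltP (Ln X Y gamma delta iota) +oo%E; last first.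
  (* If $L_n$ is infinite, so is the bound, and any copy of the Gaussian maximum will do. *)
  rewrite leye_eq => /eqP ->; exists W; split => //.
  by rewrite addey// gt0_mulye ?lte_fin// gt0_muley ?leey// lte_fin.
have [r [r0 LnE [theta /andP[theta0 theta_le] cmp]]] : exists r,
    [/\ 0 <= r, Ln X Y gamma delta iota = r%:E &
      exists2 theta, 0 <= theta <= (K1 + K2) * r & comparison X Y gamma delta theta].
  move: fin; rewrite /Ln.
  set t1 := (X in Order.min X _); set t2 := (X in Order.min _ X).
  have [_|_] := leP t1 t2 => fin.
    have [r [r0 rE cmp]] := comparison_third_moment n0 d0 indX indY indXY intX intY intXX intYY
      meanX meanY covXY C_large gamma0 delta0 gd fin.
    exists r; split => //; exists (K1 * r) => //.
    by rewrite mulr_ge0//= ler_wpM2r// lerDl.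
  have [r [r0 rE cmp]] := comparison_low_moment n0 d0 indX indY indXY intX intY intXX intYY
    meanX meanY covXY C_large gamma0 delta0 gd iota01 fin.
  exists r; split => //; exists (K2 * r) => //.
  by rewrite mulr_ge0//= ler_wpM2r// lerDr.
(* [e] is the slack spent on the tails; the summand 1 in the constant pays for it, and the factor
   [(1 - e)^-1] is at least 1. *)
have rhs0 : theta + e <= (1 + K1 + K2) * ((e + r) * (1 - e)^-1).
  apply: (@le_trans _ _ ((1 + K1 + K2) * (e + r))).
    have k0 : 0 <= (K1 + K2) * e by exact: mulr_ge0 (addr_ge0 K10 K20) (ltW e0).
    rewrite (_ : _ * _ = (K1 + K2) * r + e + (r + (K1 + K2) * e)); last by ring.
    by rewrite -[leLHS]addr0 lerD ?addr_ge0// lerD2r.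
  have er0 : 0 <= e + r by exact: addr_ge0 (ltW e0) r0.
  by rewrite ler_wpM2l ?(ltW K0)// -[leLHS]mulr1 ler_wpM2l.
rewrite LnE -EFinD -!EFinM.
have [/existsP[j sj]|/existsPn sj] := boolP [exists j, Sigma j j != 0].
  pose V : {RV P >-> R} := HB.pack (fun x => tnth (Y i0 x) j)
    (isMeasurableFun.Build _ _ _ _ _ (measurable_coord j (measurable_funP (Y i0)))).
  have Vatom c : P (V @^-1` [set c]) = 0%E.
    exact: (gaussian_coordinate_no_atom (gaussY i0) c sj).
  have [Z' [law PZ']] := @comparison_coupling _ _ _ P _ _ X Y d0 indXY Z W V i0 j gamma delta
    theta e
    (fun=> erefl) (fun=> erefl) (fun=> erefl) Vatom delta0 theta0 e0 cmp.
  exists Z'; split => //; apply: le_trans PZ' _; by rewrite lee_fin.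
(* All diagonal entries of [Sigma] vanish: no Gaussian coordinate is available as a source of
   randomness, but the Gaussian maximum itself is a suitable copy. *)
exists W; split => //; apply: le_trans.
  apply: degenerate_coupling => //.
  - by rewrite ltr_wpDl// mulr_gt0.
  - by move=> i j; rewrite covX; apply/eqP/negPn/sj.
  - by move=> i j; rewrite covY; apply/eqP/negPn/sj.
by rewrite lee_fin; apply: le_trans rhs0; rewrite addr_ge0// ltW.
Qed.
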